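(* Let $F$ be a number field with absolute Galois group $G_F=\mathrm{Gal}(\overline{F}/F)$, let $0_v$ be a tangential base point of $\mathbb{P}^1_F\setminus\{0,1,\infty\}$ supported at $0$, and let $\rho:G_F\to GL_d(\mathbb{Q})$ be a continuous representation with finite image. Then $\rho$ can be embedded, as a representation of $G_F$, into the space $\mathrm{Func}^{\mathrm{loc.const.}}(\pi_1^{\mathrm{\acute{e}t}}(\mathbb{P}^1_{\overline{F}}\setminus\{0,1,\infty\},0_v),\mathbb{Q})$ of locally constant $\mathbb{Q}$-valued functions on the étale fundamental group.
   Context: Tangential base points: let $v\in T_0\mathbb{P}^1_F$ be a non-zero tangent vector and let $t$ be a uniformizer of $\mathcal{O}_{\mathbb{P}^1_F,0}$ with $dt(v)=1$. This gives $\iota:\mathrm{Spec}\,F((t))\to\mathbb{P}^1_F\setminus\{0,1,\infty\}$. Restriction along $\mathrm{Spec}\,F((t))\to\mathrm{Spec}\,F[t,t^{-1}]=\mathbb{G}_{m,F}$ is an equivalence between finite étale covers of $\mathbb{G}_{m,F}$ and of $\mathrm{Spec}\,F((t))$. The tangential base point $0_v$ is the functor from finite étale covers of $\mathbb{P}^1_F\setminus\{0,1,\infty\}$ to finite étale covers of $\mathrm{Spec}\,F$ obtained by pulling back along $\iota$, applying the inverse of this equivalence, and taking the fiber at $t=1$ (independent of $t$ up to isomorphism). It yields a geometric fiber functor, hence the profinite group $\pi_1^{\mathrm{\acute{e}t}}(\mathbb{P}^1_{\overline{F}}\setminus\{0,1,\infty\},0_v)$ with a continuous action of $G_F$. $G_F$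 acts on functions on this group via its action on the group: $(\sigma f)(\gamma)=f(\sigma^{-1}(\gamma))$. *)

(* Defs.v *)
From HB Require Import structures.
From mathcomp Require Import all_boot all_order all_algebra all_field.
From mathcomp Require Import generic_quotient.
From mathcomp Require Import boolp classical_sets functions cardinality.
From mathcomp Require Import topology.

Set Implicit Arguments.
Unset Strict Implicit.
Unset Printing Implicit Defensive.

Import GRing.Theory.
Local Open Scope ring_scope.

(* The power series ring R[[x]]; a wrapper, because nat -> R already carries   *)
(* the pointwise ring structure.                                              *)
Record powser (R : Type) := Powser { scoef : nat -> R }.

Lemma powserP (R : Type) (a b : powser R) : scoef a =1 scoef b -> a = b.
Proof. by case: a b => [a] [b] /= /funext ->. Qed.

HB.instance Definition _ (R : Type) := gen_eqMixin (powser R).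
HB.instance Definition _ (R : Type) := gen_choiceMixin (powser R).

Section SeriesRing.
Variable R : comNzRingType.
Implicit Types a b c : powser R.

Definition powser_zero : powser R := Powser (fun _ => 0).
Definition powser_one : powser R := Powser (fun n => (n == 0%N)%:R).
Definition powser_opp a := Powser (fun n => - scoef a n).
Definition powser_add a b := Powser (fun n => scoef a n + scoef b n).
Definition powser_mul a b :=
  Powser (fun n => \sum_(i < n.+1) scoef a i * scoef b (n - i)).

Let trunc n a : {poly R} := \poly_(i < n.+1) scoef a i.

Let mulE n m a b : (m <= n)%N ->
  scoef (powser_mul a b) m = (trunc n a * trunc n b)`_m.
Proof.
move=> lemn; rewrite coefM; apply: eq_bigr => i _ /=.
rewrite !coef_poly !ltnS (leq_trans _ lemn) ?(leq_trans (leq_subr _ _)) //.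
by rewrite -ltnS.
Qed.

Let addA : associative powser_add.
Proof. by move=> a b c; apply: powserP => n /=; rewrite addrA. Qed.
Let addC : commutative powser_add.
Proof. by move=> a b; apply: powserP => n /=; rewrite addrC. Qed.
Let add0 : left_id powser_zero powser_add.
Proof. by move=> a; apply: powserP => n /=; rewrite add0r. Qed.
Let addN : left_inverse powser_zero powser_opp powser_add.
Proof. by move=> a; apply: powserP => n /=; rewrite addNr. Qed.

HB.instance Definition _ :=
  GRing.isZmodule.Build (powser R) addA addC add0 addN.

Let mulC : commutative powser_mul.
Proof. by move=> a b; apply: powserP => n; rewrite !(mulE _ _ (leqnn n)) mulrC. Qed.

Let mulA : associative powser_mul.
Proof.
move=> a b c; apply: powserP => n.
rewrite (mulE _ _ (leqnn n)) [RHS](mulE _ _ (leqnn n)).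
transitivity (trunc n a * (trunc n b * trunc n c))`_n.
  rewrite !coefM; apply: eq_bigr => i _; congr (_ * _).
  by rewrite [LHS]coef_poly ltnS leq_subr -mulE ?leq_subr.
rewrite mulrA !coefM; apply: eq_bigr => i _; congr (_ * _).
by rewrite [RHS]coef_poly ltn_ord (@mulE n) // -ltnS.
Qed.

Let mul1 : left_id powser_one powser_mul.
Proof.
move=> a; apply: powserP => n; rewrite (mulE _ _ (leqnn n)).
have ->: trunc n powser_one = 1.
  apply/polyP => i; rewrite coef_poly coef1 /=; case: ltnP => //.
  by case: i.
by rewrite mul1r coef_poly ltnSn.
Qed.

Let mulD : left_distributive powser_mul powser_add.
Proof.
move=> a b c; apply: powserP => n /=; rewrite -big_split; apply: eq_bigr => i _.
by rewrite mulrDl.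
Qed.

Let one_neq0 : powser_one != 0.
Proof. by apply/eqP => /(congr1 (fun a => scoef a 0)) /eqP; rewrite /= oner_eq0. Qed.

HB.instance Definition _ := GRing.Zmodule_isComNzRing.Build (powser R)
  mulA mulC mul1 mulD one_neq0.

Let unit : {pred powser R} := fun a => `[< exists b, b * a = 1 >].
Let inv a := if pselect (exists b, b * a = 1) is left h then projT1 (cid h) else a.

Let mulVs : {in unit, left_inverse 1 inv *%R}.
Proof.
move=> a /asboolP ua; rewrite /inv; case: pselect => // h.
by case: (cid h).
Qed.
Let unitPs : forall a b, b * a = 1 -> a \in unit.
Proof. by move=> a b ba; apply/asboolP; exists b. Qed.
Let invs_out : {in [predC unit], inv =1 id}.
Proof.
by move=> a /asboolP nua; rewrite /inv; case: pselect => // h.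
Qed.

HB.instance Definition _ := GRing.ComNzRing_hasMulInverse.Build (powser R)
  mulVs unitPs invs_out.

End SeriesRing.

Lemma powser_mulf_eq0 (R : idomainType) : GRing.integral_domain_axiom (powser R).
Proof.
move=> a b ab0; apply/negPn; rewrite negb_or; apply/negP => /andP[na nb].
have ex c : c != 0 :> powser R -> exists n, scoef c n != 0.
  move=> nc; apply: contrapT => H; case/negP: nc; apply/eqP/powserP => n /=.
  by apply/eqP/negPn/negP => h; apply: H; exists n.
case: (ex_minnP (ex a na)) => n an0 minn.
case: (ex_minnP (ex b nb)) => m bm0 minm.
have /eqP := congr1 (fun c => scoef c (n + m)) ab0; rewrite /= .
have ltn : (n < (n + m).+1)%N by rewrite ltnS leq_addr.
rewrite (bigD1 (Ordinal ltn)) //= addKn big1 ?addr0 ?mulf_eq0 ?(negPf an0) ?(negPf bm0) //.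
move=> j; rewrite -val_eqE /= => jn.
have [ltjn|] := ltnP j n.
  have -> : scoef a j = 0 by apply/eqP/negPn/negP => /minn; rewrite leqNgt ltjn.
  by rewrite mul0r.
rewrite leq_eqVlt eq_sym (negPf jn) /= => ltnj.
have -> : scoef b (n + m - j) = 0; last by rewrite mulr0.
apply/eqP/negPn/negP => /minm.
by rewrite leqNgt ltn_subLR ?ltn_add2r ?ltnj // -ltnS.
Qed.

HB.instance Definition _ (R : idomainType) :=
  GRing.ComUnitRing_isIntegral.Build (powser R) (@powser_mulf_eq0 R).

Section SeriesMaps.

Definition powser_map (R S : comNzRingType) (f : R -> S) (a : powser R) :=
  Powser (fun n => f (scoef a n)).

Section Map.
Variables (R S : comNzRingType) (f : {rmorphism R -> S}).

Fact powser_map_is_zmod_morphism : zmod_morphism (powser_map f).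
Proof. by move=> a b; apply: powserP => n /=; rewrite rmorphB. Qed.

Fact powser_map_is_monoid_morphism : monoid_morphism (powser_map f).
Proof.
split=> [|a b]; apply: powserP => n /=; first exact: rmorph_nat.
by rewrite rmorph_sum; apply: eq_bigr => i _; rewrite rmorphM.
Qed.

HB.instance Definition _ := GRing.isZmodMorphism.Build (powser R) (powser S)
  (powser_map f) powser_map_is_zmod_morphism.
HB.instance Definition _ := GRing.isMonoidMorphism.Build (powser R) (powser S)
  (powser_map f) powser_map_is_monoid_morphism.

Lemma powser_map_inj : injective f -> injective (powser_map f).
Proof.
move=> fI a b ab; apply: powserP => n; apply: fI.
exact: (congr1 (fun c => scoef c n) ab).
Qed.

End Map.

Variable R : comNzRingType.

Definition poly_powser (p : {poly R}) : powser R := Powser (fun n => p`_n).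

Fact poly_powser_is_zmod_morphism : zmod_morphism poly_powser.
Proof. by move=> p q; apply: powserP => n /=; rewrite coefB. Qed.

Fact poly_powser_is_monoid_morphism : monoid_morphism poly_powser.
Proof.
by split=> [|p q]; apply: powserP => n /=; rewrite ?coef1 ?coefM.
Qed.

HB.instance Definition _ := GRing.isZmodMorphism.Build {poly R} (powser R)
  poly_powser poly_powser_is_zmod_morphism.
HB.instance Definition _ := GRing.isMonoidMorphism.Build {poly R} (powser R)
  poly_powser poly_powser_is_monoid_morphism.

Lemma poly_powser_inj : injective poly_powser.
Proof. by move=> p q [pq]; apply/polyP => n; exact: (congr1 (@^~ n) pq). Qed.

End SeriesMaps.

Notation "{ 'laurent' K }" := {fraction (powser K)} (format "{ 'laurent'  K }").

Local Notation "x %:F" := (@FracField.tofrac _ x).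

Lemma fracE (D : idomainType) (z : {fraction D}) :
  {ab : D * D | ab.2 != 0 & z = ab.1%:F / ab.2%:F}.
Proof.
apply: cid2; have := reprK z; move: (generic_quotient.repr z) => r <-.
exists (frac r); first exact: denom_ratioP.
rewrite -[RHS]/(FracField.mul _ (FracField.inv _)) /FracField.tofrac; unlock.
rewrite -FracField.pi_inv -FracField.pi_mul.
rewrite /FracField.mulf /FracField.invf !numden_Ratio ?oner_eq0 //.
all: by rewrite ?mulr1 ?mul1r ?Ratio_numden ?denom_ratioP.
Qed.

Section FracMap.
Variables (D D' : idomainType) (f : {rmorphism D -> D'}).

Definition frac_map of injective f := fun z : {fraction D} =>
  let: exist2 ab _ _ := fracE z in (f ab.1)%:F / (f ab.2)%:F.

Hypothesis fI : injective f.

Lemma frac_mapE a b : b != 0 ->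
  frac_map fI (a%:F / b%:F) = (f a)%:F / (f b)%:F.
Proof.
have fn0 c : c != 0 -> (f c)%:F != 0.
  by rewrite tofrac_eq0 -(rmorph0 f) (inj_eq fI).
have Fn0 (c : D) : c != 0 -> c%:F != 0 by rewrite tofrac_eq0.
move=> b0; rewrite /frac_map; case: fracE => -[a' b'] /= b'0 /eqP.
rewrite eqr_div ?Fn0 // -!tofracM tofrac_eq => /eqP eab.
apply/eqP; rewrite eqr_div ?fn0 // -!tofracM -!rmorphM.
by rewrite eab.
Qed.

Lemma frac_map_tofrac a : frac_map fI a%:F = (f a)%:F.
Proof.
by have:= frac_mapE a (oner_neq0 D); rewrite !rmorph1 !divr1.
Qed.

Fact frac_map_is_zmod_morphism : zmod_morphism (frac_map fI).
Proof.
have fn0 c : c != 0 -> (f c)%:F != 0.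
  by rewrite tofrac_eq0 -(rmorph0 f) (inj_eq fI).
have Fn0 (c : D) : c != 0 -> c%:F != 0 by rewrite tofrac_eq0.
move=> z w; case: (fracE z) (fracE w) => -[a b] /= b0 -> [[a' b'] /= b'0 ->].
rewrite -mulNr addf_div ?Fn0 // -!tofracN -!tofracM -tofracD.
rewrite !frac_mapE ?mulf_neq0 // -mulNr addf_div ?fn0 //.
by rewrite rmorphD !rmorphM rmorphN -!tofracN -!tofracM -tofracD.
Qed.

Fact frac_map_is_monoid_morphism : monoid_morphism (frac_map fI).
Proof.
split=> [|z w]; first by rewrite -tofrac1 frac_map_tofrac rmorph1.
case: (fracE z) (fracE w) => -[a b] /= b0 -> [[a' b'] /= b'0 ->].
rewrite mulf_div -!tofracM !frac_mapE ?mulf_neq0 //.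
by rewrite !rmorphM mulf_div.
Qed.

HB.instance Definition _ := GRing.isZmodMorphism.Build {fraction D}
  {fraction D'} (frac_map fI) frac_map_is_zmod_morphism.
HB.instance Definition _ := GRing.isMonoidMorphism.Build {fraction D}
  {fraction D'} (frac_map fI) frac_map_is_monoid_morphism.

End FracMap.

Section Localization.
Variables (D : idomainType) (s : D).

(* D[1/s] inside Frac(D). Asking s ^+ n != 0 only matters for s = 0.          *)
Definition in_loc : {pred {fraction D}} := fun z =>
  `[< exists an : D * nat, s ^+ an.2 != 0 /\ z = an.1%:F / s%:F ^+ an.2 >].

Fact in_loc_subring : subring_closed in_loc.
Proof.
have Fn0 n : s ^+ n != 0 -> s%:F ^+ n != 0 by rewrite -tofracXn tofrac_eq0.
split.
- by apply/asboolP; exists (1, 0%N); rewrite tofrac1 !expr0 divr1 oner_neq0.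
- move=> z w /asboolP[[a n] /= [sn ->]] /asboolP[[b m] /= [sm ->]].
  apply/asboolP; exists (a * s ^+ m - b * s ^+ n, (n + m)%N) => /=.
  rewrite exprD mulf_neq0 //; split=> //.
  by rewrite -mulNr addf_div ?Fn0 // mulNr tofracB !tofracM !tofracXn exprD.
- move=> z w /asboolP[[a n] /= [sn ->]] /asboolP[[b m] /= [sm ->]].
  apply/asboolP; exists (a * b, (n + m)%N) => /=.
  by rewrite exprD mulf_neq0 //; split=> //; rewrite mulf_div tofracM exprD.
Qed.

HB.instance Definition _ :=
  GRing.isSubringClosed.Build {fraction D} in_loc in_loc_subring.

Record loc := Loc { loc_val : {fraction D}; _ : loc_val \in in_loc }.

HB.instance Definition _ := [isSub for loc_val].
HB.instance Definition _ := [Choice of loc by <:].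
HB.instance Definition _ := [SubChoice_isSubComNzRing of loc by <:].

Lemma locE (z : loc) :
  {an : D * nat | s ^+ an.2 != 0 & val z = an.1%:F / s%:F ^+ an.2}.
Proof. by apply: cid2; case: z => z /= /asboolP[an []]; exists an. Qed.

Fact loc_of_subproof a : a%:F \in in_loc.
Proof.
by apply/asboolP; exists (a, 0%N); rewrite /= !expr0 divr1 oner_neq0.
Qed.

Definition loc_of (a : D) : loc := Loc (loc_of_subproof a).

Fact loc_of_is_zmod_morphism : zmod_morphism loc_of.
Proof. by move=> a b; apply: val_inj; rewrite /= tofracB. Qed.

Fact loc_of_is_monoid_morphism : monoid_morphism loc_of.
Proof. by split=> [|a b]; apply: val_inj; rewrite /= ?tofrac1 ?tofracM. Qed.

HB.instance Definition _ := GRing.isZmodMorphism.Build D loc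
  loc_of loc_of_is_zmod_morphism.
HB.instance Definition _ := GRing.isMonoidMorphism.Build D loc
  loc_of loc_of_is_monoid_morphism.

Fact loc_inv_subproof : s%:F^-1 \in in_loc.
Proof.
have [->|s0] := eqVneq s 0.
  by rewrite tofrac0 invr0 -(tofrac0 D); exact: loc_of_subproof.
by apply/asboolP; exists (1, 1%N); rewrite /= !expr1 tofrac1 mul1r.
Qed.

Definition loc_inv : loc := Loc loc_inv_subproof.

Lemma loc_invK : s != 0 -> loc_of s * loc_inv = 1.
Proof. by move=> s0; apply: val_inj; rewrite /= divff ?tofrac_eq0. Qed.

Section Lift.
Variables (R : comPzRingType) (f : {rmorphism D -> R}) (y : R).

Definition loc_lift of f s * y = 1 := fun z : loc =>
  let: exist2 an _ _ := locE z in f an.1 * y ^+ an.2.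

Hypothesis fy : f s * y = 1.

Lemma loc_liftE (z : loc) a n : s ^+ n != 0 -> val z = a%:F / s%:F ^+ n ->
  loc_lift fy z = f a * y ^+ n.
Proof.
have Fn0 m : s ^+ m != 0 -> s%:F ^+ m != 0 by rewrite -tofracXn tofrac_eq0.
have fyX m : f s ^+ m * y ^+ m = 1 by rewrite -exprMn fy expr1n.
move=> sn ez; rewrite /loc_lift; case: locE => -[b m] /= sm /eqP.
rewrite ez eqr_div ?Fn0 // -!tofracXn -!tofracM tofrac_eq => /eqP /(congr1 f).
rewrite !rmorphM !rmorphXn => e.
rewrite -[LHS]mulr1 -(fyX n) mulrACA -e.
by rewrite -mulrA [f s ^+ m * _]mulrA fyX mul1r.
Qed.

Lemma loc_lift_of a : loc_lift fy (loc_of a) = f a.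
Proof.
by rewrite (@loc_liftE _ a 0) ?expr0 ?mulr1 ?oner_neq0 ?divr1.
Qed.

Fact loc_lift_is_zmod_morphism : zmod_morphism (loc_lift fy).
Proof.
have Fn0 m : s ^+ m != 0 -> s%:F ^+ m != 0 by rewrite -tofracXn tofrac_eq0.
have fyX m : f s ^+ m * y ^+ m = 1 by rewrite -exprMn fy expr1n.
move=> z w; case: (locE z) (locE w) => -[a n] /= sn ez [[b m] /= sm ew].
rewrite (loc_liftE sn ez) (loc_liftE sm ew).
rewrite (@loc_liftE _ (a * s ^+ m - b * s ^+ n) (n + m)).
- rewrite rmorphB !rmorphM !rmorphXn mulrBl exprD mulrACA fyX mulr1.
  by rewrite [y ^+ n * _]mulrC mulrACA fyX mulr1.
- by rewrite exprD mulf_neq0.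
rewrite rmorphB /= ez ew -mulNr addf_div ?Fn0 // mulNr.
by rewrite tofracB !tofracM !tofracXn exprD.
Qed.

Fact loc_lift_is_monoid_morphism : monoid_morphism (loc_lift fy).
Proof.
split=> [|z w]; first by rewrite -(rmorph1 loc_of) loc_lift_of rmorph1.
case: (locE z) (locE w) => -[a n] /= sn ez [[b m] /= sm ew].
rewrite (loc_liftE sn ez) (loc_liftE sm ew).
rewrite (@loc_liftE _ (a * b) (n + m)).
- by rewrite rmorphM exprD mulrACA.
- by rewrite exprD mulf_neq0.
by rewrite rmorphM /= ez ew mulf_div tofracM exprD.
Qed.

HB.instance Definition _ := GRing.isZmodMorphism.Build loc R
  (loc_lift fy) loc_lift_is_zmod_morphism.
HB.instance Definition _ := GRing.isMonoidMorphism.Build loc R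
  (loc_lift fy) loc_lift_is_monoid_morphism.

End Lift.

Lemma loc_ext (R : comPzRingType) (g h : {rmorphism loc -> R}) :
  s != 0 -> g \o loc_of =1 h \o loc_of -> g =1 h.
Proof.
move=> s0 gh z; case: (locE z) => -[a n] /= sn ez.
have -> : z = loc_of a * loc_inv ^+ n.
  by apply: val_inj; rewrite rmorphM rmorphXn /= ez exprVn.
rewrite !rmorphM !rmorphXn; congr (_ * _ ^+ _); first exact: gh.
have gs : g (loc_of s) * g loc_inv = 1 by rewrite -rmorphM loc_invK ?rmorph1.
have hs : h (loc_of s) * h loc_inv = 1 by rewrite -rmorphM loc_invK ?rmorph1.
have e : h (loc_of s) = g (loc_of s) by rewrite -[LHS]gh.
by rewrite -[LHS]mulr1 -hs e mulrCA mulrA gs mul1r.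
Qed.

End Localization.

Section FiniteEtale.

Definition formally_etale (R S : comPzRingType) (u : {rmorphism R -> S}) :=
  forall (T T0 : comPzRingType) (pi : {rmorphism T -> T0})
         (a : {rmorphism R -> T}) (b : {rmorphism S -> T0}),
    (forall y, exists x, pi x = y) ->
    (forall x y, pi x = 0 -> pi y = 0 -> x * y = 0) ->
    pi \o a =1 b \o u ->
  exists c : {rmorphism S -> T},
    [/\ c \o u =1 a, pi \o c =1 b &
        forall c' : {rmorphism S -> T},
          c' \o u =1 a -> pi \o c' =1 b -> c' =1 c].

(* For an algebra that is finite as a module, finite presentation as an       *)
(* algebra and finite presentation as a module are the same condition.        *)
Definition finitely_presented (R S : comPzRingType) (u : {rmorphism R -> S}) :=
  exists (m n : nat) (g : 'I_n -> S) (M : 'M[R]_(m, n)),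
    (forall z, exists r : 'rV[R]_n, z = \sum_j u (r 0 j) * g j) /\
    (forall r : 'rV[R]_n,
       \sum_j u (r 0 j) * g j = 0 <-> exists q : 'rV[R]_m, r = q *m M).

Definition finite_etale (R S : comPzRingType) (u : {rmorphism R -> S}) :=
  finitely_presented u /\ formally_etale u.

Definition is_pushout (A B C E : comPzRingType)
    (f : {rmorphism A -> B}) (g : {rmorphism A -> C})
    (b : {rmorphism B -> E}) (c : {rmorphism C -> E}) :=
  b \o f =1 c \o g /\
  forall (Z : comPzRingType) (b' : {rmorphism B -> Z}) (c' : {rmorphism C -> Z}),
    b' \o f =1 c' \o g ->
  exists h : {rmorphism E -> Z},
    [/\ h \o b =1 b', h \o c =1 c' &
        forall h' : {rmorphism E -> Z}, h' \o b =1 b' -> h' \o c =1 c' -> h' =1 h].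

Section Twist.
Variables (R S : comPzRingType) (u : {rmorphism R -> S}).
Variables (e e' : {rmorphism R -> R}) (ee' : cancel e e') (e'e : cancel e' e).

Lemma formally_etale_twist : formally_etale u -> formally_etale (u \o e).
Proof.
move=> eu T T0 pi a b pis pin pab.
have [|c [ca cb cu]] := eu T T0 pi (a \o e') b pis pin.
  by move=> x; rewrite /= -[in RHS](e'e x); apply: pab.
exists c; split=> //.
  by move=> x; rewrite /= -[in RHS](ee' x); apply: ca.
move=> c' c'a c'b; apply: cu => // x /=.
by rewrite -[in LHS](e'e x); apply: c'a.
Qed.

Lemma finitely_presented_twist :
  finitely_presented u -> finitely_presented (u \o e).
Proof.
move=> [m [n [g [M [gen rel]]]]].
have K1 (a b : nat) (r : 'M_(a, b)) : map_mx e (map_mx e' r) = r.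
  by apply/matrixP => j k; rewrite !mxE e'e.
have K2 (a b : nat) (r : 'M_(a, b)) : map_mx e' (map_mx e r) = r.
  by apply/matrixP => j k; rewrite !mxE ee'.
exists m, n, g, (map_mx e' M); split.
  move=> z; case: (gen z) => r ->; exists (map_mx e' r).
  by apply: eq_bigr => j _; rewrite /= mxE e'e.
move=> r; have := rel (map_mx e r).
under eq_bigr do rewrite mxE.
move=> ->; split=> [[q qM]|[q ->]].
  by exists (map_mx e' q); rewrite -map_mxM -qM K2.
by exists (map_mx e q); rewrite map_mxM K1.
Qed.

Lemma finite_etale_twist : finite_etale u -> finite_etale (u \o e).
Proof.
by move=> [p f]; split; [exact: finitely_presented_twist|exact: formally_etale_twist].
Qed.

End Twist.

Lemma is_pushout_twist (A B C E : comPzRingType)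
    (f : {rmorphism A -> B}) (g : {rmorphism A -> C})
    (b : {rmorphism B -> E}) (c : {rmorphism C -> E})
    (eA eA' : {rmorphism A -> A}) (eC eC' : {rmorphism C -> C}) :
    cancel eA' eA -> cancel eC eC' -> cancel eC' eC -> g \o eA =1 eC \o g ->
  is_pushout f g b c -> is_pushout (f \o eA) g b (c \o eC).
Proof.
move=> A'A CC' C'C gA [bc H]; split=> [x|Z b' c' b'c'].
  by rewrite /= -[eC _]gA; apply: bc.
have [x|h [hb hc hu]] := H Z b' (c' \o eC').
  have := b'c' (eA' x); rewrite /= A'A => ->.
  by rewrite -{2}(A'A x) -[g (eA _)]/((g \o eA) _) gA /= CC'.
exists h; split=> //.
  by move=> x; rewrite /= -[RHS](congr1 c' (CC' x)); apply: hc.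
move=> h' h'b h'c; apply: hu => // x /=.
by rewrite -[in LHS](C'C x); apply: h'c.
Qed.

End FiniteEtale.

(* x is the coordinate of P^1, so that v d/dx is a tangent vector at 0 for     *)
(* v : F. The parameter t = p / q is regular at 0 and vanishes there, and      *)
(* dt(v d/dx) = t'(0) v = 1 (hence t is a uniformizer).                        *)
Record tangential_base_point (F : fieldType) := TangentialBasePoint {
  tbp_vec : F;
  tbp_par : {fraction {poly F}};
  tbp_vec_neq0 : tbp_vec != 0;
  tbp_par_dual : exists p q : {poly F},
    [/\ tbp_par = p%:F / q%:F, q.[0] != 0, p.[0] = 0 &
        (p^`().[0] * q.[0] - p.[0] * q^`().[0]) / q.[0] ^+ 2 * tbp_vec = 1]
}.

Lemma tbp_par_neq0 (F : fieldType) (bp : tangential_base_point F) :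
  tbp_par bp != 0.
Proof.
case: (tbp_par_dual bp) => p [q [-> q0 p0 d1]].
have pn0 : p != 0.
  apply: contra_eq_neq d1 => ->; rewrite deriv0 !horner0 !mul0r subr0 !mul0r.
  by rewrite eq_sym oner_neq0.
have qn0 : q != 0 by apply: contraNneq q0 => ->; rewrite horner0.
by rewrite mulf_neq0 ?invr_eq0 ?tofrac_eq0.
Qed.

Section Rings.
Variable L : fieldType.

(* The coordinate rings L[x, 1/x, 1/(1-x)] and L[T, 1/T].                     *)
Definition P1_minus3 := loc ('X * (1 - 'X) : {poly L}).
Definition Gm := loc ('X : {poly L}).

HB.instance Definition _ := GRing.ComNzRing.on P1_minus3.
HB.instance Definition _ := GRing.ComNzRing.on Gm.

Definition laurent_of_poly : {rmorphism {poly L} -> {laurent L}} :=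
  (@FracField.tofrac (powser L)) \o (@poly_powser L).

Lemma laurent_of_poly_eq0 p : (laurent_of_poly p == 0) = (p == 0).
Proof.
rewrite /= tofrac_eq0 -(rmorph0 (@poly_powser L)).
by rewrite (inj_eq (@poly_powser_inj L)).
Qed.

Lemma X1X_neq0 : 'X * (1 - 'X) != 0 :> {poly L}.
Proof.
rewrite mulf_neq0 ?polyX_eq0 // -opprB oppr_eq0.
by rewrite -size_poly_gt0 size_XsubC.
Qed.

Fact iotaX_subproof : laurent_of_poly ('X * (1 - 'X)) *
  (laurent_of_poly ('X * (1 - 'X)))^-1 = 1.
Proof. by rewrite divff // laurent_of_poly_eq0 X1X_neq0. Qed.

Definition iotaX : {rmorphism P1_minus3 -> {laurent L}} :=
  loc_lift iotaX_subproof.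

Definition laurent_const : {rmorphism L -> {laurent L}} :=
  laurent_of_poly \o polyC.

Definition laurent_subst (t : {laurent L}) : {rmorphism {poly L} -> {laurent L}} :=
  horner_eval t \o map_poly laurent_const.

Fact iotaG_subproof t : t != 0 -> laurent_subst t 'X * t^-1 = 1.
Proof.
by move=> t0; rewrite /= map_polyX /horner_eval hornerX divff.
Qed.

(* L[T, 1/T] -> L((x)), T |-> t.                                             *)
Definition iotaG (t : {laurent L}) (t0 : t != 0) : {rmorphism Gm -> {laurent L}} :=
  loc_lift (iotaG_subproof t0).

Fact eval1_subproof : horner_eval (1 : L) 'X * 1 = 1.
Proof. by rewrite /horner_eval hornerX mulr1. Qed.

Definition eval1 : {rmorphism Gm -> L} := loc_lift eval1_subproof.

End Rings.

Arguments laurent_of_poly {L}.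
Arguments laurent_const {L}.
Arguments iotaX {L}.
Arguments eval1 {L}.

(* Semilinear automorphisms induced by s : L -> L, fixing the coordinates.     *)
Section Coefficients.
Variables (L : fieldType) (s : {rmorphism L -> L}).

Fact map_X1X : map_poly s ('X * (1 - 'X)) = 'X * (1 - 'X).
Proof. by rewrite rmorphM rmorphB rmorph1 /= map_polyX. Qed.

Fact coefX_subproof :
  (@loc_of _ ('X * (1 - 'X)) \o map_poly s) ('X * (1 - 'X)) * loc_inv _ = 1.
Proof. by rewrite /= map_X1X loc_invK ?X1X_neq0. Qed.

Definition coefX : {rmorphism P1_minus3 L -> P1_minus3 L} :=
  loc_lift coefX_subproof.

Fact coefG_subproof : (@loc_of _ 'X \o map_poly s) 'X * loc_inv _ = 1.
Proof. by rewrite /= map_polyX loc_invK ?polyX_eq0. Qed.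

Definition coefG : {rmorphism Gm L -> Gm L} := loc_lift coefG_subproof.

Definition coefK : {rmorphism {laurent L} -> {laurent L}} :=
  frac_map (powser_map_inj (fmorph_inj s)).

Lemma coefK_poly p : coefK (laurent_of_poly p) = laurent_of_poly (map_poly s p).
Proof.
rewrite /coefK /= frac_map_tofrac; congr (_%:F).
by apply: powserP => n /=; rewrite coef_map.
Qed.

Lemma coefK_iotaX : iotaX \o coefX =1 coefK \o iotaX.
Proof.
apply: loc_ext => [|p]; first exact: X1X_neq0.
by rewrite /= !loc_lift_of -coefK_poly.
Qed.

Lemma coefK_iotaG (t : {laurent L}) (t0 : t != 0) : coefK t = t ->
  iotaG t0 \o coefG =1 coefK \o iotaG t0.
Proof.
move=> st; apply: loc_ext => [|p]; first by rewrite polyX_eq0.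
rewrite /= !loc_lift_of /= /horner_eval.
rewrite -[RHS]/(coefK _) -horner_map /= st -!map_poly_comp.
congr (horner _ t); apply: eq_map_poly => x /=.
by have := coefK_poly x%:P; rewrite map_polyC /= => ->.
Qed.

Lemma coefG_eval1 : eval1 \o coefG =1 s \o eval1.
Proof.
apply: loc_ext => [|p]; first by rewrite polyX_eq0.
rewrite /= !loc_lift_of /= /horner_eval.
by rewrite -{1}(rmorph1 s) horner_map.
Qed.

End Coefficients.

Section CoefficientsComp.
Variables (L : fieldType) (s r q : {rmorphism L -> L}).

Lemma coefX_id : s =1 id -> coefX s =1 id.
Proof.
move=> s1; apply: (@loc_ext _ _ _ (coefX s) idfun) => [|p]; first exact: X1X_neq0.
by rewrite /= !loc_lift_of /= (@eq_map_poly _ _ _ idfun) ?map_poly_id.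
Qed.

Lemma coefG_id : s =1 id -> coefG s =1 id.
Proof.
move=> s1; apply: (@loc_ext _ _ _ (coefG s) idfun) => [|p].
  by rewrite polyX_eq0.
by rewrite /= !loc_lift_of /= (@eq_map_poly _ _ _ idfun) ?map_poly_id.
Qed.

Lemma coefK_id : s =1 id -> coefK s =1 id.
Proof.
move=> s1 z; case: (fracE z) => -[a b] /= b0 ->.
rewrite !rmorphM !fmorphV /= !frac_map_tofrac.
by congr (_%:F / _%:F); apply: powserP => n /=; rewrite s1.
Qed.

Lemma coefX_comp : s \o r =1 q -> coefX s \o coefX r =1 coefX q.
Proof.
move=> sr; apply: loc_ext => [|p]; first exact: X1X_neq0.
by rewrite /= !loc_lift_of /= -map_poly_comp (eq_map_poly sr).
Qed.

Lemma coefG_comp : s \o r =1 q -> coefG s \o coefG r =1 coefG q.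
Proof.
move=> sr; apply: loc_ext => [|p]; first by rewrite polyX_eq0.
by rewrite /= !loc_lift_of /= -map_poly_comp (eq_map_poly sr).
Qed.

Lemma coefK_comp : s \o r =1 q -> coefK s \o coefK r =1 coefK q.
Proof.
move=> sr z; case: (fracE z) => -[a b] /= b0 ->.
rewrite !rmorphM !fmorphV /= !frac_map_tofrac.
by congr (_%:F / _%:F); apply: powserP => n /=; rewrite -sr.
Qed.

End CoefficientsComp.

Section CoefficientsInv.
Variables (L : fieldType) (s s' : {rmorphism L -> L}) (ss' : cancel s s').

Let s's : s' \o s =1 idfun.
Proof. exact: ss'. Qed.

Lemma coefXK : cancel (coefX s) (coefX s').
Proof. by move=> z; rewrite -[RHS](coefX_id (frefl idfun)); exact: coefX_comp. Qed.

Lemma coefGK : cancel (coefG s) (coefG s').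
Proof. by move=> z; rewrite -[RHS](coefG_id (frefl idfun)); exact: coefG_comp. Qed.

Lemma coefKK : cancel (coefK s) (coefK s').
Proof. by move=> z; rewrite -[RHS](coefK_id (frefl idfun)); exact: coefK_comp. Qed.

End CoefficientsInv.

Lemma rmorphism_ext (R S : pzSemiRingType) (f g : {rmorphism R -> S}) :
  f =1 g -> f = g.
Proof.
case: f g => f [[a] [b]] [g [[c] [d]]] /= /funext fg.
case: _ / fg c d => c d.
by rewrite (Prop_irrelevance a c) (Prop_irrelevance b d).
Qed.

Section AbsoluteGaloisGroup.
Variables (F L : fieldType) (i : {rmorphism F -> L}).

Record absgal := AbsGal {
  gal_fun :> {rmorphism L -> L};
  gal_fix : forall x, gal_fun (i x) = i x;
  gal_bij : bijective gal_fun
}.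

HB.instance Definition _ := gen_eqMixin absgal.
HB.instance Definition _ := gen_choiceMixin absgal.

Lemma absgal_ext (s r : absgal) : s =1 r -> s = r.
Proof.
case: s r => s sf sb [r rf rb] /= /rmorphism_ext sr.
case: _ / sr rf rb => rf rb.
by rewrite (Prop_irrelevance sf rf) (Prop_irrelevance sb rb).
Qed.

Definition gal_one : absgal :=
  @AbsGal idfun (fun=> erefl) (Bijective (frefl _) (frefl _)).

Fact gal_mul_fix (s r : absgal) x : (s \o r) (i x) = i x.
Proof. by rewrite /= !gal_fix. Qed.

Definition gal_mul (s r : absgal) : absgal :=
  @AbsGal (s \o r) (gal_mul_fix s r) (bij_comp (gal_bij s) (gal_bij r)).

Section Inverse.
Variable s : absgal.

Fact gal_surj y : exists x, s x = y.
Proof. by case: (gal_bij s) => g _ gK; exists (g y). Qed.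

Definition gal_inv_fun y := sval (cid (gal_surj y)).

Fact gal_inv_funK : cancel gal_inv_fun s.
Proof. by move=> y; rewrite /gal_inv_fun; case: (cid _). Qed.

Fact gal_funK : cancel s gal_inv_fun.
Proof. by move=> x; apply: (fmorph_inj s); rewrite gal_inv_funK. Qed.

Fact gal_inv_fun_is_zmod_morphism : zmod_morphism gal_inv_fun.
Proof.
by move=> x y; apply: (fmorph_inj s); rewrite rmorphB !gal_inv_funK.
Qed.

Fact gal_inv_fun_is_monoid_morphism : monoid_morphism gal_inv_fun.
Proof.
split=> [|x y]; apply: (fmorph_inj s).
  by rewrite rmorph1 gal_inv_funK.
by rewrite rmorphM !gal_inv_funK.
Qed.

HB.instance Definition _ := GRing.isZmodMorphism.Build L L
  gal_inv_fun gal_inv_fun_is_zmod_morphism.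
HB.instance Definition _ := GRing.isMonoidMorphism.Build L L
  gal_inv_fun gal_inv_fun_is_monoid_morphism.

Fact gal_inv_fix x : gal_inv_fun (i x) = i x.
Proof. by rewrite -{1}(gal_fix s x) gal_funK. Qed.

Definition gal_inv : absgal :=
  @AbsGal gal_inv_fun gal_inv_fix (Bijective gal_inv_funK gal_funK).

End Inverse.

Fact gal_mulA : associative gal_mul.
Proof. by move=> s r q; apply: absgal_ext. Qed.
Fact gal_mul1g : left_id gal_one gal_mul.
Proof. by move=> s; apply: absgal_ext. Qed.
Fact gal_mulg1 : right_id gal_one gal_mul.
Proof. by move=> s; apply: absgal_ext. Qed.
Fact gal_mulVg : left_inverse gal_one gal_inv gal_mul.
Proof. by move=> s; apply: absgal_ext => x; rewrite /= gal_funK. Qed.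
Fact gal_mulgV : right_inverse gal_one gal_inv gal_mul.
Proof. by move=> s; apply: absgal_ext => x; rewrite /= gal_inv_funK. Qed.

HB.instance Definition _ := isGroup.Build absgal
  gal_mulA gal_mul1g gal_mulg1 gal_mulVg gal_mulgV.

Lemma galK (s : absgal) : cancel s (s^-1)%g.
Proof. exact: gal_funK. Qed.

Lemma galVK (s : absgal) : cancel (s^-1)%g s.
Proof. exact: gal_inv_funK. Qed.

(* Krull topology: pointwise agreement on finite subsets of L.                *)
Definition absgal_open (U : set absgal) :=
  forall s, U s -> exists X : seq L, forall r : absgal, {in X, r =1 s} -> U r.

Fact absgal_openT : absgal_open setT.
Proof. by move=> s _; exists [::]. Qed.

Fact absgal_openI : setI_closed absgal_open.
Proof.
move=> U V oU oV s [/oU [X HX] /oV [Y HY]]; exists (X ++ Y) => r H.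
by split; [apply: HX|apply: HY] => x xX; apply: H; rewrite mem_cat xX ?orbT.
Qed.

Fact absgal_open_bigU (I : Type) (f : I -> set absgal) :
  (forall i, absgal_open (f i)) -> absgal_open (\bigcup_i f i)%classic.
Proof.
move=> of_ s [k _ /of_ [X HX]]; exists X => r /HX fr; exists k => //.
Qed.

HB.instance Definition _ := isOpenTopological.Build absgal
  absgal_openT absgal_openI absgal_open_bigU.

End AbsoluteGaloisGroup.

Section FundamentalGroup.
Variables (F L : fieldType) (i : {rmorphism F -> L}).
Variable bp : tangential_base_point F.

Fact tpar_subproof : injective (@poly_powser L \o map_poly i).
Proof.
by apply: inj_comp; [exact: poly_powser_inj|exact: map_poly_inj].
Qed.

Definition tpar : {laurent L} := frac_map tpar_subproof (tbp_par bp).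

Fact tpar_neq0 : tpar != 0.
Proof. by rewrite fmorph_eq0 tbp_par_neq0. Qed.

Fact tpar_coefK (s : absgal i) : coefK s tpar = tpar.
Proof.
rewrite /tpar; case: (fracE (tbp_par bp)) => -[a b] /= b0 ->.
rewrite !fmorph_div /= !frac_map_tofrac.
by congr (_%:F / _%:F); apply: powserP => n; rewrite /= !coef_map /= gal_fix.
Qed.

(* A finite etale cover Spec cov_X of P^1 - {0,1,oo} over L, together with its *)
(* image under the inverse of the equivalence FEt(Gm) -> FEt(Spec L((x))): a   *)
(* finite etale cover Spec cov_G of Gm whose pullback along T |-> t is         *)
(* identified, through the common algebra cov_K, with the pullback of          *)
(* Spec cov_X along iota. As FEt(Gm) -> FEt(Spec L((x))) is an equivalence for *)
(* L algebraically closed of characteristic 0, forgetting all but cov_X is an  *)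
(* equivalence from the category of these data onto FEt(P^1 - {0,1,oo}).       *)
(* All schemes involved are affine, so they are given by their rings; pullbacks*)
(* of covers are pushouts of rings, and arrows are reversed.                   *)
Record fet_cover := FetCover {
  cov_X : comPzRingType;
  cov_G : comPzRingType;
  cov_K : comPzRingType;
  str_X : {rmorphism P1_minus3 L -> cov_X};
  str_G : {rmorphism Gm L -> cov_G};
  str_K : {rmorphism {laurent L} -> cov_K};
  res_X : {rmorphism cov_X -> cov_K};
  res_G : {rmorphism cov_G -> cov_K};
  cov_X_etale : finite_etale str_X;
  cov_G_etale : finite_etale str_G;
  cov_X_pushout : is_pushout str_X iotaX res_X str_K;
  cov_G_pushout : is_pushout str_G (iotaG tpar_neq0) res_G str_K
}.

Record fet_cover_hom (Y Y' : fet_cover) := FetCoverHom {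
  hom_X : {rmorphism cov_X Y -> cov_X Y'};
  hom_G : {rmorphism cov_G Y -> cov_G Y'};
  hom_K : {rmorphism cov_K Y -> cov_K Y'};
  hom_X_str : hom_X \o str_X Y =1 str_X Y';
  hom_G_str : hom_G \o str_G Y =1 str_G Y';
  hom_K_str : hom_K \o str_K Y =1 str_K Y';
  hom_X_res : hom_K \o res_X Y =1 res_X Y' \o hom_X;
  hom_G_res : hom_K \o res_G Y =1 res_G Y' \o hom_G
}.

(* The fiber of Spec cov_G -> Gm above the L-point T = 1.                     *)
Record fiber_point (Y : fet_cover) := FiberPoint {
  fiber_point_fun :> {rmorphism cov_G Y -> L};
  fiber_point_over : fiber_point_fun \o str_G Y =1 eval1
}.

Lemma fiber_point_ext Y (p q : fiber_point Y) : p =1 q -> p = q.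
Proof.
case: p q => p po [q qo] /= /rmorphism_ext pq.
by case: _ / pq qo => qo; rewrite (Prop_irrelevance po qo).
Qed.

Fact pull_over Y Y' (f : fet_cover_hom Y Y') (p : fiber_point Y') :
  (p \o hom_G f) \o str_G Y =1 eval1.
Proof. by move=> z; rewrite -(fiber_point_over p) /= -(hom_G_str f). Qed.

Definition pull Y Y' (f : fet_cover_hom Y Y') (p : fiber_point Y') : fiber_point Y :=
  FiberPoint (pull_over f p).

(* The automorphism group of the fiber functor. Its elements are              *)
(* families indexed by the large type of all covers, which live in too large   *)
(* a universe for groupType and topologicalType; the group law and the         *)
(* topology are therefore given directly.                                      *)
Record pi1 := Pi1 {
  pi1_fun :> forall Y, fiber_point Y -> fiber_point Y;
  pi1_nat : forall Y Y' (f : fet_cover_hom Y Y') (p : fiber_point Y'),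
    pi1_fun (pull f p) = pull f (pi1_fun p);
  pi1_bij : forall Y, bijective (@pi1_fun Y)
}.

Lemma pi1_ext (g h : pi1) : (forall Y (p : fiber_point Y), g Y p = h Y p) -> g = h.
Proof.
case: g h => g gn gb [h hn hb] /= gh.
have e : g = h.
  by apply: functional_extensionality_dep => Y; apply: funext => p; exact: gh.
case: _ / e hn hb {gh} => hn hb.
by rewrite (Prop_irrelevance gn hn) (Prop_irrelevance gb hb).
Qed.

Definition pi1_one : pi1 :=
  @Pi1 (fun Y p => p) (fun _ _ _ _ => erefl)
       (fun Y => Bijective (frefl _) (frefl _)).

Fact pi1_mul_nat (g h : pi1) Y Y' (f : fet_cover_hom Y Y') (p : fiber_point Y') :
  g Y (h Y (pull f p)) = pull f (g Y' (h Y' p)).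
Proof. by rewrite !pi1_nat. Qed.

Definition pi1_mul (g h : pi1) : pi1 :=
  @Pi1 (fun Y => g Y \o h Y) (pi1_mul_nat g h)
       (fun Y => bij_comp (pi1_bij g Y) (pi1_bij h Y)).

Section Inverse.
Variable g : pi1.

Fact pi1_surj Y (q : fiber_point Y) : exists p, g Y p = q.
Proof. by case: (pi1_bij g Y) => h _ gK; exists (h q). Qed.

Definition pi1_inv_fun Y (q : fiber_point Y) := sval (cid (pi1_surj q)).

Fact pi1_inv_funK Y : cancel (@pi1_inv_fun Y) (g Y).
Proof. by move=> q; rewrite /pi1_inv_fun; case: (cid _). Qed.

Fact pi1_funK Y : cancel (g Y) (@pi1_inv_fun Y).
Proof. by move=> p; apply: (bij_inj (pi1_bij g Y)); rewrite pi1_inv_funK. Qed.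

Fact pi1_inv_nat Y Y' (f : fet_cover_hom Y Y') (p : fiber_point Y') :
  pi1_inv_fun (pull f p) = pull f (pi1_inv_fun p).
Proof.
by apply: (bij_inj (pi1_bij g Y)); rewrite pi1_nat !pi1_inv_funK.
Qed.

Definition pi1_inv : pi1 :=
  @Pi1 pi1_inv_fun pi1_inv_nat
       (fun Y => Bijective (@pi1_inv_funK Y) (@pi1_funK Y)).

End Inverse.

Fact pi1_mulA : associative pi1_mul.
Proof. by move=> g h k; apply: pi1_ext. Qed.
Fact pi1_mul1g : left_id pi1_one pi1_mul.
Proof. by move=> g; apply: pi1_ext. Qed.
Fact pi1_mulg1 : right_id pi1_one pi1_mul.
Proof. by move=> g; apply: pi1_ext. Qed.
Fact pi1_mulVg : left_inverse pi1_one pi1_inv pi1_mul.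
Proof. by move=> g; apply: pi1_ext => Y p; rewrite /= pi1_funK. Qed.
Fact pi1_mulgV : right_inverse pi1_one pi1_inv pi1_mul.
Proof. by move=> g; apply: pi1_ext => Y p; rewrite /= pi1_inv_funK. Qed.

(* Profinite topology: the fibers are finite and discrete.                    *)
Definition pi1_open (U : pi1 -> Prop) :=
  forall g, U g -> exists n (Y : 'I_n -> fet_cover),
    forall h : pi1, (forall k (p : fiber_point (Y k)), h _ p = g _ p) -> U h.

Definition pi1_locally_constant (T : Type) (f : pi1 -> T) :=
  forall g, exists U, [/\ pi1_open U, U g & forall h, U h -> f h = f g].

(* The conjugate cover: same rings, structure maps twisted by s on scalars.    *)
(* This uses that t has coefficients in F (tpar_coefK). twist_point is the    *)
(* bijection of fibers, and G_F acts on pi1 by transport of structure.         *)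
Section Twist.
Variables (s : absgal i) (Y : fet_cover).
Let s' : absgal i := (s^-1)%g.

Fact twist_X_etale : finite_etale (str_X Y \o coefX s').
Proof.
exact: (finite_etale_twist (coefXK (galVK s)) (coefXK (galK s)) (cov_X_etale Y)).
Qed.

Fact twist_G_etale : finite_etale (str_G Y \o coefG s').
Proof.
exact: (finite_etale_twist (coefGK (galVK s)) (coefGK (galK s)) (cov_G_etale Y)).
Qed.

Fact twist_X_pushout :
  is_pushout (str_X Y \o coefX s') iotaX (res_X Y) (str_K Y \o coefK s').
Proof.
exact: (is_pushout_twist (coefXK (galK s)) (coefKK (galVK s))
  (coefKK (galK s)) (coefK_iotaX s') (cov_X_pushout Y)).
Qed.

Fact twist_G_pushout :
  is_pushout (str_G Y \o coefG s') (iotaG tpar_neq0) (res_G Y)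
    (str_K Y \o coefK s').
Proof.
exact: (is_pushout_twist (coefGK (galK s)) (coefKK (galVK s))
  (coefKK (galK s)) (coefK_iotaG tpar_neq0 (tpar_coefK s')) (cov_G_pushout Y)).
Qed.

Definition twist : fet_cover :=
  FetCover twist_X_etale twist_G_etale twist_X_pushout twist_G_pushout.

Fact twist_point_over (p : fiber_point Y) : (s \o p) \o str_G twist =1 eval1.
Proof.
move=> z; have e := etrans (fiber_point_over p (coefG s' z)) (coefG_eval1 s' z).
exact: etrans (congr1 s e) (galVK s _).
Qed.

Definition twist_point (p : fiber_point Y) : fiber_point twist := @FiberPoint twist (s \o p) (twist_point_over p).

Fact untwist_point_over (q : fiber_point twist) : (s' \o q) \o str_G Y =1 eval1.
Proof.
move=> z; have := fiber_point_over q (coefG s z).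
rewrite /= [coefG _ (coefG s z)](coefGK (galK s)) => ->.
by rewrite [eval1 _](coefG_eval1 s z) /= galK.
Qed.

Definition untwist_point (q : fiber_point twist) : fiber_point Y := @FiberPoint Y (s' \o q) (untwist_point_over q).

Lemma twist_pointK : cancel twist_point untwist_point.
Proof. by move=> p; apply: fiber_point_ext => z; rewrite /= galK. Qed.

Lemma untwist_pointK : cancel untwist_point twist_point.
Proof. by move=> p; apply: fiber_point_ext => z; rewrite /= galVK. Qed.

End Twist.

Section TwistHom.
Variables (s : absgal i) (Y Y' : fet_cover) (f : fet_cover_hom Y Y').

Definition twist_hom : fet_cover_hom (twist s Y) (twist s Y').
Proof.
apply: (@FetCoverHom (twist s Y) (twist s Y') (hom_X f) (hom_G f) (hom_K f)) => z.
- by rewrite /= -[hom_X f _]/((hom_X f \o str_X Y) _) hom_X_str.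
- by rewrite /= -[hom_G f _]/((hom_G f \o str_G Y) _) hom_G_str.
- by rewrite /= -[hom_K f _]/((hom_K f \o str_K Y) _) hom_K_str.
- exact: (hom_X_res f z).
- exact: (hom_G_res f z).
Defined.

Lemma twist_point_pull (p : fiber_point Y') : twist_point s (pull f p) = pull twist_hom (twist_point s p).
Proof. exact: fiber_point_ext. Qed.

Lemma untwist_point_pull (p : fiber_point (twist s Y')) :
  untwist_point (pull twist_hom p) = pull f (untwist_point p).
Proof. exact: fiber_point_ext. Qed.

End TwistHom.

Section Action.
Variables (s : absgal i) (g : pi1).
Let s' : absgal i := (s^-1)%g.

Definition pi1_act_fun Y (p : fiber_point Y) : fiber_point Y :=
  untwist_point (g (twist s' Y) (twist_point s' p)).

Fact pi1_act_nat Y Y' (f : fet_cover_hom Y Y') (p : fiber_point Y') :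
  pi1_act_fun (pull f p) = pull f (pi1_act_fun p).
Proof. by rewrite /pi1_act_fun (twist_point_pull s') pi1_nat untwist_point_pull. Qed.

Fact pi1_act_bij Y : bijective (@pi1_act_fun Y).
Proof.
have sb : bijective (@twist_point s' Y) by exists (@untwist_point s' Y); [exact: twist_pointK|exact: untwist_pointK].
have ub : bijective (@untwist_point s' Y) by exists (@twist_point s' Y); [exact: untwist_pointK|exact: twist_pointK].
exact: bij_comp ub (bij_comp (pi1_bij g _) sb).
Qed.

Definition pi1_act : pi1 := Pi1 pi1_act_nat pi1_act_bij.

End Action.

Definition func_act (T : Type) (s : absgal i) (f : pi1 -> T) : pi1 -> T :=
  fun g => f (pi1_act (s^-1)%g g).

Lemma pi1_act_mul (s : absgal i) (g h : pi1) :
  pi1_act s (pi1_mul g h) = pi1_mul (pi1_act s g) (pi1_act s h).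
Proof.
apply: pi1_ext => Y p; rewrite /= /pi1_act_fun /=; congr untwist_point.
by rewrite untwist_pointK.
Qed.

Section TwistAction.
Variables (s r q : absgal i) (Y : fet_cover).

Hypothesis s1 : s =1 id.

Let sV1 : (s^-1)%g =1 id.
Proof. by move=> x; rewrite -{1}[x]s1 galK. Qed.

Fact twist1_X : str_X Y =1 str_X (twist s Y).
Proof. by move=> z; rewrite /= [coefX _ z](coefX_id sV1). Qed.
Fact twist1_G : str_G Y =1 str_G (twist s Y).
Proof. by move=> z; rewrite /= [coefG _ z](coefG_id sV1). Qed.
Fact twist1_K : str_K Y =1 str_K (twist s Y).
Proof. by move=> z; rewrite /= [coefK _ z](coefK_id sV1). Qed.

Definition twist1_hom : fet_cover_hom Y (twist s Y) :=
  @FetCoverHom Y (twist s Y) idfun idfun idfun twist1_X twist1_G twist1_K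
    (frefl _) (frefl _).

Hypothesis srq : s \o r =1 q.

Let srqV : (r^-1)%g \o (s^-1)%g =1 (q^-1)%g.
Proof. by move=> x; apply: (fmorph_inj q); rewrite galVK -srq /= !galVK. Qed.

Fact twistM_X : str_X (twist s (twist r Y)) =1 str_X (twist q Y).
Proof. by move=> z; rewrite /= -[coefX (q^-1)%g z](coefX_comp srqV). Qed.
Fact twistM_G : str_G (twist s (twist r Y)) =1 str_G (twist q Y).
Proof. by move=> z; rewrite /= -[coefG (q^-1)%g z](coefG_comp srqV). Qed.
Fact twistM_K : str_K (twist s (twist r Y)) =1 str_K (twist q Y).
Proof. by move=> z; rewrite /= -[coefK (q^-1)%g z](coefK_comp srqV). Qed.

Definition twistM_hom : fet_cover_hom (twist s (twist r Y)) (twist q Y) :=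
  @FetCoverHom (twist s (twist r Y)) (twist q Y) idfun idfun idfun
    twistM_X twistM_G twistM_K (frefl _) (frefl _).

End TwistAction.

Lemma pi1_act1 (g : pi1) : pi1_act 1%g g = g.
Proof.
apply: pi1_ext => Y p; rewrite /= /pi1_act_fun.
have s1 : (1^-1 : absgal i)%g =1 id by rewrite invg1.
have {2}-> : p = pull (twist1_hom Y s1) (twist_point (1^-1)%g p).
  by apply: fiber_point_ext => z; exact: (esym (s1 (p z))).
have sVV : ((1^-1)^-1 : absgal i)%g =1 id by rewrite !invg1.
by rewrite pi1_nat; apply: fiber_point_ext => z; exact: sVV.
Qed.

Lemma pi1_actM (s r : absgal i) (g : pi1) :
  pi1_act (s * r)%g g = pi1_act s (pi1_act r g).
Proof.
apply: pi1_ext => Y p; rewrite /= /pi1_act_fun /= /pi1_act_fun.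
have sr : (r^-1)%g \o (s^-1)%g =1 ((s * r)^-1)%g by rewrite invgM.
have srV : ((s * r)^-1^-1)%g =1 (s^-1^-1)%g \o (r^-1^-1)%g by rewrite !invgK.
have -> : twist_point (r^-1)%g (twist_point (s^-1)%g p) =
    pull (twistM_hom Y sr) (twist_point ((s * r)^-1)%g p).
  by apply: fiber_point_ext => z; exact: sr.
by rewrite pi1_nat; apply: fiber_point_ext => z; exact: srV.
Qed.

End FundamentalGroup.

Definition is_representation (G : groupType) (d : nat) (rho : G -> 'M[rat]_d) :=
  (forall s, rho s \in unitmx) /\
  (forall s r, rho (s * r)%g = rho s *m rho r).

Definition embeds_in_Func_loc_const (F L : fieldType) (i : {rmorphism F -> L})
    (bp : tangential_base_point F) (d : nat) (rho : absgal i -> 'M[rat]_d) :=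
  exists e : 'cV[rat]_d -> (pi1 i bp -> rat),
    [/\ forall u, pi1_locally_constant (e u),
        forall (a : rat) u v, e (a *: u + v) = fun g => a * e u g + e v g,
        injective e &
        forall s u, e (rho s *m u) = func_act s (e u)].

(* Main.v *)
(* Let X in Fbar be finite such that elements of G_F fixing X lie in the kernel
   of rho, and b in Fbar such that an element of G_F fixing b fixes X. The points
   b + k, k < d, lie in distinct orbits, so a vector u defines a function on Fbar,
   s (b + k) |-> (rho s^-1 u)_k and 0 elsewhere, depending equivariantly and
   injectively on u. It remains to find a locally constant equivariant map alpha
   from pi_1 to Fbar whose image contains the points b + k.

   By Belyi's theorem, in the variant where the points are sent to 0, there is a
   rational function P / Q over the rational numbers, etale over P^1 - {0,1,oo},
   with zeros at the points b + k and a rational simple zero a. Its fiber at 0_v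
   maps to the set of zeros of P: if P / Q = k (z - c)^e + ... at a zero c, then
   the corresponding component of the counterpart of the cover on G_m is
   T = (k / v) s^e. As a is simple and rational, the fiber has a Galois-invariant
   point p above a, and alpha sends g to the zero under g p.

   That alpha hits every zero is the transitivity of pi_1 on the fiber of a
   connected cover. The fiber is identified with the points of the cover in a
   large algebraically closed field containing L((t)), by means of a place
   extending the constant term of power series in T - 1; the automorphisms of
   the large field over L(t) permute these points transitively. *)
Require Import Defs.
From HB Require Import structures.
From mathcomp Require Import all_boot all_order all_algebra all_field.
From mathcomp Require Import boolp classical_sets functions cardinality.
From mathcomp Require Import topology filter ring.

Set Implicit Arguments.
Unset Strict Implicit.
Unset Printing Implicit Defensive.

Import GRing.Theory.
Local Open Scope ring_scope.
Local Open Scope classical_set_scope.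

(** The fiber at a tangential base point above 0 sees only what lies over 0, which is why the points
    b + k are made zeros of the Belyi function. A zero of multiplicity e carries e points of the
    fiber, the solutions of s^e = v / k, and Galois may permute them when e > 1: hence the demand
    for a simple rational zero, where v / k is the only solution.

    The pieces of the Belyi cover over the curve, over G_m and over the punctured disc are written
    down explicitly, and every series chosen on the way (a local branch, an e-th root) is normalized
    so as to be unique. Galois equivariance of the cover then reduces to uniqueness.

    For transitivity there is a mismatch: the punctured disc is centred at T = 0, whereas the fiber
    is taken at T = 1. An automorphism of an algebraic closure of L(x), carrying t to 1 + x, is
    therefore interposed before the place is applied. It acts on algebraic functions only, not on
    Laurent series, so that this closure is kept apart from the larger field containing L((x)). *)

Lemma rmorphism_exists (R S : pzRingType) (f : R -> S) :
  zmod_morphism f -> monoid_morphism f -> exists g : {rmorphism R -> S}, g =1 f.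
Proof.
move=> fB fM.
pose a := GRing.isZmodMorphism.Build R S f fB.
pose m := GRing.isMonoidMorphism.Build R S f fM.
pose g : {rmorphism R -> S} := HB.pack f a m.
by exists g.
Qed.

(** * Quotients, products and ultraproducts of rings *)

Record ideal (R : comPzRingType) := Ideal {
  ideal_set :> R -> Prop;
  ideal0 : ideal_set 0;
  idealB : forall x y, ideal_set x -> ideal_set y -> ideal_set (x - y);
  idealM : forall a x, ideal_set x -> ideal_set (a * x)
}.

Section Quotient.
Variables (R : comPzRingType) (J : ideal R).

Let idealN x : J x -> J (- x).
Proof. by move=> Jx; rewrite -[- x]add0r; apply: idealB => //; apply: ideal0. Qed.
Let idealD x y : J x -> J y -> J (x + y).
Proof. by move=> Jx Jy; rewrite -[y]opprK; apply: idealB => //; apply: idealN. Qed.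

(** [choose] depends only on the predicate, so congruent elements get the same representative and
    the quotient can be the type of representatives. The ideal may be the unit ideal, hence a
    quotient that is allowed to be the zero ring. *)
Definition ideal_rep (x : R) : R := choose (fun y => `[< J (x - y) >]) x.

Let repP x : J (x - ideal_rep x).
Proof.
apply/asboolP/(@chooseP _ (fun y => `[< J (x - y) >])).
by apply/asboolP; rewrite subrr; exact: ideal0.
Qed.

Let rep_eq x y : J (x - y) -> ideal_rep x = ideal_rep y.
Proof.
move=> Jxy; rewrite /ideal_rep.
have -> : (fun z => `[< J (x - z) >]) = (fun z => `[< J (y - z) >]).
  apply: funext => z; apply/asboolP/asboolP => H.
    by rewrite -(subrKA x) -opprB; apply: idealD => //; exact: idealN.
  by rewrite -(subrKA y); apply: idealD.
apply: choose_id; apply/asboolP; last by rewrite subrr; exact: ideal0.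
by rewrite -opprB; exact: idealN.
Qed.

Definition iquot := {x : R | ideal_rep x == x}.
HB.instance Definition _ := Choice.on iquot.

Let rep_idem x : ideal_rep (ideal_rep x) == ideal_rep x.
Proof. by apply/eqP/rep_eq; rewrite -opprB; exact/idealN/repP. Qed.

Definition iquot_pi (x : R) : iquot := exist _ (ideal_rep x) (rep_idem x).

Lemma iquot_piK (z : iquot) : iquot_pi (sval z) = z.
Proof. by apply: val_inj; apply/eqP/(valP z). Qed.

Lemma iquot_piP x y : iquot_pi x = iquot_pi y <-> J (x - y).
Proof.
split=> [[e]|/rep_eq e]; last exact: val_inj.
rewrite -(subrKA (ideal_rep x)); apply: idealD; first exact: repP.
by rewrite e -opprB; exact/idealN/repP.
Qed.

Let z0 := iquot_pi 0.
Let opp (a : iquot) := iquot_pi (- sval a).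
Let add (a b : iquot) := iquot_pi (sval a + sval b).
Let one := iquot_pi 1.
Let mul (a b : iquot) := iquot_pi (sval a * sval b).

Let addE x y : add (iquot_pi x) (iquot_pi y) = iquot_pi (x + y).
Proof.
apply/iquot_piP; rewrite opprD addrACA /=.
by apply: idealD; rewrite -opprB; exact/idealN/repP.
Qed.
Let mulE x y : mul (iquot_pi x) (iquot_pi y) = iquot_pi (x * y).
Proof.
apply/iquot_piP => /=; set x' := ideal_rep x; set y' := ideal_rep y.
have -> : x' * y' - x * y = - (y' * (x - x') + x * (y - y')).
  by ring.
by apply/idealN/idealD; apply/idealM/repP.
Qed.
Let oppE x : opp (iquot_pi x) = iquot_pi (- x).
Proof. by apply/iquot_piP => /=; rewrite opprK addrC; exact: repP. Qed.

Let addA : associative add.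
Proof.
by move=> a b c; rewrite -(iquot_piK a) -(iquot_piK b) -(iquot_piK c) !addE addrA.
Qed.
Let addC : commutative add.
Proof. by move=> a b; rewrite /add addrC. Qed.
Let add0 : left_id z0 add.
Proof. by move=> a; rewrite -(iquot_piK a) addE add0r. Qed.
Let addN : left_inverse z0 opp add.
Proof. by move=> a; rewrite -(iquot_piK a) oppE addE addNr. Qed.
HB.instance Definition _ := GRing.isZmodule.Build iquot addA addC add0 addN.

Let mulA : associative mul.
Proof.
by move=> a b c; rewrite -(iquot_piK a) -(iquot_piK b) -(iquot_piK c) !mulE mulrA.
Qed.
Let mulC : commutative mul.
Proof. by move=> a b; rewrite /mul mulrC. Qed.
Let mul1 : left_id one mul.
Proof. by move=> a; rewrite -(iquot_piK a) mulE mul1r. Qed.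
Let mulD : left_distributive mul add.
Proof.
move=> a b c; rewrite -(iquot_piK a) -(iquot_piK b) -(iquot_piK c).
by rewrite !(addE, mulE) mulrDl.
Qed.
HB.instance Definition _ :=
  GRing.Zmodule_isComPzRing.Build iquot mulA mulC mul1 mulD.

Fact iquot_pi_is_zmod_morphism : zmod_morphism iquot_pi.
Proof. by move=> x y; rewrite -addE -oppE. Qed.
Fact iquot_pi_is_monoid_morphism : monoid_morphism iquot_pi.
Proof. by split=> // x y; rewrite -mulE. Qed.
HB.instance Definition _ :=
  GRing.isZmodMorphism.Build R iquot iquot_pi iquot_pi_is_zmod_morphism.
HB.instance Definition _ :=
  GRing.isMonoidMorphism.Build R iquot iquot_pi iquot_pi_is_monoid_morphism.

Lemma iquot_pi_eq0 x : iquot_pi x = 0 <-> J x.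
Proof. by rewrite -(rmorph0 iquot_pi) iquot_piP subr0. Qed.

End Quotient.

(** The index [i0] is carried by the type as a witness that the family is nonempty, which makes the
    product a nonzero ring canonically. *)
Record dprod (I : Type) (i0 : I) (R : I -> comNzRingType) :=
  DProd { dcomp : forall i, R i }.
Arguments DProd {I i0 R} dcomp.

Section DependentProduct.
Variables (I : Type) (i0 : I) (R : I -> comNzRingType).
Implicit Types a b c : dprod i0 R.

Lemma dprodP a b : (forall i, dcomp a i = dcomp b i) -> a = b.
Proof.
by case: a b => a [b] /= ab; congr DProd; exact: functional_extensionality_dep.
Qed.

HB.instance Definition _ := gen_eqMixin (dprod i0 R).
HB.instance Definition _ := gen_choiceMixin (dprod i0 R).

Let add a b : dprod i0 R := DProd (fun i => dcomp a i + dcomp b i).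
Let opp a : dprod i0 R := DProd (fun i => - dcomp a i).
Let mul a b : dprod i0 R := DProd (fun i => dcomp a i * dcomp b i).

Let addA : associative add.
Proof. by move=> a b c; apply: dprodP => i; rewrite /= addrA. Qed.
Let addC : commutative add.
Proof. by move=> a b; apply: dprodP => i; rewrite /= addrC. Qed.
Let add0 : left_id (DProd (fun i => 0)) add.
Proof. by move=> a; apply: dprodP => i; rewrite /= add0r. Qed.
Let addN : left_inverse (DProd (fun i => 0)) opp add.
Proof. by move=> a; apply: dprodP => i; rewrite /= addNr. Qed.
HB.instance Definition _ := GRing.isZmodule.Build (dprod i0 R) addA addC add0 addN.

Let mulA : associative mul.
Proof. by move=> a b c; apply: dprodP => i; rewrite /= mulrA. Qed.
Let mulC : commutative mul.
Proof. by move=> a b; apply: dprodP => i; rewrite /= mulrC. Qed.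
Let mul1 : left_id (DProd (fun i => 1)) mul.
Proof. by move=> a; apply: dprodP => i; rewrite /= mul1r. Qed.
Let mulD : left_distributive mul add.
Proof. by move=> a b c; apply: dprodP => i; rewrite /= mulrDl. Qed.
Let one_neq0 : DProd (fun i => 1) != 0 :> dprod i0 R.
Proof. by apply/eqP => /(congr1 (fun a => dcomp a i0)) /eqP; rewrite oner_eq0. Qed.
HB.instance Definition _ :=
  GRing.Zmodule_isComNzRing.Build (dprod i0 R) mulA mulC mul1 mulD one_neq0.

Section Projection.
Variable i : I.
Definition dproj (a : dprod i0 R) : R i := dcomp a i.
Fact dproj_is_zmod_morphism : zmod_morphism dproj.
Proof. by []. Qed.
Fact dproj_is_monoid_morphism : monoid_morphism dproj.
Proof. by []. Qed.
HB.instance Definition _ :=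
  GRing.isZmodMorphism.Build (dprod i0 R) (R i) dproj dproj_is_zmod_morphism.
HB.instance Definition _ :=
  GRing.isMonoidMorphism.Build (dprod i0 R) (R i) dproj dproj_is_monoid_morphism.
End Projection.

End DependentProduct.

Section FieldOfRing.
Variables (R : comPzRingType) (R1 : 1 != 0 :> R).
Hypothesis RV : forall x : R, x <> 0 -> exists y, y * x = 1.

Definition fring (_ : 1 != 0 :> R) (_ : forall x : R, x <> 0 -> exists y, y * x = 1)
  : Type := R.
Local Notation T := (fring R1 RV).
HB.instance Definition _ := GRing.ComPzRing.on T.
HB.instance Definition _ := GRing.PzSemiRing_isNonZero.Build T R1.

Let inv (x : T) : T :=
  if pselect (x <> 0) is left h then sval (cid (RV h)) else 0.
Let mulVx (x : T) : x != 0 -> inv x * x = 1.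
Proof.
move=> /eqP x0; rewrite /inv; case: pselect => // h; exact: (svalP (cid (RV h))).
Qed.
Let inv0 : inv 0 = 0.
Proof. by rewrite /inv; case: pselect. Qed.
HB.instance Definition _ := GRing.ComNzRing_isField.Build T mulVx inv0.

Lemma field_of_ring : exists (E : fieldType) (f : {rmorphism R -> E}), injective f.
Proof. by exists (T : fieldType), (idfun : {rmorphism R -> R}). Qed.

End FieldOfRing.

(** * A field in which all polynomials over a given field split *)

Definition splits (K E : fieldType) (h : {rmorphism K -> E}) (p : {poly K}) :=
  exists rs : seq E, map_poly h p = \prod_(r <- rs) ('X - r%:P).

Lemma splits_comp (K E E' : fieldType) (h : {rmorphism K -> E})
    (h' : {rmorphism E -> E'}) (p : {poly K}) :
  splits h p -> splits (h' \o h) p.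
Proof.
move=> [rs e]; exists [seq h' r | r <- rs].
rewrite map_poly_comp e rmorph_prod big_map; apply: eq_bigr => r _.
by rewrite rmorphB /= map_polyX map_polyC.
Qed.

Lemma exists_irreducible_factor (K : fieldType) (p : {poly K}) :
  (1 < size p)%N -> exists2 q, irreducible_poly q & q %| p.
Proof.
move=> p1; pose P n := `[< exists q : {poly K}, [/\ (1 < size q)%N, q %| p & size q = n] >].
have exP : exists n, P n by exists (size p); apply/asboolP; exists p.
case: (ex_minnP exP) => n /asboolP[q [q1 qp <-]] qmin.
exists q => //; split=> // r r1 rq.
have q0 : q != 0 by rewrite -size_poly_gt0 (ltn_trans _ q1).
have r0 : r != 0 by apply: contraNneq q0 => r0; rewrite -dvd0p -r0.
rewrite -dvdp_size_eqp // eqn_leq dvdp_leq //= qmin //.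
apply/asboolP; exists r; split=> //; last exact: dvdp_trans qp.
by rewrite ltn_neqAle eq_sym r1 size_poly_gt0.
Qed.

Lemma splitting_field (K : fieldType) (p : {poly K}) : p \is monic ->
  exists (E : fieldType) (h : {rmorphism K -> E}), splits h p.
Proof.
have [n] := ubnP (size p); elim: n K p => // n IHn K p /ltnSE lepn pm.
have [p1|] := leqP (size p) 1.
  exists K, idfun, [::]; rewrite big_nil map_poly_id //.
  have /size_poly1P[c _ pc] : size p == 1 by rewrite eqn_leq p1 size_poly_gt0 monic_neq0.
  by move: pm; rewrite pc monicE lead_coefC => /eqP ->.
move=> /exists_irreducible_factor[q /irredp_FAdjoin[F _ [z qz _]] qp].
pose h : {rmorphism K -> F} := in_alg F.
have /factor_theorem[r pr] : root (map_poly h p) z.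
  by apply: root_dvdp qz; rewrite dvdp_map.
have rm : r \is monic by rewrite -(monicMr _ (monicXsubC z)) -pr map_monic.
have [|E [h' [rs e]]] := IHn F r _ rm.
  apply: leq_trans lepn; rewrite -(size_map_poly h) pr size_Mmonic ?monicXsubC ?monic_neq0 //.
  by rewrite size_XsubC addn2.
exists E, (h' \o h), (h' z :: rs).
by rewrite map_poly_comp pr rmorphM /= e rmorphB /= map_polyX map_polyC big_cons mulrC.
Qed.

Lemma splitting_field_seq (K : fieldType) (s : seq {poly K}) :
  exists (E : fieldType) (h : {rmorphism K -> E}),
    forall p, p \in s -> p \is monic -> splits h p.
Proof.
elim: s => [|p s [E [h IH]]]; first by exists K, idfun.
have [pm|npm] := boolP (p \is monic); last first.
  exists E, h => q; rewrite inE => /predU1P[->|/IH //]; by rewrite (negPf npm).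
have [|E' [h' sp]] := @splitting_field E (map_poly h p); first by rewrite map_monic.
exists E', (h' \o h) => q; rewrite inE => /predU1P[->|/IH qs qm].
  by case: sp => rs; rewrite -map_poly_comp; exists rs.
by apply: splits_comp; exact: qs.
Qed.

Section Ultraproduct.
Variable K : fieldType.
Local Notation I := (seq {poly K}).
Let E (s : I) : fieldType := projT1 (cid (splitting_field_seq s)).
Let h (s : I) : {rmorphism K -> E s} := projT1 (cid (projT2 (cid (splitting_field_seq s)))).
Let hP s p : p \in s -> p \is monic -> splits (@h s) p.
Proof. exact: (projT2 (cid (projT2 (cid (splitting_field_seq s))))). Qed.

Let cones : set_system I := fun A => exists t : I, forall s : I, {subset t <= s} -> A s.

Let cones_proper : ProperFilter cones.
Proof.
apply: Build_ProperFilter_ex; first by move=> A [t tA]; exists t; exact: tA.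
split; first by exists [::].
- move=> A B [t tA] [u uB]; exists (t ++ u) => s tus.
  by split; [apply: tA|apply: uB] => x xs; apply: tus; rewrite mem_cat xs ?orbT.
- by move=> A B AB [t tA]; exists t => s /tA /AB.
Qed.

(** Finitely many polynomials split in some extension. The ultraproduct of these extensions, along
    an ultrafilter containing every cone of finite lists above a given list, is a field in which all
    of them split: the degree of [p] is fixed, so its roots are finitely many elements of the
    product, taken componentwise. *)
Lemma exists_splitting_field : exists (Om : fieldType) (j : {rmorphism K -> Om}),
  forall p, p \is monic -> splits j p.
Proof.
have [U [UU cU]] := ultraFilterLemma cones_proper.
pose D := dprod ([::] : I) (fun s => E s : comNzRingType).
have J0 : U [set s | dcomp (0 : D) s = 0].
  by apply: filterS filterT.
have JB (x y : D) : U [set s | dcomp x s = 0] -> U [set s | dcomp y s = 0] ->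
    U [set s | dcomp (x - y) s = 0].
  by apply: filterS2 => s /= -> ->; rewrite subr0.
have JM (a x : D) : U [set s | dcomp x s = 0] -> U [set s | dcomp (a * x) s = 0].
  by apply: filterS => s /= ->; rewrite mulr0.
pose J := Ideal J0 JB JM.
have Q1 : 1 != 0 :> iquot J.
  apply/eqP; rewrite -(rmorph1 (@iquot_pi _ J)) => /iquot_pi_eq0 /= U0.
  have [s /= /eqP] := filter_ex U0; by rewrite oner_eq0.
have QV (x : iquot J) : x <> 0 -> exists y, y * x = 1.
  rewrite -(iquot_piK x); move: (sval x) => {}x nx.
  exists (iquot_pi J (DProd (fun s => (dcomp x s)^-1))).
  rewrite -rmorphM -(rmorph1 (@iquot_pi _ J)); apply/iquot_piP => /=.
  have [|Un0] := @in_ultra_setVsetC _ U [set s | dcomp x s = 0] UU.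
    by move=> Us; case: nx; apply/(@iquot_pi_eq0 _ J).
  apply: filterS Un0 => s /= /eqP xs.
  by rewrite mulVf // subrr.
have [Om [f fI]] := field_of_ring Q1 QV.
pose g : {rmorphism D -> Om} := f \o @iquot_pi _ J.
have g0 x : U [set s | dcomp x s = 0] -> g x = 0.
  by move=> Ux; rewrite /g /= (iffRL (@iquot_pi_eq0 _ J x) Ux) rmorph0.
have [||d dE] := @rmorphism_exists K D (fun x => DProd (fun s => @h s x)).
- by move=> x y; apply: dprodP => s /=; rewrite rmorphB.
- by split=> [|x y]; apply: dprodP => s /=; rewrite ?rmorph1 ?rmorphM.
exists Om, (g \o d) => p pm.
pose R s : seq (E s) := if pselect (p \in s) is left ps then projT1 (cid (hP ps pm)) else [::].
pose n := (size p).-1.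
pose r k : D := DProd (fun s => nth 0 (R s) k).
exists [seq g (r k) | k <- iota 0 n].
have -> : \prod_(r0 <- [seq g (r k) | k <- iota 0 n]) ('X - r0%:P) =
    map_poly g (\prod_(k <- iota 0 n) ('X - (r k)%:P)).
  rewrite rmorph_prod big_map; apply: eq_bigr => k _.
  by rewrite rmorphB /= map_polyX map_polyC.
rewrite map_poly_comp; apply/polyP => k; rewrite !coef_map.
apply/eqP; rewrite -subr_eq0 -rmorphB; apply/eqP/g0; apply: cU.
exists [:: p] => s /(_ p); rewrite inE eqxx => /(_ isT) ps /=.
set P1 := map_poly d p; set P2 := \prod_(_ <- _) _.
suff e : map_poly (@dproj I [::] (fun s => E s : comNzRingType) s) P1 = map_poly (@dproj _ _ _ s) P2.
  by have := congr1 (fun q : {poly E s} => q`_k) e; rewrite !coef_map /= /dproj => ->; rewrite subrr.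
have RP : map_poly (@h s) p = \prod_(x <- R s) ('X - x%:P).
  by rewrite /R; case: pselect => // ps'; case: (cid _).
have sR : size (R s) = n.
  by rewrite /n -(size_map_poly (@h s)) RP size_prod_XsubC.
have -> : map_poly (@dproj _ _ _ s) P1 = map_poly (@h s) p.
  rewrite /P1 -map_poly_comp; apply: eq_map_poly => x.
  by rewrite /= dE.
rewrite RP /P2 rmorph_prod (big_nth 0) sR /index_iota subn0.
by apply: eq_bigr => i _; rewrite rmorphB /= map_polyX map_polyC.
Qed.

End Ultraproduct.

(** * Extension of places *)

Section Places.
Variables (Om M : fieldType).
Hypothesis closedM : forall p : {poly M}, size p != 1 -> exists x, root p x.

(** The graph of a ring homomorphism to [M] from a subring of [Om]; the last clause is
    single-valuedness. As sets of pairs, such homomorphisms are ordered by inclusion, ready for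
    Zorn's lemma. *)
Definition partial_hom (G : set (Om * M)) :=
  [/\ G (1, 1), forall a b, G a -> G b -> G (a - b),
      forall a b, G a -> G b -> G (a * b) & forall y, G (0, y) -> y = 0].

Definition poly_rel (G : set (Om * M)) (p : {poly Om}) (q : {poly M}) :=
  forall i, G (p`_i, q`_i).

Section Closure.
Variable G : set (Om * M).
Hypothesis hG : partial_hom G.

Lemma partial_hom1 : G (1, 1). Proof. by case: hG. Qed.
Lemma partial_homB a b a' b' : G (a, b) -> G (a', b') -> G (a - a', b - b').
Proof. case: hG => _ H _ _ ab ab'; exact: (H _ _ ab ab'). Qed.
Lemma partial_homM a b a' b' : G (a, b) -> G (a', b') -> G (a * a', b * b').
Proof. case: hG => _ _ H _ ab ab'; exact: (H _ _ ab ab'). Qed.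
Lemma partial_hom_eq0 y : G (0, y) -> y = 0.
Proof. by case: hG => _ _ _; apply. Qed.
Lemma partial_hom0 : G (0, 0).
Proof. rewrite -{1}(subrr 1) -(subrr (1 : M)); exact: partial_homB partial_hom1 partial_hom1. Qed.
Lemma partial_homN a b : G (a, b) -> G (- a, - b).
Proof. by move=> ab; rewrite -[- a]add0r -[- b]add0r; apply: partial_homB partial_hom0 ab. Qed.
Lemma partial_homD a b a' b' : G (a, b) -> G (a', b') -> G (a + a', b + b').
Proof.
by move=> ab /partial_homN ab'; rewrite -[a']opprK -[b']opprK; apply: partial_homB.
Qed.
Lemma partial_homX a b n : G (a, b) -> G (a ^+ n, b ^+ n).
Proof.
move=> ab; elim: n => [|n IHn]; first by rewrite !expr0; exact: partial_hom1.
by rewrite !exprS; apply: partial_homM.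
Qed.
Lemma partial_hom_sum (I : Type) (r : seq I) (P : pred I) (f : I -> Om) (g : I -> M) :
  (forall i, P i -> G (f i, g i)) -> G (\sum_(i <- r | P i) f i, \sum_(i <- r | P i) g i).
Proof.
move=> fg; elim/big_rec2: _ => [|i a b Pi ab]; first exact: partial_hom0.
by apply: partial_homD => //; apply: fg.
Qed.
Lemma partial_hom_fun a b b' : G (a, b) -> G (a, b') -> b = b'.
Proof.
move=> ab ab'; apply/eqP; rewrite -subr_eq0; apply/eqP/partial_hom_eq0.
by rewrite -(subrr a); apply: partial_homB.
Qed.

Lemma poly_relB p q p' q' : poly_rel G p q -> poly_rel G p' q' -> poly_rel G (p - p') (q - q').
Proof. by move=> pq pq' i; rewrite !coefB; apply: partial_homB. Qed.
Lemma poly_relM p q p' q' : poly_rel G p q -> poly_rel G p' q' -> poly_rel G (p * p') (q * q').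
Proof.
move=> pq pq' i; rewrite !coefM; apply: partial_hom_sum => j _; exact: partial_homM.
Qed.
Lemma poly_relC a b : G (a, b) -> poly_rel G a%:P b%:P.
Proof. by move=> ab i; rewrite !coefC; case: ifP => // _; apply: partial_hom0. Qed.
Lemma poly_relXn n : poly_rel G 'X^n 'X^n.
Proof.
move=> i; rewrite !coefXn; case: eqP => _; [exact: partial_hom1|exact: partial_hom0].
Qed.
End Closure.

Section Maximal.
Variable G : set (Om * M).
Hypothesis hG : partial_hom G.
Hypothesis maxG : forall G', partial_hom G' -> G `<=` G' -> G' `<=` G.

(** The homomorphism extends to the localization of its domain at [a]. By maximality the domain is
    thus a local ring whose maximal ideal is the kernel, and the image is a field. *)
Lemma max_partial_homV a b : G (a, b) -> b != 0 -> G (a^-1, b^-1).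
Proof.
move=> ab b0; have a0 : a != 0.
  by apply: contraNneq b0 => a0; move: ab; rewrite a0 => /(partial_hom_eq0 hG) ->.
pose G' : set (Om * M) := fun x => exists n, G (x.1 * a ^+ n, x.2 * b ^+ n).
apply: (maxG (G' := G')).
- split.
  + by exists 0%N; rewrite /= !mulr1; exact: partial_hom1.
  + move=> [x y] [x' y'] [n /= xy] [m /= xy']; exists (n + m)%N => /=.
    rewrite !mulrBl !exprD; apply: partial_homB => //.
      by rewrite !mulrA; apply: partial_homM => //; apply: partial_homX.
    by rewrite ![x' * _]mulrCA ![y' * _]mulrCA; apply: partial_homM => //; apply: partial_homX.
  + move=> [x y] [x' y'] [n /= xy] [m /= xy']; exists (n + m)%N => /=.
    by rewrite !exprD !(mulrACA _ _ (_ ^+ n)); apply: partial_homM.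
  + move=> y [n /=]; rewrite mul0r => /(partial_hom_eq0 hG)/eqP.
    by rewrite mulf_eq0 expf_eq0 (negPf b0) andbF orbF => /eqP.
- by move=> [x y] xy; exists 0%N; rewrite /= !expr0 !mulr1.
- by exists 1%N; rewrite /= !expr1 !mulVf //; exact: partial_hom1.
Qed.

(* The alternative says that 1 lies in the ideal generated by the kernel of G *)
(* in the ring generated by x over the domain of G.                           *)
Lemma max_partial_hom_alternative x :
  (exists y, G (x, y)) \/ exists2 p, poly_rel G p 1 & p.[x] = 0.
Proof.
(* The images of the algebraic relations of [x] form an ideal of polynomials over the image of [G].
   A common root in [M] is an admissible value for [x]; since [M] is algebraically closed, there is
   one unless the ideal contains 1. *)
pose Ix q := exists2 p, poly_rel G p q & p.[x] = 0.
suff : (exists r, forall q, Ix q -> q.[r] = 0) \/ Ix 1.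
  move=> [[r rP]|]; last by right.
  left; exists r.
  pose G' : set (Om * M) := fun z => exists p q, poly_rel G p q /\ z = (p.[x], q.[r]).
  apply: (maxG (G' := G')).
  - split.
    + by exists 1, 1; rewrite !hornerC; split=> //; apply: poly_relC (partial_hom1 hG).
    + move=> _ _ [p [q [pq ->]]] [p' [q' [pq' ->]]]; exists (p - p'), (q - q').
      by rewrite !hornerE; split=> //; apply: poly_relB.
    + move=> _ _ [p [q [pq ->]]] [p' [q' [pq' ->]]]; exists (p * p'), (q * q').
      by rewrite !hornerM; split=> //; apply: poly_relM.
    + by move=> y [p [q [pq [px ->]]]]; apply: rP; exists p.
  - by move=> [a b] ab; exists a%:P, b%:P; rewrite !hornerC; split=> //; apply: poly_relC.
  - by exists 'X, 'X; rewrite !hornerX; split=> //; apply: (poly_relXn hG 1).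
have [I0|nI0] := pselect (forall q, Ix q -> q = 0).
  by left; exists 0 => q /I0 ->; rewrite horner0.
(* An element [q0] of least degree generates the ideal. Euclidean division stays inside it because
   quotients of leading coefficients lift to the domain of [G], by [max_partial_homV]. *)
pose Q n := `[< exists q, [/\ Ix q, q != 0 & size q = n] >].
have exQ : exists n, Q n.
  apply: contrapT => nQ; apply: nI0 => q Iq; apply: contrapT => /eqP q0.
  by apply: nQ; exists (size q); apply/asboolP; exists q.
case: (ex_minnP exQ) => n /asboolP[q0 [[p0 pq0 px0] q00 sq0]] qmin.
have a0b0 := pq0 (size q0).-1; have b00 : q0`_(size q0).-1 != 0 by rewrite -lead_coefE lead_coef_eq0.
have Iq_dvd q : Ix q -> q0 %| q.
  have [m] := ubnP (size q); elim: m q => // m IHm q /ltnSE leqm [p pq px].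
  have [->|q_neq0] := eqVneq q 0; first exact: dvdp0.
  have leq0 : (size q0 <= size q)%N by rewrite sq0; apply: qmin; apply/asboolP; exists q; split=> //; exists p.
  pose k := (size q - size q0)%N.
  pose c := q`_(size q).-1 / q0`_(size q0).-1.
  pose d := p`_(size q).-1 / p0`_(size q0).-1.
  have dc : G (d, c) by apply: partial_homM => //; apply: max_partial_homV.
  have : q0 %| q - c%:P * 'X^k * q0.
    apply: IHm; last first.
      exists (p - d%:P * 'X^k * p0); last by rewrite !hornerE px px0 mulr0 subr0.
      apply: poly_relB => //; apply: poly_relM => //; apply: poly_relM => //.
        exact: poly_relC.
      exact: poly_relXn.
    have c0 : c != 0 by rewrite mulf_neq0 ?invr_eq0 // -lead_coefE lead_coef_eq0.
    have sz : size (c%:P * 'X^k * q0) = size q.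
      rewrite -mulrA mul_polyC size_scale // mulrC size_mulXn // /k subnK //.
    have lc : lead_coef (c%:P * 'X^k * q0) = lead_coef q.
      by rewrite !lead_coefM lead_coefC lead_coefXn mulr1 /c -!lead_coefE mulfVK // lead_coefE.
    apply: leq_trans leqm.
    have sq_gt0 : (0 < size q)%N by rewrite size_poly_gt0.
    rewrite -(prednK sq_gt0) ltnS; apply/leq_sizeP => j lej.
    rewrite coefB; move: lej; rewrite leq_eqVlt => /predU1P[<-|ltj].
      by rewrite -[X in _ - _`_X.-1]sz -!lead_coefE lc subrr.
    rewrite !nth_default ?subrr ?sz //; by rewrite -(prednK sq_gt0).
  by rewrite dvdp_subl // dvdp_mull.
have [s1|s1] := eqVneq (size q0) 1.
  right; have /size_poly1P[c c0 qc] := introT eqP s1.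
  exists ((p0`_0)^-1%:P * p0); last by rewrite hornerM px0 mulr0.
  have -> : 1 = (c^-1)%:P * q0 by rewrite qc -polyCM mulVf.
  apply: poly_relM => //; apply: poly_relC => //; apply: max_partial_homV => //.
  by have := pq0 0; rewrite qc coefC eqxx.
have [r /eqP q0r] := closedM s1; left; exists r => q /Iq_dvd.
by move=> /dvdpP[u ->]; rewrite hornerM q0r mulr0.
Qed.

Let bad x n := exists p, [/\ poly_rel G p 1, p.[x] = 0 & (size p <= n.+1)%N].

(* Eliminates the top coefficient of p by means of the relation for x^-1.     *)
Let bad_step x n m : x != 0 -> (0 < n)%N -> (m <= n)%N -> bad x n -> bad x^-1 m -> bad x n.-1.
Proof.
move=> x0 n0 lemn [p [pG px sp]] [q [qG qx sq]].
have /= q0G := qG 0; rewrite coef1 eqxx in q0G.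
have u0 : q`_0 != 0.
  apply/eqP => q00; have := q0G; rewrite q00 => /(partial_hom_eq0 hG)/eqP.
  by rewrite oner_eq0.
pose s : {poly Om} := \sum_(i < m) (q`_i.+1)%:P * 'X^(n.-1 - i).
have sG : poly_rel G s 0.
  have sum0 k : (0 : M) = \sum_(i < k) 0 by rewrite big1.
  move=> j; rewrite coef_sum coef0 [X in G (_, X)](sum0 m).
  apply: partial_hom_sum => // i _.
  rewrite coefCM -[X in G (_, X)](mul0r ('X^(n.-1 - i) : {poly M})`_j).
  apply: partial_homM => //; last exact: poly_relXn.
  by have := qG i.+1; rewrite coef1.
have sn : (size s <= n)%N.
  apply: leq_trans (size_sum _ _ _) _; apply/bigmax_leqP => i _.
  apply: leq_trans (size_polyMleq _ _) _; rewrite size_polyXn addnS /=.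
  apply: leq_trans (leq_add (size_polyC_leq1 _) (leqnn _)) _.
  by rewrite add1n -(prednK n0) ltnS leq_subr.
have xn : x ^+ n = - (s.[x] / q`_0).
  apply: (mulIf u0); rewrite mulNr divfK //.
  apply/eqP; rewrite -addr_eq0; apply/eqP.
  transitivity (x ^+ n * q.[x^-1]); last by rewrite qx mulr0.
  rewrite (@horner_coef_wide _ m.+1 q) // big_ord_recl expr0 mulr1 mulrDr; congr (_ + _).
  rewrite horner_sum mulr_sumr; apply: eq_bigr => i _.
  rewrite hornerM hornerC hornerXn mulrCA; congr (_ * _).
  have lei : (i.+1 <= n)%N by exact: leq_trans lemn.
  by rewrite exprVn -subn1 -subnDA add1n /= expfB_cond // (negPf x0).
exists (p - (p`_n)%:P * 'X^n - (p`_n / q`_0)%:P * s); split.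
- have -> : 1 = 1 - 0%:P * 'X^n - (0 / 1)%:P * 0 :> {poly M}.
    by rewrite mulr0 mul0r !subr0.
  have pn0 : G (p`_n, 0).
    by have := pG n; rewrite coef1; case: n n0 {lemn sp s sG sn xn}.
  have V1 : G ((q`_0)^-1, 1^-1) by apply: max_partial_homV => //; apply: oner_neq0.
  apply: poly_relB => //; first apply: poly_relB => //; apply: poly_relM => //.
  + exact: poly_relC.
  + exact: poly_relXn.
  + by apply: poly_relC => //; apply: partial_homM.
- by rewrite !hornerE px xn; field.
- rewrite prednK //; apply/leq_sizeP => j lej.
  rewrite !coefB !coefCM coefXn; move: lej; rewrite leq_eqVlt => /predU1P[<-|ltj].
    by rewrite eqxx mulr1 subrr [s`_n]nth_default // mulr0 subr0.
  rewrite [p`_j]nth_default ?(leq_trans sp) // gtn_eqF // mulr0 [s`_j]nth_default.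
    by rewrite mulr0 !subr0.
  exact: leq_trans sn (ltnW ltj).
Qed.

(** The classical proof that a maximal local subring is a valuation ring. If both [x] and its
    inverse satisfied a relation exhibiting 1 in the extended maximal ideal, [bad_step] would lower
    the larger degree again and again, until a constant relation gives [G (0, 1)]. *)
Lemma max_partial_hom_valuation x :
  (exists y, G (x, y)) \/ x != 0 /\ G (x^-1, 0).
Proof.
have [->|x0] := eqVneq x 0; first by left; exists 0; exact: partial_hom0.
have no_bad n m y : y != 0 -> bad y n -> bad y^-1 m -> False.
  have [k] := ubnP (n + m); elim: k n m y => // k IHk n m y ltk y0 bn bm.
  wlog lemn : n m y ltk y0 bn bm / (m <= n)%N.
    move=> H; have [|/ltnW] := leqP m n; first exact: H bn bm.
    by apply: (H m n y^-1); rewrite ?invrK ?invr_eq0 // addnC.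
  have [n0|n_gt0] := posnP n.
    move: bn; rewrite n0 => -[p [pG px /size1_polyC pc]].
    have := pG 0; rewrite coef1 eqxx; move: px; rewrite pc hornerC coefC eqxx => ->.
    by move/(partial_hom_eq0 hG)/eqP; rewrite oner_eq0.
  apply: (IHk n.-1 m y) => //; last exact: bad_step bn bm.
  by move: ltk; rewrite -{1}(prednK n_gt0) addSn.
case: (max_partial_hom_alternative x) => [|[p pG px]]; first by left.
case: (max_partial_hom_alternative x^-1) => [[y xy]|[q qG qx]]; last first.
  case: (no_bad (size p) (size q) x) => //; first by exists p.
  by exists q.
have [y0|y0] := eqVneq y 0; first by right; split=> //; rewrite -y0.
by left; exists y^-1; rewrite -[x]invrK; apply: max_partial_homV.
Qed.

End Maximal.

Lemma exists_max_partial_hom G0 : partial_hom G0 -> exists G,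
  [/\ partial_hom G, G0 `<=` G & forall G', partial_hom G' -> G `<=` G' -> G' `<=` G].
Proof.
(* Taking the union with [G0] makes the empty chain harmless and keeps [G0] inside every
   candidate. *)
move=> hG0; pose P : set (set (Om * M)) := fun G => partial_hom (G0 `|` G).
have [|A [PA maxA]] := @Zorn_bigcup _ P.
  move=> F FP totF; rewrite /P.
  have [[X FX]|nF] := pselect (exists X, F X); last first.
    suff -> : G0 `|` \bigcup_(X in F) X = G0 by [].
    by apply/seteqP; split=> [x [//|[X FX]]|x]; [case: nF; exists X|left].
  have lift a b : (G0 `|` \bigcup_(X in F) X) a -> (G0 `|` \bigcup_(X in F) X) b ->
      exists2 Y, F Y & (G0 `|` Y) a /\ (G0 `|` Y) b.
    move=> [a0|[Y FY Ya]] [b0|[Z FZ Zb]].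
    - by exists X => //; split; left.
    - by exists Z => //; split; [left|right].
    - by exists Y => //; split; [right|left].
    - case: (totF _ _ FY FZ) => sub; first by exists Z => //; split; right=> //; apply: sub.
      by exists Y => //; split; right=> //; apply: sub.
  have up Y : F Y -> G0 `|` Y `<=` G0 `|` \bigcup_(X in F) X.
    by move=> FY x [|]; [left|right; exists Y].
  split.
  - by left; exact: partial_hom1.
  - move=> a b /lift H /H [Y FY [Ya Yb]]; apply: (up Y FY); have [_ HB _ _] := FP _ FY; exact: HB.
  - move=> a b /lift H /H [Y FY [Ya Yb]]; apply: (up Y FY); have [_ _ HM _] := FP _ FY; exact: HM.
  - by move=> y /[dup] /lift H /H [Y FY [Ya _]]; exact: partial_hom_eq0 (FP _ FY) _ Ya.
exists (G0 `|` A); split=> //.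
move=> G' hG' sub; apply: contrapT => nsub.
have AG' : A `<=` G' by move=> x Ax; apply: sub; right.
have PG' : P G'.
  rewrite /P; suff -> : G0 `|` G' = G' by [].
  by apply/setUidPr => x Gx; apply: sub; left.
apply: (maxA G') => //; split=> // sub'; apply: nsub => x /sub'; by right.
Qed.

Theorem place_extension G0 : partial_hom G0 -> exists G,
  [/\ partial_hom G, G0 `<=` G,
      forall a b, G (a, b) -> b != 0 -> G (a^-1, b^-1) &
      forall x, (exists y, G (x, y)) \/ x != 0 /\ G (x^-1, 0)].
Proof.
move=> /exists_max_partial_hom[G [hG sub maxG]]; exists G; split=> //.
- exact: max_partial_homV.
- exact: max_partial_hom_valuation.
Qed.

(** A valuation ring is integrally closed: if the inverse of [x] went to 0, dividing the equation by
    the top power of [x] would send 1 to 0. *)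
Lemma place_integral (G : set (Om * M)) (p : {poly Om}) x :
    partial_hom G -> (forall x, (exists y, G (x, y)) \/ x != 0 /\ G (x^-1, 0)) ->
    p \is monic -> (forall i, exists y, G (p`_i, y)) -> root p x ->
  exists y, G (x, y).
Proof.
move=> hG val pm pG /eqP px; case: (val x) => // -[x0 xV].
have [n sp] : exists n, size p = n.+1.
  by exists (size p).-1; rewrite prednK // size_poly_gt0 monic_neq0.
have e : 1 = - \sum_(i < n) p`_i * x^-1 ^+ (n - i).
  apply/eqP; rewrite -addr_eq0; apply/eqP.
  transitivity (x^-1 ^+ n * p.[x]); last by rewrite px mulr0.
  rewrite horner_coef sp big_ord_recr /= mulrDr [in RHS]addrC.
  have -> : p`_n = 1 by move/monicP: pm; rewrite lead_coefE sp.
  rewrite mul1r -exprMn mulVf // expr1n; congr (_ + _).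
  rewrite mulr_sumr; apply: eq_bigr => i _; rewrite mulrCA; congr (_ * _).
  have aux k l : (l <= k)%N -> x^-1 ^+ (k - l) = x^-1 ^+ k * x ^+ l.
    by move=> lk; rewrite -[in RHS](subnK lk) exprD -mulrA -exprMn mulVf // expr1n mulr1.
  by rewrite aux // ltnW.
have : G (1, 0).
  have sum0 k : (0 : M) = - \sum_(i < k) 0 by rewrite big1 ?oppr0.
  rewrite [X in G (X, _)]e [X in G (_, X)](sum0 n).
  apply: partial_homN => //; apply: partial_hom_sum => // i _.
  have [y py] := pG i; rewrite -(mulr0 y); apply: partial_homM => //.
  have := partial_homX hG (n - i) xV; rewrite expr0n subn_eq0 leqNgt ltn_ord //.
by move=> /(partial_hom_fun hG (partial_hom1 hG))/eqP; rewrite oner_eq0.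
Qed.

End Places.

(** * Algebraic closure inside a field, and its automorphisms *)

Section AlgebraicClosure.
Variables (k Om : fieldType) (iota : {rmorphism k -> Om}).

Definition in_algc : {pred Om} := fun y => `[< integralOver iota y >].

Fact in_algc_divring : divring_closed in_algc.
Proof.
split=> [|x y /asboolP ix /asboolP iy|x y /asboolP ix /asboolP iy].
- exact/asboolP/integral1.
- exact/asboolP/integral_sub.
- exact/asboolP/integral_div.
Qed.
HB.instance Definition _ := GRing.isDivringClosed.Build Om in_algc in_algc_divring.

Record algc := AlgC { algc_val : Om; _ : algc_val \in in_algc }.
HB.instance Definition _ := [isSub for algc_val].
HB.instance Definition _ := [Choice of algc by <:].
HB.instance Definition _ := [SubChoice_isSubIntegralDomain of algc by <:].
HB.instance Definition _ := [SubIntegralDomain_isSubField of algc by <:].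

Definition algc_inj : {rmorphism algc -> Om} := val.

Hypothesis iota_splits : forall p : {poly k}, p \is monic -> splits iota p.

(** Only polynomials over [k] are known to split in [Om]. A root found in some extension of [Om] is
    still integral over [k]; its equation over [k] already splits in [Om], so the root lies
    there. *)
Lemma algc_root (p : {poly algc}) : p \is monic -> (1 < size p)%N ->
  exists x, root p x.
Proof.
move=> pm p1; pose pO := map_poly algc_inj p.
have [E [h [rs e]]] : exists (E : fieldType) (h : {rmorphism Om -> E}), splits h pO.
  by apply: splitting_field; rewrite map_monic.
case: rs e => [|r rs] e.
  by move: p1; rewrite -(size_map_poly algc_inj) -(size_map_poly h) e big_nil size_poly1.
have r0 : root (map_poly h pO) r by rewrite e root_prod_XsubC mem_head.
have [q qm] : integralOver (h \o iota) r.
  apply: (integral_root_monic (p := map_poly h pO)) => //.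
    by rewrite !map_monic.
  apply/integral_poly => i; rewrite !coef_map; apply: integral_rmorph.
  by case: (p`_i) => x px /=; exact/asboolP.
have [ss es] := iota_splits qm.
rewrite map_poly_comp es rmorph_prod.
under eq_bigr do rewrite rmorphB /= map_polyX map_polyC.
rewrite -(big_map h xpredT (fun x => 'X - x%:P)) root_prod_XsubC => /mapP[s s_ss rs0].
have s_alg : s \in in_algc.
  by apply/asboolP; exists q => //; rewrite es root_prod_XsubC.
exists (AlgC s_alg); rewrite -(fmorph_root algc_inj) /=.
by rewrite -(fmorph_root h) -rs0.
Qed.

Lemma algc_closed : GRing.closed_field_axiom algc.
Proof.
move=> n P n0; pose q := \poly_(i < n) P i.
have sq : (size q < size ('X^n : {poly algc}))%N by rewrite size_polyXn ltnS size_poly.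
have [| |x /eqP] := @algc_root ('X^n - q).
- by rewrite monicE lead_coefDl ?size_polyN // lead_coefXn.
- by rewrite size_polyDl ?size_polyN // size_polyXn.
rewrite !hornerE horner_poly => /eqP; rewrite subr_eq0 => /eqP; by exists x.
Qed.

Lemma exists_algc : exists (C : closedFieldType) (jC : {rmorphism C -> Om}),
  (forall y, (exists c, jC c = y) <-> integralOver iota y).
Proof.
pose C : closedFieldType := HB.pack algc (Field_isAlgClosed.Build algc algc_closed).
exists C, algc_inj => y; split=> [[[c /asboolP cc] <-] //|iy].
by have cy : y \in in_algc by [apply/asboolP]; exists (AlgC cy).
Qed.

End AlgebraicClosure.

Section FractionLift.
Variables (D : idomainType) (E : fieldType) (f : {rmorphism D -> E}).
Hypothesis fI : injective f.

Lemma frac_lift_exists : exists g : {rmorphism {fraction D} -> E},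
  forall a, g (FracField.tofrac a) = f a.
Proof.
pose g z := let: exist2 ab _ _ := fracE z in f ab.1 / f ab.2.
have f0 a : (f a == 0) = (a == 0) by rewrite -(rmorph0 f) (inj_eq fI).
have gE a b : b != 0 -> g (FracField.tofrac a / FracField.tofrac b) = f a / f b.
  move=> b0; rewrite /g; case: fracE => -[a' b'] /= b'0 /eqP.
  rewrite eqr_div ?tofrac_eq0 // -!tofracM tofrac_eq => /eqP eab.
  by apply/eqP; rewrite eqr_div ?f0 // -!rmorphM eab.
have [||h hE] := @rmorphism_exists _ _ g.
- move=> x y; case: (fracE x) (fracE y) => -[a b] /= b0 -> [[a' b'] /= b'0 ->].
  rewrite -mulNr addf_div ?tofrac_eq0 // -!tofracN -!tofracM -tofracD.
  rewrite !gE ?mulf_neq0 // -mulNr addf_div ?f0 //.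
  by rewrite !rmorphD !rmorphM !rmorphN.
- split=> [|x y].
    by rewrite -(divr1 1) -tofrac1 gE ?oner_neq0 // rmorph1 divr1.
  case: (fracE x) (fracE y) => -[a b] /= b0 -> [[a' b'] /= b'0 ->].
  by rewrite mulf_div -!tofracM !gE ?mulf_neq0 // !rmorphM mulf_div.
exists h => a; have := gE a 1 (oner_neq0 D).
by rewrite -hE rmorph1 tofrac1 !divr1.
Qed.

Lemma clear_denominators (p : {poly {fraction D}}) :
  exists2 d : D, d != 0 & exists q : {poly D}, map_poly (@FracField.tofrac D) q = FracField.tofrac d *: p.
Proof.
have aux (R : comNzRingType) (B A d' u X b' : R) : B * b' = 1 ->
    B * (d' * u) * X + d' * A = d' * B * (u * X + A * b').
  move=> Bb'; transitivity (B * (d' * u) * X + d' * A * (B * b')); last by ring.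
  by rewrite Bb' mulr1.
elim/poly_ind: p => [|p c [d d0 [q e]]].
  by exists 1; rewrite ?oner_neq0 //; exists 0; rewrite rmorph0 scaler0.
case: (fracE c) => -[a b] /= b0 ->.
exists (d * b); first by rewrite mulf_neq0.
exists (b%:P * q * 'X + (d * a)%:P).
rewrite rmorphD !rmorphM /= e map_polyX !map_polyC -!mul_polyC.
rewrite polyCM; apply: aux; rewrite -polyCM divff ?tofrac_eq0 //.
Qed.

Lemma integral_frac (g : {rmorphism {fraction D} -> E}) y :
    (forall a, g (FracField.tofrac a) = f a) -> integralOver g y ->
  exists2 p : {poly D}, p != 0 & root (map_poly f p) y.
Proof.
move=> gf [p pm py]; have [d d0 [q e]] := clear_denominators p.
exists q.
  apply: contraNneq (monic_neq0 pm) => q0; move: e; rewrite q0 rmorph0 => /esym/eqP.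
  by rewrite scaler_eq0 tofrac_eq0 (negPf d0).
have -> : map_poly f q = map_poly g (map_poly (@FracField.tofrac D) q).
  by rewrite -map_poly_comp; apply: eq_map_poly => a /=; rewrite gf.
by rewrite e map_polyZ rootE hornerZ (eqP py) mulr0.
Qed.

End FractionLift.

Definition poly_ev (L C : fieldType) (c : {rmorphism L -> C}) (x : C) :
  {rmorphism {poly L} -> C} := horner_eval x \o map_poly c.

(** When [x] is transcendental over [L], that is when [poly_ev c x] is injective, this is
    algebraicity over the field L(x) with denominators cleared. *)
Definition algebraic_over (L C : fieldType) (c : {rmorphism L -> C}) (x y : C) :=
  exists2 p : {poly {poly L}}, p != 0 & root (map_poly (poly_ev c x) p) y.

Lemma algebraic_over_trans (L C : fieldType) (c : {rmorphism L -> C}) (w x y : C) :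
    injective (poly_ev c w) -> injective (poly_ev c x) ->
    algebraic_over c x w -> algebraic_over c w y ->
  algebraic_over c x y.
Proof.
move=> wI xI [r r0 rw] [p p0 py].
have [g gE] := frac_lift_exists xI.
have map_neq0 (z : C) (q : {poly {poly L}}) :
    injective (poly_ev c z) -> q != 0 -> map_poly (poly_ev c z) q != 0.
  move=> zI; apply: contraNneq => /polyP e; apply/eqP/polyP => i; apply: zI.
  by have := e i; rewrite coef_map !coef0 rmorph0.
have iev (z : C) q : integralOver g z -> integralOver g (poly_ev c z q).
  move=> iz; apply: integral_horner => //; apply/integral_poly => i.
  rewrite coef_map /=; have -> : c q`_i = g (FracField.tofrac (q`_i)%:P).
    by rewrite gE /poly_ev /= map_polyC /horner_eval hornerC.
  exact: integral_id.
have iw : integralOver g w.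
  apply: (integral_root (map_neq0 _ _ xI r0) rw); apply/integral_poly => i.
  rewrite coef_map; apply: iev; have -> : x = g (FracField.tofrac 'X).
    by rewrite gE /poly_ev /= map_polyX /horner_eval hornerX.
  exact: integral_id.
apply: (integral_frac gE); apply: (integral_root (map_neq0 _ _ wI p0) py).
by apply/integral_poly => i; rewrite coef_map; apply: iev.
Qed.

(** [C] is an algebraic closure of L(w), with [w] the coordinate x, taken inside a field [Om] that
    also contains L((x)). The covers and the parameter t are algebraic over L(w), so their values
    fall in [C]; and being algebraic over L(w), [C] has enough automorphisms, which [Om] is not
    claimed to have. *)
Theorem exists_universal_field (L : fieldType) :
  exists (C : closedFieldType) (Om : fieldType)
    (jK : {rmorphism {laurent L} -> Om}) (jC : {rmorphism C -> Om})
    (c : {rmorphism L -> C}) (w : C),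
  [/\ jC \o c =1 jK \o laurent_const,
      jC \o poly_ev c w =1 jK \o laurent_of_poly,
      forall y, algebraic_over c w y &
      forall (p : {poly {poly L}}) y, p != 0 ->
        root (map_poly (jK \o laurent_of_poly) p) y -> exists z, jC z = y].
Proof.
have [Om [jK spl]] := exists_splitting_field {laurent L}.
pose f : {rmorphism {poly L} -> Om} := jK \o laurent_of_poly.
have fI : injective f.
  apply: inj_comp; first exact: fmorph_inj.
  by move=> p q /eqP; rewrite -subr_eq0 -rmorphB laurent_of_poly_eq0 subr_eq0 => /eqP.
have lI : injective (@laurent_of_poly L).
  by move=> p q e; apply: fI; exact: (congr1 jK e).
have [g gE] := frac_lift_exists fI.
have [gK gKE] := frac_lift_exists lI.
have gKg : g =1 jK \o gK.
  move=> z; case: (fracE z) => -[a b] /= b0 ->.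
  by rewrite !fmorph_div /= !gE !gKE.
have gspl p : p \is monic -> splits g p.
  move=> pm; have [|rs e] := spl (map_poly gK p); first by rewrite map_monic.
  by exists rs; rewrite -e -map_poly_comp; apply: eq_map_poly.
have [C [jC jCP]] := exists_algc gspl.
have pre a : exists c, jC c = g a by apply/jCP; exact: integral_id.
pose k a := sval (cid (pre a)).
have kE a : jC (k a) = g a by exact: svalP (cid (pre a)).
have [||jk jkE] := @rmorphism_exists _ _ k.
- by move=> x y; apply: (fmorph_inj jC); rewrite rmorphB !kE rmorphB.
- by split=> [|x y]; apply: (fmorph_inj jC); rewrite ?rmorphM !kE ?rmorph1 ?rmorphM.
pose c : {rmorphism L -> C} := jk \o (@FracField.tofrac {poly L}) \o polyC.
pose w : C := jk (FracField.tofrac 'X).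
have ev q : poly_ev c w q = jk (FracField.tofrac q).
  elim/poly_ind: q => [|q a IHq]; first by rewrite !rmorph0.
  rewrite rmorphD rmorphM IHq /= /poly_ev /= map_polyX map_polyC /horner_eval hornerX hornerC.
  by rewrite [in RHS]rmorphD rmorphD !rmorphM.
have jCev q : jC (poly_ev c w q) = f q by rewrite ev /= jkE kE gE.
exists C, Om, jK, jC, c, w; split.
- by move=> a; rewrite /= jkE kE gE.
- exact: jCev.
- move=> y; have [|p p0 py] := @integral_frac _ _ f g (jC y) gE.
    by apply/jCP; exists y.
  exists p => //; rewrite -(fmorph_root jC) -map_poly_comp.
  by rewrite (eq_map_poly (g := f)) // => q /=; rewrite -jCev.
- move=> p y p0 py; apply/jCP.
  pose q := map_poly (@FracField.tofrac {poly L}) p.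
  have q0 : q != 0.
    apply: contraNneq p0 => /polyP q0; apply/eqP/polyP => i; have := q0 i.
    by rewrite coef_map !coef0 => /eqP; rewrite tofrac_eq0 => /eqP.
  apply/integral_algebraic; exists q => //.
  by rewrite -map_poly_comp (eq_map_poly (g := f)).
Qed.

(** * Extension of homomorphisms *)

Section Extension.
Variables (D : idomainType) (C M : closedFieldType).

Lemma closed_has_root (p : {poly M}) : size p != 1 -> exists x, root p x.
Proof. by move/closed_rootP. Qed.

(** A place extending [G0] has no pole here. Each [y] satisfies an equation over the image of [D]
    whose leading coefficient has a nonzero value, since [b] is injective; after division by it, [y]
    is integral over the valuation ring. *)
Lemma total_extension (a : {rmorphism D -> C}) (b : {rmorphism D -> M})
    (G0 : set (C * M)) :
    injective b -> partial_hom G0 -> (forall d, G0 (a d, b d)) ->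
    (forall y, exists2 p : {poly D}, p != 0 & root (map_poly a p) y) ->
  exists s : {rmorphism C -> M}, forall x y, G0 (x, y) -> s x = y.
Proof.
move=> bI hG0 abG alg; have [G [hG subG GV val]] := place_extension closed_has_root hG0.
have dom y : exists z, G (y, z).
  have [p p0 py] := alg y; set d := lead_coef p.
  have bd0 : b d != 0 by rewrite -(rmorph0 b) (inj_eq bI) lead_coef_eq0.
  have Gd : G (a d, b d) by apply: subG.
  have ad0 : a d != 0.
    by apply: contraNneq bd0 => ad0; move: Gd; rewrite ad0 => /(partial_hom_eq0 hG) ->.
  have sz : size (map_poly a p) = size p by rewrite size_poly_eq.
  apply: (@place_integral _ _ G ((a d)^-1 *: map_poly a p)) => //.
  - by rewrite monicE lead_coefZ lead_coefE sz coef_map -lead_coefE mulVf.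
  - move=> i; exists ((b d)^-1 * b p`_i); rewrite coefZ coef_map.
    exact: (partial_homM hG (GV _ _ Gd bd0) (subG _ (abG _))).
  - by rewrite rootE hornerZ (eqP py) mulr0.
pose s y := sval (cid (dom y)).
have sP y : G (y, s y) by exact: svalP (cid (dom y)).
have sE x y : G (x, y) -> s x = y by move=> xy; exact: (partial_hom_fun hG (sP x) xy).
have [||s' s'E] := @rmorphism_exists _ _ s.
- by move=> x y; apply: sE; exact: (partial_homB hG (sP _) (sP _)).
- by split=> [|x y]; apply: sE; [exact: (partial_hom1 hG)|exact: (partial_homM hG (sP _) (sP _))].
by exists s' => x y /subG /sE; rewrite s'E.
Qed.

Lemma extension_surj (a : {rmorphism D -> C}) (s : {rmorphism C -> M}) :
    injective a ->
    (forall y, exists2 p : {poly D}, p != 0 & root (map_poly (s \o a) p) y) ->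
  forall y, exists x, s x = y.
Proof.
move=> aI alg y; have [p p0] := alg y.
have [rs e] := closed_field_poly_normal (map_poly a p).
rewrite map_poly_comp e map_polyZ rootZ; last first.
  rewrite fmorph_eq0 lead_coef_eq0; apply: contraNneq p0 => /polyP pa0.
  by apply/eqP/polyP => i; apply: aI; have := pa0 i; rewrite coef_map !coef0 rmorph0.
rewrite rmorph_prod; under eq_bigr do rewrite rmorphB /= map_polyX map_polyC.
rewrite -(big_map s xpredT (fun x => 'X - x%:P)) root_prod_XsubC => /mapP[x _ ->].
by exists x.
Qed.

End Extension.

(** * Finite etale algebras *)

(** Cayley-Hamilton in eigenvalue form: [f z] is an eigenvalue of the matrix of multiplication by
    [z] on the generators, with eigenvector the [f (g j)]. These cannot all vanish, because the
    generators span 1. *)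
Lemma finite_integral (R : comNzRingType) (S : comPzRingType) (u : {rmorphism R -> S})
    (E : fieldType) (f : {rmorphism S -> E}) (z : S) :
  finitely_presented u -> exists2 p : {poly R}, p \is monic & root (map_poly (f \o u) p) (f z).
Proof.
move=> [m [n [g [_ [gen _]]]]].
have [A Az] : exists A : 'M[R]_n, forall j, z * g j = \sum_k u (A j k) * g k.
  pose r j := sval (cid (gen (z * g j))).
  exists (\matrix_(j, k) r j 0 k) => j; rewrite [LHS](svalP (cid (gen (z * g j)))).
  by apply: eq_bigr => k _; rewrite mxE.
exists (char_poly A^T); first exact: char_poly_monic.
rewrite map_char_poly -eigenvalue_root_char; apply/eigenvalueP.
exists (\row_j f (g j)).
  apply/rowP => j; rewrite !mxE -rmorphM Az rmorph_sum; apply: eq_bigr => k _.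
  by rewrite !mxE rmorphM mulrC.
apply/eqP => g0; have [r r1] := gen 1.
have /eqP := congr1 f r1; rewrite rmorph1 rmorph_sum big1 ?oner_eq0 // => j _.
by rewrite rmorphM; have /rowP/(_ j) := g0; rewrite !mxE => ->; rewrite mulr0.
Qed.

(** * Truncated power series, and lifting along formally étale maps *)

Section Jets.
Variable L : fieldType.

Let J0 n : forall m, (m < n)%N -> scoef (0 : powser L) m = 0.
Proof. by []. Qed.
Let JB n (a b : powser L) : (forall m, (m < n)%N -> scoef a m = 0) ->
  (forall m, (m < n)%N -> scoef b m = 0) -> forall m, (m < n)%N -> scoef (a - b) m = 0.
Proof. by move=> a0 b0 m lt; rewrite /= a0 // b0 // subr0. Qed.
Let JM n (a b : powser L) : (forall m, (m < n)%N -> scoef b m = 0) ->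
  forall m, (m < n)%N -> scoef (a * b) m = 0.
Proof.
move=> b0 m lt; rewrite /= big1 // => i _; rewrite b0 ?mulr0 //.
exact: leq_ltn_trans (leq_subr _ _) lt.
Qed.

Definition order_ideal n : ideal (powser L) :=
  Ideal (ideal_set := fun a => forall m, (m < n)%N -> scoef a m = 0) (@J0 n) (@JB n) (@JM n).

Definition jet n := iquot (order_ideal n).
HB.instance Definition _ n := GRing.ComPzRing.on (jet n).
Definition jet_pi n : {rmorphism powser L -> jet n} := @iquot_pi _ (order_ideal n).

Lemma jet_piP n a b :
  jet_pi n a = jet_pi n b <-> forall m, (m < n)%N -> scoef a m = scoef b m.
Proof.
rewrite /jet_pi /= iquot_piP /=; split=> H m lt.
  by apply/eqP; rewrite -subr_eq0; apply/eqP/H.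
by rewrite H // subrr.
Qed.

Lemma jet_repK n (z : jet n) : jet_pi n (sval z) = z.
Proof. exact: iquot_piK. Qed.

Lemma jet_trunc_exists n : exists q : {rmorphism jet n.+1 -> jet n},
  forall a, q (jet_pi n.+1 a) = jet_pi n a.
Proof.
pose q (z : jet n.+1) := jet_pi n (sval z).
have qE a : q (jet_pi n.+1 a) = jet_pi n a.
  apply/jet_piP => m lt; have /jet_piP := jet_repK (jet_pi n.+1 a).
  by apply; exact: ltnW.
have [||q' q'E] := @rmorphism_exists _ _ q.
- by move=> x y; rewrite -(jet_repK x) -(jet_repK y) -rmorphB !qE rmorphB.
- split=> [|x y]; first by rewrite -(rmorph1 (jet_pi n.+1)) qE rmorph1.
  by rewrite -(jet_repK x) -(jet_repK y) -rmorphM !qE rmorphM.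
by exists q' => a; rewrite q'E qE.
Qed.

Lemma jet_square_zero n (q : {rmorphism jet n.+2 -> jet n.+1}) :
  (forall a, q (jet_pi n.+2 a) = jet_pi n.+1 a) ->
  forall x y, q x = 0 -> q y = 0 -> x * y = 0.
Proof.
move=> qE x y; rewrite -(jet_repK x) -(jet_repK y) !qE.
rewrite -!(rmorph0 (jet_pi n.+1)) => /jet_piP /= a0 /jet_piP /= b0.
rewrite -rmorphM -(rmorph0 (jet_pi n.+2)); apply/jet_piP => m lt /=.
apply: big1 => i _; have [le|gt] := leqP i n; first by rewrite a0 // mul0r.
rewrite b0 ?mulr0 // ltnS; apply: leq_trans (leq_sub2l _ gt) _.
by rewrite leq_subLR addSn (leq_trans (ltnSE lt)) // ltnS leq_addr.
Qed.

Definition const_powser : {rmorphism L -> powser L} := @poly_powser L \o polyC.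

Lemma powser_ext (a b : powser L) : (forall n, jet_pi n.+1 a = jet_pi n.+1 b) -> a = b.
Proof. by move=> H; apply: powserP => n; have /jet_piP := H n; apply. Qed.

(* A point of S lifts uniquely along every jet, hence to power series.        *)
Lemma etale_lift (R S : comPzRingType) (u : {rmorphism R -> S})
    (a : {rmorphism R -> powser L}) (p : {rmorphism S -> L}) :
    formally_etale u -> (forall r, p (u r) = scoef (a r) 0) ->
  exists b : {rmorphism S -> powser L},
    (forall r, b (u r) = a r) /\ (forall z, scoef (b z) 0 = p z).
Proof.
move=> eu pu.
pose lifts n := {c : {rmorphism S -> jet n.+1} | c \o u =1 jet_pi n.+1 \o a}.
have step n (c : lifts n) : {c' : lifts n.+1 | forall z m, (m <= n)%N ->
    scoef (sval (sval c' z)) m = scoef (sval (sval c z)) m}.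
  apply: cid; have [q qE] := jet_trunc_exists n.+1; case: c => c cu.
  have [|||c' [c'u qc' _]] := eu (jet n.+2) (jet n.+1) q (jet_pi n.+2 \o a) c.
  - by move=> y; exists (jet_pi n.+2 (sval y)); rewrite qE jet_repK.
  - exact: jet_square_zero.
  - by move=> r; rewrite /= qE; exact: esym (cu r).
  exists (exist _ c' c'u) => z m lemn /=.
  have /jet_piP : jet_pi n.+1 (sval (c' z)) = jet_pi n.+1 (sval (c z)).
    by rewrite -qE !jet_repK; exact: qc'.
  exact.
have c0u : (jet_pi 1 \o const_powser \o p) \o u =1 jet_pi 1 \o a.
  by move=> r /=; apply/jet_piP => -[|//] _ /=; rewrite coefC eqxx pu.
pose c0 : lifts 0%N := exist (fun c : {rmorphism S -> jet 1} => c \o u =1 jet_pi 1 \o a)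
  (jet_pi 1 \o const_powser \o p) c0u.
pose c := fix c n : lifts n := if n is n'.+1 then sval (step n' (c n')) else c0.
have cS n z m : (m <= n)%N -> scoef (sval (sval (c n.+1) z)) m = scoef (sval (sval (c n) z)) m.
  exact: (svalP (step n (c n))).
have cE n z m : (m <= n)%N -> scoef (sval (sval (c n) z)) m = scoef (sval (sval (c m) z)) m.
  elim: n => [|n IHn]; first by rewrite leqn0 => /eqP ->.
  rewrite leq_eqVlt => /predU1P[-> //|lt]; rewrite cS // IHn //.
pose b z : powser L := Powser (fun n => scoef (sval (sval (c n) z)) n).
have bE n z : jet_pi n.+1 (b z) = sval (c n) z.
  by rewrite -[RHS]jet_repK; apply/jet_piP => m; rewrite ltnS => le; rewrite /= [RHS]cE.
have [||b' b'E] := @rmorphism_exists _ _ b.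
- by move=> x y; apply: powser_ext => n; rewrite [RHS]rmorphB !bE rmorphB.
- split=> [|x y]; apply: powser_ext => n; first by rewrite bE !rmorph1.
  by rewrite [RHS]rmorphM !bE rmorphM.
exists b'; split=> [r|z]; rewrite b'E.
  by apply: powser_ext => n; rewrite bE; exact: (svalP (c n)).
have /jet_piP/(_ 0%N isT) -> : jet_pi 1 (b z) = jet_pi 1 (const_powser (p z)) by rewrite bE.
by rewrite /= coefC eqxx.
Qed.

(** [jet 2] is the ring of dual numbers. A derivation [d] along [p] yields a second lift p + d x of
    the map p, next to the constant one; uniqueness of lifts makes them equal. *)
Lemma etale_no_derivation (R S : comPzRingType) (u : {rmorphism R -> S})
    (p : {rmorphism S -> L}) (d : S -> L) :
    formally_etale u ->
    (forall x y, d (x - y) = d x - d y) ->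
    (forall x y, d (x * y) = p x * d y + d x * p y) ->
    (forall r, d (u r) = 0) ->
  forall z, d z = 0.
Proof.
move=> eu dB dM du.
have [q qE] := jet_trunc_exists 1.
pose f0 : {rmorphism S -> jet 2} := jet_pi 2 \o const_powser \o p.
pose X : powser L := poly_powser 'X.
pose h z := const_powser (p z) + const_powser (d z) * X.
have hE z : h z = Powser (fun n => if n is n'.+1 then (if n' is 0 then d z else 0) else p z).
  rewrite /h /X /= -rmorphM -rmorphD; apply: powserP => -[|[|n]] /=;
  by rewrite coefD coefC coefMX coefC ?addr0 ?add0r.
have d1 : d 1 = 0 by rewrite -(rmorph1 u) du.
have [||f1 f1E] := @rmorphism_exists _ _ (fun z => jet_pi 2 (h z)).
- by move=> x y; rewrite -rmorphB; congr (jet_pi 2 _); rewrite !hE;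
    apply: powserP => -[|[|n]] /=; rewrite ?rmorphB ?dB ?subr0.
- split=> [|x y]; first by rewrite /h d1 !rmorph1 rmorph0 mul0r addr0 rmorph1.
  rewrite -rmorphM; apply/jet_piP => -[|[|//]] _; rewrite !hE /=.
    by rewrite big_ord_recl big_ord0 /= addr0 rmorphM.
  by rewrite !big_ord_recl big_ord0 /= addr0 dM.
have [|||f [_ _ fu]] := eu (jet 2) (jet 1) q (f0 \o u) (q \o f0).
- by move=> y; exists (jet_pi 2 (sval y)); rewrite qE jet_repK.
- exact: jet_square_zero.
- by [].
have e0 := fu f0 (frefl _) (frefl _).
have e1 : f1 =1 f.
  apply: fu => [r|z] /=; rewrite f1E.
    by rewrite /h du rmorph0 mul0r addr0.
  by rewrite /f0 /= !qE; apply/jet_piP => -[|//] _; rewrite hE /= coefC.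
move=> z; have /jet_piP/(_ 1%N isT) : jet_pi 2 (h z) = jet_pi 2 (const_powser (p z)).
  by rewrite -f1E e1 -e0.
by rewrite hE /= coefC.
Qed.

End Jets.

(** * Power series *)

Lemma polyhom_ext (R : nzRingType) (S : pzRingType) (f g : {rmorphism {poly R} -> S}) :
  (forall a, f a%:P = g a%:P) -> f 'X = g 'X -> f =1 g.
Proof.
move=> fg fgX p; elim/poly_ind: p => [|p a IHp]; first by rewrite !rmorph0.
by rewrite !rmorphD !rmorphM IHp fgX fg.
Qed.

Lemma horner_taylor1 (R : comNzRingType) (p : {poly R}) x y :
  exists q, p.[x + y] = p.[x] + p^`().[x] * y + y ^+ 2 * q.
Proof.
elim/poly_ind: p => [|p c [q IHp]]; first by exists 0; rewrite linear0 !horner0; ring.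
exists (p^`().[x] + q * (x + y)).
by rewrite derivMXaddC !hornerE IHp; ring.
Qed.

Lemma horner_sub_dvd (R : comNzRingType) (p : {poly R}) x y :
  exists q, p.[x] - p.[y] = (x - y) * q.
Proof.
have [q e] := horner_taylor1 p y (x - y).
exists (p^`().[y] + (x - y) * q); move: e; rewrite addrC subrK => ->; ring.
Qed.

Section PowerSeries.
Variable L : fieldType.
Implicit Types a b : powser L.

Definition cterm a : L := scoef a 0.

Fact cterm_is_zmod_morphism : zmod_morphism cterm.
Proof. by []. Qed.
Fact cterm_is_monoid_morphism : monoid_morphism cterm.
Proof. by split=> // a b; rewrite /cterm /= big_ord_recl big_ord0 addr0. Qed.
HB.instance Definition _ :=
  GRing.isZmodMorphism.Build (powser L) L cterm cterm_is_zmod_morphism.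
HB.instance Definition _ :=
  GRing.isMonoidMorphism.Build (powser L) L cterm cterm_is_monoid_morphism.

Lemma scoefB a b k : scoef (a - b) k = scoef a k - scoef b k. Proof. by []. Qed.
Lemma ctermD a b : cterm (a + b) = cterm a + cterm b. Proof. exact: rmorphD. Qed.
Lemma ctermB a b : cterm (a - b) = cterm a - cterm b. Proof. exact: rmorphB. Qed.
Lemma ctermM a b : cterm (a * b) = cterm a * cterm b. Proof. exact: rmorphM. Qed.
Lemma ctermXn a n : cterm (a ^+ n) = cterm a ^+ n. Proof. exact: rmorphXn. Qed.

Lemma cterm_const x : cterm (const_powser L x) = x.
Proof. by rewrite /cterm /= coefC. Qed.

Definition pvar : powser L := poly_powser 'X.

Lemma scoef_pvarX n a k : scoef (pvar ^+ n * a) k = if (k < n)%N then 0 else scoef a (k - n).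
Proof.
rewrite /pvar -rmorphXn /=; case: ltnP => [lt|le].
  by apply: big1 => j _; rewrite coefXn ltn_eqF ?mul0r // (leq_trans (ltn_ord j)).
have lt : (n < k.+1)%N by rewrite ltnS.
rewrite (bigD1 (Ordinal lt)) //= coefXn eqxx mul1r big1 ?addr0 // => j.
by rewrite -val_eqE /= coefXn => /negPf ->; rewrite mul0r.
Qed.

Lemma cterm_pvar : cterm pvar = 0.
Proof. by rewrite /cterm /= coefX. Qed.

Lemma pvar_neq0 : pvar != 0.
Proof.
apply/eqP => /(congr1 (fun a => scoef a 1)) /eqP.
by rewrite /= coefX oner_eq0.
Qed.

Definition pdvd n a := exists b, a = pvar ^+ n * b.

Lemma pdvdP n a : pdvd n a <-> forall k, (k < n)%N -> scoef a k = 0.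
Proof.
split=> [[b ->] k lt|H]; first by rewrite scoef_pvarX lt.
exists (Powser (fun k => scoef a (k + n))); apply: powserP => k.
by rewrite scoef_pvarX /=; case: ltnP => [/H //|le]; rewrite subnK.
Qed.

Lemma pdvdB n a b : pdvd n a -> pdvd n b -> pdvd n (a - b).
Proof. by move=> [x ->] [y ->]; exists (x - y); rewrite mulrBr. Qed.
Lemma pdvdD n a b : pdvd n a -> pdvd n b -> pdvd n (a + b).
Proof. by move=> [x ->] [y ->]; exists (x + y); rewrite mulrDr. Qed.
Lemma pdvdMr n a b : pdvd n a -> pdvd n (a * b).
Proof. by move=> [x ->]; exists (x * b); rewrite mulrA. Qed.
Lemma pdvd1P a : pdvd 1 a <-> cterm a = 0.
Proof. by rewrite pdvdP; split=> [/(_ 0%N isT)|a0 [|//]]. Qed.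

Lemma pdvd_eq0 a : (forall n, pdvd n a) -> a = 0.
Proof.
by move=> H; apply: powserP => n; have /pdvdP/(_ n (ltnSn n)) := H n.+1.
Qed.

Lemma cterm_horner (p : {poly powser L}) a : cterm p.[a] = (map_poly cterm p).[cterm a].
Proof. by rewrite horner_map. Qed.

Section Hensel.
Variables (p : {poly powser L}) (r0 : L).
Hypothesis pr0 : root (map_poly cterm p) r0.
Let d := (map_poly cterm p)^`().[r0].
Hypothesis dn0 : d != 0.

(** Newton's iteration with the derivative frozen at its constant term and a single coefficient
    corrected. Lower coefficients never change again, so the root is read off the diagonal of the
    sequence. *)
Definition hensel_step n r := r - const_powser L (scoef p.[r] n.+1 / d) * pvar ^+ n.+1.
Fixpoint hensel_seq n := if n is n'.+1 then hensel_step n' (hensel_seq n') else const_powser L r0.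

Let deriv_cterm r : cterm r = r0 -> cterm p^`().[r] = d.
Proof. by move=> rr0; rewrite cterm_horner -deriv_map rr0. Qed.

Let seqP n : cterm (hensel_seq n) = r0 /\ pdvd n.+1 p.[hensel_seq n].
Proof.
elim: n => [|n [IH0 [b pb]]]; first split.
- exact: cterm_const.
- by apply/pdvd1P; rewrite cterm_horner cterm_const; apply/eqP.
have c0 : cterm (hensel_seq n.+1) = r0.
  by rewrite [hensel_seq _]/(hensel_step _ _) ctermB ctermM ctermXn cterm_pvar exprS mul0r mulr0 subr0.
split=> //.
rewrite [hensel_seq _]/(hensel_step _ _) /hensel_step; set e := scoef _ _ / d; set y := const_powser L e * _.
have [q ->] := horner_taylor1 p (hensel_seq n) (- y).
have -> : p.[hensel_seq n] + p^`().[hensel_seq n] * - y + (- y) ^+ 2 * q =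
    pvar ^+ n.+1 * (b - p^`().[hensel_seq n] * const_powser L e) +
    pvar ^+ n.+2 * (pvar ^+ n * const_powser L e ^+ 2 * q).
  by rewrite {1}pb /y !exprS; ring.
apply: pdvdD; last by exists (pvar ^+ n * const_powser L e ^+ 2 * q).
have : pdvd 1 (b - p^`().[hensel_seq n] * const_powser L e).
  apply/pdvd1P; rewrite ctermB ctermM deriv_cterm // cterm_const /e mulrC divfK //.
  by rewrite pb scoef_pvarX ltnn subnn subrr.
by move=> [z ->]; exists z; rewrite mulrA -exprD addn1.
Qed.

Let root_series : powser L := Powser (fun n => scoef (hensel_seq n) n).

Let seq_stable m n k : (k <= n)%N -> scoef (hensel_seq (n + m)) k = scoef (hensel_seq n) k.
Proof.
move=> lekn; elim: m => [|m IHm]; first by rewrite addn0.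
rewrite addnS -IHm [hensel_seq _]/(hensel_step _ _) /hensel_step.
have le : (k < (n + m).+1)%N by rewrite ltnS (leq_trans lekn) // leq_addr.
by rewrite scoefB [_ * pvar ^+ _]mulrC scoef_pvarX le subr0.
Qed.

Lemma hensel : exists r, cterm r = r0 /\ p.[r] = 0.
Proof.
exists root_series; split; first exact: cterm_const.
apply: pdvd_eq0 => -[|n]; first by exists p.[root_series]; rewrite mul1r.
have [_ pn] := seqP n; have [q e] := horner_sub_dvd p root_series (hensel_seq n).
rewrite -[_.[_]](subrK p.[hensel_seq n]); apply: pdvdD => //; rewrite e; apply: pdvdMr.
apply/pdvdP => k; rewrite ltnS => lekn; rewrite /= -(seq_stable (n - k) (leqnn k)).
by rewrite subnKC // subrr.
Qed.

Lemma hensel_unique r r' :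
  cterm r = r0 -> cterm r' = r0 -> p.[r] = 0 -> p.[r'] = 0 -> r = r'.
Proof.
move=> c c' pr pr'; have [q e] := horner_taylor1 p r (r' - r).
move: e; rewrite addrC subrK pr pr' add0r expr2 -mulrA [_ * (r' - r)]mulrC -mulrDr => /esym/eqP.
rewrite mulf_eq0 subr_eq0 => /orP[/eqP -> //|/eqP /(congr1 cterm)].
rewrite ctermD ctermM deriv_cterm // ctermB c c' subrr mul0r addr0 => /eqP.
by rewrite rmorph0 (negPf dn0).
Qed.

End Hensel.

Lemma powser_inv a : cterm a != 0 -> exists b, a * b = 1.
Proof.
move=> a0; have [||b [_ /eqP]] := @hensel (a *: 'X - 1) (cterm a)^-1.
- by rewrite rmorphB /= map_polyZ map_polyX rmorph1 rootE !hornerE mulfV // subrr.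
- rewrite rmorphB /= map_polyZ map_polyX rmorph1 derivB derivZ derivX derivC !hornerE subr0; exact: a0.
have -> : (a *: 'X - 1).[b] = a * b - 1 by rewrite !hornerE.
by rewrite subr_eq0 => /eqP ab; exists b.
Qed.

End PowerSeries.
Arguments pvar {L}.

(** * Transitivity of the fundamental group on the fibers of connected covers *)

Section Evaluation.
Variables (L : closedFieldType) (C : fieldType) (c : {rmorphism L -> C}).

Lemma poly_evC x a : poly_ev c x a%:P = c a.
Proof. by rewrite /poly_ev /= map_polyC /horner_eval hornerC. Qed.
Lemma poly_evX x : poly_ev c x 'X = x.
Proof. by rewrite /poly_ev /= map_polyX /horner_eval hornerX. Qed.

Lemma poly_evE x (f : {rmorphism {poly L} -> C}) p :
  (forall a, f a%:P = c a) -> f 'X = x -> f p = poly_ev c x p.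
Proof.
move=> fc fX; apply: (polyhom_ext (f := f) (g := poly_ev c x)) => [a|].
  by rewrite fc poly_evC.
by rewrite fX poly_evX.
Qed.

Lemma poly_ev_shift x p : poly_ev c x (p \Po (1 + 'X)) = poly_ev c (1 + x) p.
Proof.
apply: (poly_evE (f := poly_ev c x \o comp_poly (1 + 'X))) => [a|].
  by rewrite -[LHS]/(poly_ev c x (a%:P \Po _)) comp_polyC poly_evC.
by rewrite -[LHS]/(poly_ev c x ('X \Po _)) comp_polyX rmorphD rmorph1 poly_evX.
Qed.

Lemma poly_ev_inj x : (forall a, x <> c a) -> injective (poly_ev c x).
Proof.
move=> xc; apply: raddf_inj => p px; have [rs e] := closed_field_poly_normal p.
apply/eqP; rewrite -lead_coef_eq0 -(fmorph_eq0 c).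
have : c (lead_coef p) * \prod_(r <- rs) (x - c r) = 0.
  transitivity (poly_ev c x p); last exact: px.
  rewrite {2}e -mul_polyC [RHS]rmorphM poly_evC; congr (_ * _).
  by rewrite rmorph_prod; apply: eq_bigr => r _; rewrite rmorphB poly_evC poly_evX.
move=> /eqP; rewrite mulf_eq0 prodf_seq_eq0 => /orP[//|/hasP[r _]].
by rewrite subr_eq0 => /eqP /xc.
Qed.

End Evaluation.

Lemma loc_image (D : idomainType) (s : D) (R : pzRingType) (f : {rmorphism loc s -> R}) z :
  s != 0 -> exists a n, f z * f (loc_of s s) ^+ n = f (loc_of s a).
Proof.
move=> s0; case: (locE z) => -[a n] /= sn ez; exists a, n.
rewrite -rmorphXn -rmorphM; congr (f _).
apply: val_inj; rewrite rmorphM rmorphXn /= ez divfK //.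
by rewrite -tofracXn tofrac_eq0.
Qed.

Lemma polyX_neq0 (R : nzRingType) : 'X != 0 :> {poly R}.
Proof. by rewrite polyX_eq0. Qed.

Lemma eval1E (L : fieldType) (p : {poly L}) : eval1 (loc_of 'X p) = p.[1].
Proof. exact: loc_lift_of. Qed.
Lemma iotaXE (L : fieldType) (p : {poly L}) : iotaX (loc_of _ p) = laurent_of_poly p.
Proof. exact: loc_lift_of. Qed.
Lemma iotaGE (L : fieldType) (t : {laurent L}) (t0 : t != 0) (p : {poly L}) :
  iotaG t0 (loc_of 'X p) = laurent_subst t p.
Proof. exact: loc_lift_of. Qed.

Lemma loc_unit_image (D : idomainType) (s : D) (E : fieldType) (f : {rmorphism loc s -> E}) :
  s != 0 -> f (loc_of s s) != 0.
Proof.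
move=> s0; apply/eqP => fs0; have := congr1 f (loc_invK s0).
by rewrite rmorphM fs0 mul0r rmorph1 => /esym/eqP; rewrite oner_eq0.
Qed.

Section Fiber.
Variables (F : fieldType) (L : closedFieldType) (i : {rmorphism F -> L}).
Variable bp : tangential_base_point F.
Variables (C : closedFieldType) (Om : fieldType) (jK : {rmorphism {laurent L} -> Om}).
Variables (jC : {rmorphism C -> Om}) (c : {rmorphism L -> C}) (w : C).
Hypothesis jCc : jC \o c =1 jK \o laurent_const.
Hypothesis jCw : jC \o poly_ev c w =1 jK \o laurent_of_poly.

Variables (tC : C) (j : {rmorphism C -> C}) (G : set (C * L)).
Hypothesis jCt : jC tC = jK (tpar i bp).
Hypothesis jc : j \o c =1 c.
Hypothesis jt : j tC = 1 + w.
Hypothesis jS : forall y, exists x, j x = y.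
Hypothesis hG : partial_hom G.
Hypothesis GV : forall a b, G (a, b) -> b != 0 -> G (a^-1, b^-1).
Hypothesis Gval : forall x, (exists y, G (x, y)) \/ x != 0 /\ G (x^-1, 0).
Hypothesis Gbase : forall (a : powser L) x, jC x = jK (FracField.tofrac a) -> G (x, cterm a).

Local Notation inC y := (exists x, jC x = y).

Let cover := fet_cover i bp.

Lemma range_div x y z : inC x -> inC z -> y * z = x -> z != 0 -> inC y.
Proof. by move=> [x' <-] [z' <-] e z0; exists (x' / z'); rewrite fmorph_div -e mulfK. Qed.

Lemma range_loc (s : {poly L}) (f : {rmorphism loc s -> Om}) z :
  s != 0 -> (forall p, inC (f (loc_of s p))) -> inC (f z).
Proof.
move=> s0 fp; have [a [n e]] := loc_image f z s0.
apply: (range_div (fp a) _ e); last by rewrite expf_neq0 // loc_unit_image.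
by rewrite -!rmorphXn; exact: fp.
Qed.

Lemma range_finite (R : comNzRingType) (S : comPzRingType) (u : {rmorphism R -> S})
    (f : {rmorphism S -> Om}) z :
  finite_etale u -> (forall r, inC (f (u r))) -> inC (f z).
Proof.
move=> [fu _] fr; have [p pm pz] := finite_integral f z fu.
pose q : {poly C} := \poly_(k < size p) sval (cid (fr p`_k)).
have qp : map_poly jC q = map_poly (f \o u) p.
  apply/polyP => k; rewrite !coef_map coef_poly; case: ltnP => [lt|le] /=.
    exact: svalP (cid (fr p`_k)).
  by rewrite nth_default // !rmorph0.
have qm : q \is monic by rewrite -(map_monic jC) qp monic_map.
have [rs e] := closed_field_poly_normal q.
move: pz; rewrite -qp e (monicP qm) scale1r rmorph_prod.
under eq_bigr do rewrite rmorphB /= map_polyX map_polyC.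
rewrite -(big_map jC xpredT (fun x => 'X - x%:P)) root_prod_XsubC => /mapP[x _ ->].
by exists x.
Qed.

Lemma corestrict (S : pzRingType) (f : {rmorphism S -> Om}) :
  (forall z, inC (f z)) -> exists g : {rmorphism S -> C}, forall z, jC (g z) = f z.
Proof.
move=> fC; pose g z := sval (cid (fC z)).
have gE z : jC (g z) = f z by exact: svalP (cid (fC z)).
have [||g' g'E] := @rmorphism_exists _ _ g.
- by move=> x y; apply: (fmorph_inj jC); rewrite rmorphB !gE rmorphB.
- by split=> [|x y]; apply: (fmorph_inj jC); rewrite ?rmorphM !gE ?rmorph1 ?rmorphM.
by exists g' => z; rewrite g'E.
Qed.

Lemma place_finite (R : comNzRingType) (S : comPzRingType) (u : {rmorphism R -> S})
    (f : {rmorphism S -> C}) z :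
  finite_etale u -> (forall r, exists y, G (f (u r), y)) -> exists y, G (f z, y).
Proof.
move=> [fu _] fr; have [p pm pz] := finite_integral f z fu.
apply: (place_integral hG Gval _ _ pz) => [|k]; first by rewrite monic_map.
by rewrite coef_map; exact: fr.
Qed.

(** Provides the normalizing divisor in [rigidity]: divisibility in a valuation ring is total, so a
    finite family has a member of largest absolute value. *)
Lemma dominating (s : seq C) : (forall x, x \in s -> x = 0) \/
  exists2 x, x \in s /\ x != 0 & forall y, y \in s -> exists z, G (y / x, z).
Proof.
elim: s => [|a s [s0|[x [xs x0] xP]]]; first by left.
- have [->|a0] := eqVneq a 0; first by left=> x; rewrite inE => /predU1P[|/s0].
  right; exists a => [|y]; first by rewrite mem_head.
  rewrite inE => /predU1P[->|/s0 ->]; first by exists 1; rewrite divff //; exact: partial_hom1 hG.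
  by exists 0; rewrite mul0r; exact: partial_hom0 hG.
- right; case: (Gval (a / x)) => [ax|[ax0 axV]].
    exists x => [|y]; first by rewrite inE xs orbT.
    by rewrite inE => /predU1P[->|/xP].
  have a0 : a != 0 by apply: contraNneq ax0 => ->; rewrite mul0r.
  exists a => [|y]; first by rewrite mem_head.
  rewrite inE => /predU1P[->|/xP[z yz]].
    by exists 1; rewrite divff //; exact: partial_hom1 hG.
  exists (z * 0); have -> : y / a = (y / x) * (a / x)^-1 by field; rewrite x0.
  exact: (partial_homM hG yz axV).
Qed.

(* If f and g differed, dividing f - g by its largest value on generators     *)
(* would give a nonzero derivation of S over R along p.                       *)
Lemma rigidity (R S : comPzRingType) (u : {rmorphism R -> S})
    (f g : {rmorphism S -> C}) (p : {rmorphism S -> L}) :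
    finite_etale u -> f \o u =1 g \o u ->
    (forall z, G (f z, p z)) -> (forall z, G (g z, p z)) ->
  f =1 g.
Proof.
move=> [[m [n [h [_ [gen _]]]]] eu] fgu fp gp.
have sub0 z : (forall k, f (h k) = g (h k)) -> f z = g z.
  move=> H; have [r ->] := gen z; rewrite !rmorph_sum; apply: eq_bigr => k _.
  by rewrite !rmorphM H; congr (_ * _); exact: fgu.
case: (dominating [seq f (h k) - g (h k) | k <- enum 'I_n]) => [H|[x [/mapP[k0 _ ek0] x0] xP]].
  move=> z; apply: sub0 => k; apply/eqP; rewrite -subr_eq0; apply/eqP/H.
  by apply: map_f; rewrite mem_enum.
have dom z : exists y, G ((f z - g z) / x, y).
  have [r ->] := gen z.
  have yk k : exists y, G ((f (h k) - g (h k)) / x, y).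
    by apply: xP; apply: map_f; rewrite mem_enum.
  pose y k := sval (cid (yk k)).
  exists (\sum_k p (u (r 0 k)) * y k).
  rewrite !rmorph_sum /= -sumrB mulr_suml; apply: (partial_hom_sum hG) => k _.
  have -> : f (u (r 0 k) * h k) - g (u (r 0 k) * h k) = f (u (r 0 k)) * (f (h k) - g (h k)).
    by rewrite !rmorphM mulrBr; congr (_ - _ * _); exact: esym (fgu _).
  rewrite -mulrA; apply: (partial_homM hG); first exact: fp.
  exact: svalP (cid (yk k)).
pose d z := sval (cid (dom z)).
have dP z : G ((f z - g z) / x, d z) by exact: svalP (cid (dom z)).
have dE z y : G ((f z - g z) / x, y) -> d z = y by exact: (partial_hom_fun hG (dP z)).
have d0 := etale_no_derivation eu (p := p) (d := d).
have /eqP : d (h k0) = 0.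
  apply: d0 => [a b|a b|r]; apply: dE.
  - have -> : (f (a - b) - g (a - b)) / x = (f a - g a) / x - (f b - g b) / x.
      by rewrite !rmorphB; ring.
    exact: (partial_homB hG (dP a) (dP b)).
  - have -> : (f (a * b) - g (a * b)) / x = f a * ((f b - g b) / x) + (f a - g a) / x * g b.
      by rewrite !rmorphM; ring.
    exact: (partial_homD hG (partial_homM hG (fp a) (dP b)) (partial_homM hG (dP a) (gp b))).
  - by rewrite [f (u r)]fgu subrr mul0r; exact: partial_hom0 hG.
have -> : d (h k0) = 1 by apply: dE; rewrite -ek0 divff //; exact: partial_hom1 hG.
by rewrite oner_eq0.
Qed.

(* A K-algebra map cov_K Y -> Om is a geometric point of the cover over the   *)
(* generic point of the punctured formal disc; it specializes to the fiber    *)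
(* above T = 1 through the automorphism j and the place G.                    *)
Definition geom_point (Y : cover) := {k : {rmorphism cov_K Y -> Om} | k \o str_K Y =1 jK}.
Definition specializes (Y : cover) (k : geom_point Y) (p : fiber_point Y) :=
  forall z x, jC x = sval k (res_G Y z) -> G (j x, p z).

Lemma j_inj : injective j. Proof. exact: fmorph_inj. Qed.

(** Once T is sent to 1 + w, a polynomial in T is a power series in w whose constant term is its
    value at T = 1. This is how the place on [C], centred at w = 0, computes the fiber at T = 1. *)
Lemma Gm_place (f : {rmorphism Gm L -> C}) :
    (forall a, f (loc_of 'X a%:P) = c a) -> f (loc_of 'X 'X) = 1 + w ->
  forall z, G (f z, eval1 z).
Proof.
move=> fc fX z.
have pG p : G (f (loc_of 'X p), eval1 (loc_of 'X p)).
  have -> : f (loc_of 'X p) = poly_ev c w (p \Po (1 + 'X)).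
    by rewrite poly_ev_shift; exact: (poly_evE (f := f \o loc_of 'X)).
  have -> : eval1 (loc_of 'X p) = cterm (poly_powser (p \Po (1 + 'X))).
    by rewrite eval1E /cterm /= -horner_coef0 horner_comp !hornerE.
  by apply: Gbase; exact: jCw.
have [a' [n' /= e']] := loc_image (idfun : {rmorphism Gm L -> Gm L}) z (polyX_neq0 L).
have X1 : eval1 (loc_of 'X 'X) = 1 :> L by rewrite eval1E hornerX.
have fX0 := loc_unit_image f (polyX_neq0 L).
have -> : f z = f (loc_of 'X a') / f (loc_of 'X 'X) ^+ n'.
  by rewrite -e' rmorphM rmorphXn mulfK // expf_neq0.
have -> : eval1 z = eval1 (loc_of 'X a') / eval1 (loc_of 'X 'X) ^+ n'.
  by rewrite -e' rmorphM rmorphXn X1 expr1n !mulr1 ?divr1.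
apply: (partial_homM hG); first exact: pG.
apply: GV; last by rewrite X1 expr1n oner_neq0.
by apply: (partial_homX hG); exact: pG.
Qed.

Lemma subst_t p : jC (poly_ev c tC p) = jK (laurent_subst (tpar i bp) p).
Proof.
apply: (polyhom_ext (f := jC \o poly_ev c tC) (g := jK \o laurent_subst (tpar i bp))) => [a|].
  rewrite -[LHS]/(jC (poly_ev c tC _)) poly_evC -[LHS]/((jC \o c) a) jCc /=.
  by rewrite map_polyC /horner_eval hornerC.
by rewrite -[LHS]/(jC (poly_ev c tC _)) poly_evX jCt /= map_polyX /horner_eval hornerX.
Qed.

Lemma range_G (Y : cover) (k : geom_point Y) z : inC (sval k (res_G Y z)).
Proof.
case: k => k kK; apply: (range_finite (f := k \o res_G Y) z (cov_G_etale Y)) => r.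
rewrite /= -[res_G Y (str_G Y r)]/((res_G Y \o str_G Y) r) (proj1 (cov_G_pushout Y)) /=.
rewrite -[k _]/((k \o str_K Y) _) kK.
apply: (range_loc (f := jK \o iotaG (tpar_neq0 i bp)) _ (polyX_neq0 L)) => p.
exists (poly_ev c tC p); rewrite -[RHS]/(jK (iotaG _ (loc_of 'X p))) iotaGE.
exact: subst_t.
Qed.

Lemma range_X (Y : cover) (k : geom_point Y) z : inC (sval k (res_X Y z)).
Proof.
case: k => k kK; apply: (range_finite (f := k \o res_X Y) z (cov_X_etale Y)) => r.
rewrite /= -[res_X Y (str_X Y r)]/((res_X Y \o str_X Y) r) (proj1 (cov_X_pushout Y)) /=.
rewrite -[k _]/((k \o str_K Y) _) kK.
apply: (range_loc (f := jK \o iotaX) _ (X1X_neq0 L)) => p.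
exists (poly_ev c w p).
by rewrite -[RHS]/(jK (iotaX (loc_of _ p))) iotaXE; exact: jCw.
Qed.

Lemma geom_G (Y : cover) (k : geom_point Y) r :
  sval k (res_G Y (str_G Y r)) = jK (iotaG (tpar_neq0 i bp) r).
Proof.
case: k => k kK /=; rewrite -[res_G Y (str_G Y r)]/((res_G Y \o str_G Y) r).
by rewrite (proj1 (cov_G_pushout Y)) /= -[LHS]/((k \o str_K Y) _) kK.
Qed.

Lemma geom_X (Y : cover) (k : geom_point Y) r :
  sval k (res_X Y (str_X Y r)) = jK (iotaX r).
Proof.
case: k => k kK /=; rewrite -[res_X Y (str_X Y r)]/((res_X Y \o str_X Y) r).
by rewrite (proj1 (cov_X_pushout Y)) /= -[LHS]/((k \o str_K Y) _) kK.
Qed.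

Lemma geom_ext_G (Y : cover) (k k' : geom_point Y) :
  sval k \o res_G Y =1 sval k' \o res_G Y -> k = k'.
Proof.
case: k k' => k kK [k' kK'] /= e.
have kk' : k = k'.
  have [eq univ] := cov_G_pushout Y.
  have [|h [_ _ hu]] := univ _ (k \o res_G Y) jK.
    by move=> r; rewrite /= -[res_G Y (str_G Y r)]/((res_G Y \o str_G Y) r) eq /= -kK.
  apply: rmorphism_ext => y; rewrite (hu k (frefl _) kK).
  by rewrite (hu k' (fsym e) kK').
by case: _ / kk' kK' => kK'; rewrite (Prop_irrelevance kK kK').
Qed.

Lemma geom_ext_X (Y : cover) (k k' : geom_point Y) :
  sval k \o res_X Y =1 sval k' \o res_X Y -> k = k'.
Proof.
case: k k' => k kK [k' kK'] /= e.
have kk' : k = k'.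
  have [eq univ] := cov_X_pushout Y.
  have [|h [_ _ hu]] := univ _ (k \o res_X Y) jK.
    by move=> r; rewrite /= -[res_X Y (str_X Y r)]/((res_X Y \o str_X Y) r) eq /= -kK.
  apply: rmorphism_ext => y; rewrite (hu k (frefl _) kK).
  by rewrite (hu k' (fsym e) kK').
by case: _ / kk' kK' => kK'; rewrite (Prop_irrelevance kK kK').
Qed.

Lemma geom_of_G (Y : cover) (f : {rmorphism cov_G Y -> Om}) :
  f \o str_G Y =1 jK \o iotaG (tpar_neq0 i bp) ->
  exists k : geom_point Y, sval k \o res_G Y =1 f.
Proof.
by move=> fu; have [_ /(_ _ f jK fu)[k [kf kK _]]] := cov_G_pushout Y; exists (exist _ k kK).
Qed.

Lemma geom_of_X (Y : cover) (f : {rmorphism cov_X Y -> Om}) :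
  f \o str_X Y =1 jK \o iotaX -> exists k : geom_point Y, sval k \o res_X Y =1 f.
Proof.
by move=> fu; have [_ /(_ _ f jK fu)[k [kf kK _]]] := cov_X_pushout Y; exists (exist _ k kK).
Qed.

Lemma geom_scalars (f : {rmorphism Gm L -> C}) :
  (forall r, jC (f r) = jK (iotaG (tpar_neq0 i bp) r)) ->
  (forall a, f (loc_of 'X a%:P) = c a) /\ f (loc_of 'X 'X) = tC.
Proof.
move=> fE; split=> [a|]; apply: (fmorph_inj jC); rewrite fE iotaGE /=.
  by rewrite map_polyC /horner_eval hornerC -[RHS]/((jC \o c) a) jCc.
by rewrite map_polyX /horner_eval hornerX jCt.
Qed.

Lemma specialize (Y : cover) (k : geom_point Y) : exists p, specializes k p.
Proof.
have [f fE] := corestrict (f := sval k \o res_G Y) (range_G k).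
have [fc fX] := geom_scalars (f := f \o str_G Y) (fun r => etrans (fE _) (geom_G k r)).
have pl := Gm_place (f := j \o f \o str_G Y) (fun a => etrans (congr1 j (fc a)) (jc a))
  (etrans (congr1 j fX) jt).
have dom z : exists y, G (j (f z), y).
  by apply: (place_finite (f := j \o f) z (cov_G_etale Y)) => r; exists (eval1 r); exact: pl.
pose p z := sval (cid (dom z)).
have pP z : G (j (f z), p z) by exact: svalP (cid (dom z)).
have pE z y : G (j (f z), y) -> p z = y by exact: (partial_hom_fun hG (pP z)).
have [||p' p'E] := @rmorphism_exists _ _ p.
- by move=> x y; apply: pE; rewrite !rmorphB; exact: (partial_homB hG).
- split=> [|x y]; apply: pE; first by rewrite !rmorph1; exact: (partial_hom1 hG).
  by rewrite !rmorphM; exact: (partial_homM hG).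
have p'u : p' \o str_G Y =1 eval1 by move=> r; rewrite /= p'E; apply: pE; exact: pl.
exists (FiberPoint p'u) => z x xz /=; rewrite p'E.
by have -> : x = f z by apply: (fmorph_inj jC); rewrite xz fE.
Qed.

(** By étaleness the point extends to a section over the formal disc around T = 1, with values in
    power series in x = T - 1. The values are integral over functions in [C], hence lie in [C], and
    undoing [j] carries them to a geometric point over the punctured disc at 0. *)
Lemma generalize_point (Y : cover) (p : fiber_point Y) : exists k : geom_point Y, specializes k p.
Proof.
have [v vE] : exists v : powser L, (1 + pvar) * v = 1.
  by apply: powser_inv; rewrite ctermD rmorph1 cterm_pvar addr0 oner_neq0.
pose a0 : {rmorphism {poly L} -> powser L} := horner_eval (1 + pvar) \o map_poly (const_powser L).
have a0v : a0 'X * v = 1 by rewrite /a0 /= map_polyX /horner_eval hornerX.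
pose a : {rmorphism Gm L -> powser L} := loc_lift a0v.
have aE q : a (loc_of 'X q) = poly_powser (q \Po (1 + 'X)).
  rewrite /a /= loc_lift_of.
  have := @polyhom_ext _ _ a0 (@poly_powser L \o comp_poly (1 + 'X)).
  apply=> [b|] /=; first by rewrite map_polyC /horner_eval hornerC comp_polyC.
  by rewrite map_polyX /horner_eval hornerX comp_polyX rmorphD rmorph1.
have pa r : p (str_G Y r) = scoef (a r) 0.
  rewrite -[LHS]/((p \o str_G Y) r) fiber_point_over -[RHS]/((@cterm L \o a) r).
  move: r; apply: loc_ext => [|q]; first exact: polyX_neq0.
  rewrite -[LHS]/(eval1 (loc_of 'X q)) eval1E -[RHS]/(cterm (a (loc_of 'X q))) aE.
  by rewrite /cterm /= -horner_coef0 horner_comp !hornerE.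
have [b [bu bp0]] := etale_lift (proj2 (cov_G_etale Y)) pa.
pose f : {rmorphism cov_G Y -> Om} := jK \o (@FracField.tofrac (powser L)) \o b.
have fC z : inC (f z).
  apply: (range_finite z (cov_G_etale Y)) => r; rewrite /f /= bu.
  apply: (range_loc (f := jK \o (@FracField.tofrac (powser L)) \o a) _ (polyX_neq0 L)) => q.
  exists (poly_ev c w (q \Po (1 + 'X))).
  by rewrite -[RHS]/(jK (FracField.tofrac (a (loc_of 'X q)))) aE; exact: jCw.
have [g gE] := corestrict fC.
pose h z := sval (cid (jS (g z))).
have hE z : j (h z) = g z by exact: svalP (cid (jS (g z))).
have [||h' h'E] := @rmorphism_exists _ _ h.
- by move=> x y; apply: j_inj; rewrite rmorphB !hE rmorphB.
- by split=> [|x y]; apply: j_inj; rewrite ?rmorphM !hE ?rmorph1 ?rmorphM.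
have [|k kE] := @geom_of_G Y (jC \o h').
  apply: loc_ext => [|q]; first exact: polyX_neq0.
  rewrite -[RHS]/(jK (iotaG _ (loc_of 'X q))) iotaGE -subst_t -[LHS]/(jC (h' (str_G Y (loc_of 'X q)))).
  congr (jC _); apply: (poly_evE (f := h' \o str_G Y \o loc_of 'X)) => [x|].
    apply: j_inj; rewrite -[LHS]/(j (h' (str_G Y _))) h'E hE [RHS]jc; apply: (fmorph_inj jC).
    rewrite gE -[LHS]/(jK (FracField.tofrac (b (str_G Y _)))) bu aE comp_polyC.
    by rewrite -[RHS]/((jC \o c) x) jCc.
  apply: j_inj; rewrite -[LHS]/(j (h' (str_G Y _))) h'E hE jt; apply: (fmorph_inj jC).
  rewrite gE -[LHS]/(jK (FracField.tofrac (b (str_G Y _)))) bu aE comp_polyX.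
  have -> : 1 + w = poly_ev c w (1 + 'X) by rewrite rmorphD rmorph1 poly_evX.
  by rewrite [RHS]jCw.
exists k => z x; rewrite -[sval k _]/((sval k \o res_G Y) z) kE /= h'E => /(fmorph_inj jC) ->.
by rewrite hE -bp0; apply: Gbase; rewrite gE.
Qed.

Lemma specializes_fun (Y : cover) (k : geom_point Y) p q :
  specializes k p -> specializes k q -> p = q.
Proof.
move=> kp kq; apply: fiber_point_ext => z; have [x xz] := range_G k z.
exact: (partial_hom_fun hG (kp z x xz) (kq z x xz)).
Qed.

Lemma specializes_inj (Y : cover) (k k' : geom_point Y) p :
  specializes k p -> specializes k' p -> k = k'.
Proof.
move=> kp kp'; apply: geom_ext_G => z.
have [f fE] := corestrict (f := sval k \o res_G Y) (range_G k).
have [g gE] := corestrict (f := sval k' \o res_G Y) (range_G k').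
rewrite -fE -gE; congr (jC _); apply: j_inj.
apply: (rigidity (f := j \o f) (g := j \o g) (p := p) (cov_G_etale Y)) => [r|y|y] /=.
- congr (j _); apply: (fmorph_inj jC); rewrite fE gE /=.
  by rewrite !geom_G.
- by apply: kp; rewrite fE.
- by apply: kp'; rewrite gE.
Qed.

Section Automorphism.
Variable s : {rmorphism C -> C}.
Hypothesis sc : s \o c =1 c.
Hypothesis sw : s w = w.
Hypothesis sS : forall y, exists x, s x = y.

(** The point [k'] is [s] after [k]. This is stated on [cov_X] because [s] acts on [C] alone, while
    values of [k] on [cov_K] include arbitrary Laurent series. *)
Definition moves (Y : cover) (k k' : geom_point Y) :=
  forall z x, jC x = sval k (res_X Y z) -> jC (s x) = sval k' (res_X Y z).

Lemma fix_base q : s (poly_ev c w q) = poly_ev c w q.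
Proof.
apply: (poly_evE (f := s \o poly_ev c w)) => [a|].
  by rewrite -[LHS]/(s (poly_ev c w _)) poly_evC; exact: sc.
by rewrite -[LHS]/(s (poly_ev c w _)) poly_evX.
Qed.

Lemma geom_X_base (Y : cover) (k : geom_point Y) q :
  sval k (res_X Y (str_X Y (loc_of _ q))) = jC (poly_ev c w q).
Proof. by rewrite geom_X iotaXE; exact: esym (jCw q). Qed.

Lemma moves_total (Y : cover) (k : geom_point Y) : exists k', moves k k'.
Proof.
have [f fE] := corestrict (f := sval k \o res_X Y) (range_X k).
have [|k' k'E] := @geom_of_X Y (jC \o s \o f).
  apply: loc_ext => [|q]; first exact: X1X_neq0.
  have e : f (str_X Y (loc_of _ q)) = poly_ev c w q.
    by apply: (fmorph_inj jC); rewrite fE /= geom_X_base.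
  rewrite -[LHS]/(jC (s (f (str_X Y (loc_of _ q))))) e fix_base.
  by rewrite -[RHS]/(jK (iotaX (loc_of _ q))) iotaXE; exact: jCw.
exists k' => z x xz; rewrite -[RHS]/((sval k' \o res_X Y) z) k'E /=; congr (jC (s _)).
by apply: (fmorph_inj jC); rewrite xz fE.
Qed.

Lemma moves_surj (Y : cover) (k' : geom_point Y) : exists k, moves k k'.
Proof.
have [f fE] := corestrict (f := sval k' \o res_X Y) (range_X k').
pose h z := sval (cid (sS (f z))).
have hE z : s (h z) = f z by exact: svalP (cid (sS (f z))).
have sI : injective s by exact: fmorph_inj.
have [||h' h'E] := @rmorphism_exists _ _ h.
- by move=> x y; apply: sI; rewrite rmorphB !hE rmorphB.
- by split=> [|x y]; apply: sI; rewrite ?rmorphM !hE ?rmorph1 ?rmorphM.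
have [|k kE] := @geom_of_X Y (jC \o h').
  apply: loc_ext => [|q]; first exact: X1X_neq0.
  have e : h' (str_X Y (loc_of _ q)) = poly_ev c w q.
    apply: sI; rewrite h'E hE fix_base; apply: (fmorph_inj jC).
    by rewrite fE /= geom_X_base.
  rewrite -[LHS]/(jC (h' (str_X Y (loc_of _ q)))) e.
  by rewrite -[RHS]/(jK (iotaX (loc_of _ q))) iotaXE; exact: jCw.
exists k => z x; rewrite -[sval k _]/((sval k \o res_X Y) z) kE /= => /(fmorph_inj jC) ->.
by rewrite h'E hE fE.
Qed.

Lemma moves_fun (Y : cover) (k k1 k2 : geom_point Y) : moves k k1 -> moves k k2 -> k1 = k2.
Proof.
move=> m1 m2; apply: geom_ext_X => z; have [x xz] := range_X k z.
by rewrite /= -(m1 z x xz) -(m2 z x xz).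
Qed.

Lemma moves_inj (Y : cover) (k1 k2 k : geom_point Y) : moves k1 k -> moves k2 k -> k1 = k2.
Proof.
move=> m1 m2; apply: geom_ext_X => z /=.
have [x1 e1] := range_X k1 z; have [x2 e2] := range_X k2 z.
rewrite -e1 -e2; congr (jC _); apply: (fmorph_inj s); apply: (fmorph_inj jC).
by rewrite (m1 _ _ e1) (m2 _ _ e2).
Qed.

Fact pull_geom_str (Y Y' : cover) (f : fet_cover_hom Y Y') (k : geom_point Y') :
  (sval k \o hom_K f) \o str_K Y =1 jK.
Proof. by case: k => k kK z /=; rewrite -[hom_K f _]/((hom_K f \o _) z) hom_K_str -kK. Qed.

Definition pull_geom (Y Y' : cover) (f : fet_cover_hom Y Y') (k : geom_point Y') : geom_point Y :=
  exist _ (sval k \o hom_K f : {rmorphism _ -> _}) (pull_geom_str f k).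

Lemma specializes_pull (Y Y' : cover) (f : fet_cover_hom Y Y') (k : geom_point Y') p :
  specializes k p -> specializes (pull_geom f k) (pull f p).
Proof.
move=> kp z x /= xz; apply: kp; rewrite xz; congr (sval k _).
exact: (hom_G_res f z).
Qed.

Lemma moves_pull (Y Y' : cover) (f : fet_cover_hom Y Y') (k k' : geom_point Y') :
  moves k k' -> moves (pull_geom f k) (pull_geom f k').
Proof.
move=> m z x /= xz; rewrite -[hom_K f _]/((hom_K f \o res_X Y) z) hom_X_res /=.
apply: m; rewrite xz; congr (sval k _); exact: (hom_X_res f z).
Qed.

Definition pi1_rel (Y : cover) (p p' : fiber_point Y) :=
  exists k k', [/\ specializes k p, moves k k' & specializes k' p'].

(** A geometric point is determined by its restriction to [cov_X], on which [s] acts, and also by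
    its restriction to [cov_G], through which it corresponds to a point of the fiber. Transporting
    the action from one side to the other is natural in the cover, hence an element of the
    fundamental group. *)
Lemma automorphism_pi1 : exists g : pi1 i bp, forall Y p p', pi1_rel (Y := Y) p p' -> g Y p = p'.
Proof.
have tot Y (p : fiber_point Y) : exists p', pi1_rel p p'.
  have [k kp] := generalize_point p; have [k' kk'] := moves_total k.
  by have [p' kp'] := specialize k'; exists p', k, k'.
pose g Y (p : fiber_point Y) := sval (cid (tot Y p)).
have gP Y p : pi1_rel p (g Y p) by exact: svalP (cid (tot Y p)).
have fn Y p p1 p2 : pi1_rel (Y := Y) p p1 -> pi1_rel p p2 -> p1 = p2.
  move=> [k [k1 [kp m1 k1p]]] [k' [k2 [kp' m2 k2p]]].
  move: m2; rewrite -(specializes_inj kp kp') => /(moves_fun m1) e.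
  by apply: (specializes_fun k1p); rewrite e.
have ij Y p1 p2 p : pi1_rel (Y := Y) p1 p -> pi1_rel p2 p -> p1 = p2.
  move=> [k1 [k [k1p m1 kp]]] [k2 [k' [k2p m2 kp']]].
  move: m1; rewrite (specializes_inj kp kp') => /moves_inj /(_ m2) e.
  by apply: (specializes_fun k1p); rewrite e.
have sj Y p' : exists p, pi1_rel (Y := Y) p p'.
  have [k' kp'] := generalize_point p'; have [k kk'] := moves_surj k'.
  by have [p kp] := specialize k; exists p, k, k'.
have gE Y p p' : pi1_rel (Y := Y) p p' -> g Y p = p' by exact: fn.
have gn Y Y' (f : fet_cover_hom Y Y') (p : fiber_point Y') : g Y (pull f p) = pull f (g Y' p).
  apply: gE; have [k [k' [kp m kp']]] := gP _ p.
  by exists (pull_geom f k), (pull_geom f k'); split; [exact: specializes_pull|exact: moves_pull|exact: specializes_pull].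
have gb Y : bijective (g Y).
  pose h p' := sval (cid (sj Y p')).
  have hP p' : pi1_rel (h p') p' by exact: svalP (cid (sj Y p')).
  exists h => p; last exact: gE.
  exact: ij (hP _) (gP _ _).
by exists (Pi1 gn gb).
Qed.

End Automorphism.

(** Injectivity on [cov_X] is what connectedness provides: two geometric points then embed [cov_X]
    into [C], and the isomorphism between the two images, over L[w], extends to an automorphism of
    [C], which carries one point to the other. *)
Lemma transitivity (Halg : forall y, algebraic_over c w y) (Y : cover) (p0 p1 : fiber_point Y) :
    (forall k : geom_point Y, injective (sval k \o res_X Y)) ->
  exists g : pi1 i bp, g Y p0 = p1.
Proof.
move=> kI; have [k0 kp0] := generalize_point p0; have [k1 kp1] := generalize_point p1.
have wI : injective (poly_ev c w).
  move=> p q pq; apply/eqP; rewrite -subr_eq0 -laurent_of_poly_eq0 -(fmorph_eq0 jK).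
  rewrite -[jK _]/((jK \o laurent_of_poly) (p - q)) -jCw.
  by rewrite -[(_ \o _) _]/(jC (poly_ev c w (p - q))) rmorphB pq subrr rmorph0.
pose G0 : set (C * C) := fun x => exists z,
  jC x.1 = sval k0 (res_X Y z) /\ jC x.2 = sval k1 (res_X Y z).
have [|||s sE] := @total_extension _ C C (poly_ev c w) (poly_ev c w) G0 wI.
- split.
  + by exists 1; rewrite !rmorph1.
  + by move=> [a b] [a' b'] [z /= [az bz]] [z' /= [az' bz']]; exists (z - z'); rewrite !rmorphB az az' bz bz'.
  + by move=> [a b] [a' b'] [z /= [az bz]] [z' /= [az' bz']]; exists (z * z'); rewrite !rmorphM az az' bz bz'.
  + move=> y [z /= []]; rewrite rmorph0 => /esym z0.
    have -> : z = 0 by apply: (kI k0); rewrite /= z0 !rmorph0.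
    by rewrite !rmorph0 => /eqP; rewrite fmorph_eq0 => /eqP.
- by move=> q; exists (str_X Y (loc_of _ q)); rewrite !geom_X_base.
- exact: Halg.
have sw q : s (poly_ev c w q) = poly_ev c w q.
  by apply: sE; exists (str_X Y (loc_of _ q)); rewrite !geom_X_base.
have [|||g gE] := @automorphism_pi1 s.
- by move=> a; rewrite /= -(poly_evC c w a) sw.
- by rewrite -{1}(poly_evX c w) sw poly_evX.
- apply: (extension_surj (a := poly_ev c w) wI) => y.
  have [p pn0 py] := Halg y; exists p => //.
  by rewrite (eq_map_poly (g := poly_ev c w)).
exists g; apply: gE; exists k0, k1; split=> // z x xz.
have [y yz] := range_X k1 z.
by rewrite -yz; congr (jC _); apply: sE; exists z.
Qed.

End Fiber.

Lemma tparE (F L : fieldType) (i : {rmorphism F -> L}) (bp : tangential_base_point F) :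
  exists P Q : {poly L},
  [/\ tpar i bp = FracField.tofrac (poly_powser P) / FracField.tofrac (poly_powser Q),
      Q.[0] != 0, P.[0] = 0 & P^`().[0] * i (tbp_vec bp) = Q.[0] ].
Proof.
have [p [q [e q0 p0 d]]] := tbp_par_dual bp.
have qn0 : q != 0 by apply: contraNneq q0 => ->; rewrite horner0.
exists (map_poly i p), (map_poly i q).
have m0 (r : {poly F}) : (map_poly i r).[0] = i r.[0] by rewrite -[0 in LHS](rmorph0 i) horner_map.
rewrite deriv_map !m0 fmorph_eq0 q0 p0 rmorph0; split=> //.
  by rewrite /tpar e frac_mapE.
rewrite -rmorphM; congr (i _); move: d; rewrite p0 mul0r subr0 => d.
apply: (mulIf (invr_neq0 q0)); rewrite mulfV // -d; field; exact: q0.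
Qed.

Section Transitive.
Variables (F : fieldType) (L : closedFieldType) (i : {rmorphism F -> L}).
Variable bp : tangential_base_point F.

Section GenericElement.
Variables (C : fieldType) (c : {rmorphism L -> C}) (w : C).
Hypothesis wI : injective (poly_ev c w).

Lemma generic_not_const a : w <> c a.
Proof.
move=> wa; have /eqP : 'X - a%:P = 0 :> {poly L}.
  by apply: wI; rewrite rmorphB poly_evX poly_evC wa subrr rmorph0.
by rewrite polyXsubC_eq0.
Qed.

Lemma parameter_generic (P Q : {poly L}) t :
    Q.[0] != 0 -> P.[0] = 0 -> P^`().[0] != 0 ->
    poly_ev c w P = t * poly_ev c w Q ->
  injective (poly_ev c t) /\ algebraic_over c t w.
Proof.
move=> Q0 P0 P1 e; split.
  apply: poly_ev_inj => a ta; have PQ : P = a%:P * Q.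
    by apply: wI; rewrite e ta rmorphM poly_evC.
  have : a = 0.
    by move: P0; rewrite PQ hornerM hornerC => /eqP; rewrite mulf_eq0 (negPf Q0) orbF => /eqP.
  by move=> a0; move: P1; rewrite PQ a0 mul0r derivC horner0 eqxx.
(* The polynomial P(X) - T Q(X), with the inner variable as T, to be evaluated at t. Its part linear
   in T is -Q, which is why it is nonzero. *)
exists (map_poly polyC P - 'X%:P * map_poly polyC Q).
  apply: contraNneq Q0 => r0; suff -> : Q = 0 by rewrite horner0.
  apply/polyP => k; have := congr1 (fun r : {poly {poly L}} => r`_k`_1) r0.
  rewrite coefB coefCM !coef_map /= coefB coefXM coefC /= coefC /= sub0r !coef0 => /eqP.
  by rewrite oppr_eq0 => /eqP.
have ev (z : C) r : (map_poly (poly_ev c z) (map_poly polyC r)).[w] = poly_ev c w r.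
  rewrite -map_poly_comp /poly_ev /= /horner_eval; congr (_.[_]); apply: eq_map_poly => a /=.
  exact: poly_evC.
rewrite rootE rmorphB rmorphM /= hornerD hornerN hornerM !ev map_polyC hornerC.
by rewrite [X in X * _](_ : _ = t) ?e ?subrr //; exact: poly_evX.
Qed.

End GenericElement.

(** The parameter t and 1 + w are both transcendental over [L], and [C] is algebraic over the field
    generated by either; so t |-> 1 + w extends to an automorphism [j] of [C]. The place extends the
    constant term on those elements of [C] that are power series. *)
Theorem fiber_transitive (Y : fet_cover i bp) (p0 p1 : fiber_point Y) :
    (forall (Om : fieldType) (jK : {rmorphism {laurent L} -> Om})
       (k : {rmorphism cov_K Y -> Om}),
       k \o str_K Y =1 jK -> injective (k \o res_X Y)) ->
  exists g : pi1 i bp, g Y p0 = p1.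
Proof.
move=> YI; have [C [Om [jK [jC [c [w [jCc jCw Halg _]]]]]]] := exists_universal_field L.
have wI : injective (poly_ev c w).
  move=> p q pq; apply/eqP; rewrite -subr_eq0 -laurent_of_poly_eq0 -(fmorph_eq0 jK).
  rewrite -[jK _]/((jK \o laurent_of_poly) (p - q)) -jCw.
  by rewrite -[(_ \o _) _]/(jC (poly_ev c w (p - q))) rmorphB pq subrr rmorph0.
have [P [Q [te Q0 P0 PQ]]] := tparE i bp.
have P1 : P^`().[0] != 0.
  by apply: contraNneq Q0 => P10; rewrite -PQ P10 mul0r.
have ev0 q : q != 0 -> poly_ev c w q != 0.
  by move=> qn0; rewrite -(rmorph0 (poly_ev c w)) (inj_eq wI).
have Qn0 : Q != 0 by apply: contraNneq Q0 => ->; rewrite horner0.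
pose tC := poly_ev c w P / poly_ev c w Q.
have jCt : jC tC = jK (tpar i bp).
  by rewrite te !fmorph_div; congr (_ / _); exact: jCw.
have [tI talg] : injective (poly_ev c tC) /\ algebraic_over c tC w.
  by apply: (parameter_generic wI Q0 P0 P1); rewrite divfK // ev0.
have [w1I w1alg] : injective (poly_ev c (1 + w)) /\ algebraic_over c (1 + w) w.
  split; first by apply: poly_ev_inj => a e; apply: (@generic_not_const _ _ _ wI (a - 1)); rewrite rmorphB rmorph1 -e addrC addKr.
  exists ('X - ('X - 1)%:P); first by rewrite polyXsubC_eq0.
  rewrite rmorphB /= map_polyX map_polyC /= root_XsubC.
  have -> : horner_eval (1 + w) (map_poly c ('X - 1)) = poly_ev c (1 + w) ('X - 1) by [].
  by rewrite rmorphB rmorph1 poly_evX addrC addKr.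
have alg_t y : algebraic_over c tC y by exact: algebraic_over_trans wI tI talg (Halg y).
have alg_1 y : algebraic_over c (1 + w) y by exact: algebraic_over_trans wI w1I w1alg (Halg y).
pose G0 : set (C * C) := fun x => exists q, x = (poly_ev c tC q, poly_ev c (1 + w) q).
have [|||j jE] := @total_extension _ C C (poly_ev c tC) (poly_ev c (1 + w)) G0 w1I.
- split.
  + by exists 1; rewrite !rmorph1.
  + by move=> _ _ [q ->] [q' ->]; exists (q - q'); rewrite !rmorphB.
  + by move=> _ _ [q ->] [q' ->]; exists (q * q'); rewrite !rmorphM.
  + move=> y [q [q0 ->]]; have -> : q = 0 by apply: tI; rewrite rmorph0.
    exact: (rmorph0 (poly_ev c (1 + w))).
- by move=> q; exists q.
- exact: alg_t.
have jev q : j (poly_ev c tC q) = poly_ev c (1 + w) q by apply: jE; exists q.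
have jc : j \o c =1 c by move=> a; rewrite /= -[in LHS](poly_evC c tC a) jev poly_evC.
have jt : j tC = 1 + w by rewrite -{1}(poly_evX c tC) jev poly_evX.
have jS y : exists x, j x = y.
  apply: (extension_surj (a := poly_ev c tC) tI) => z.
  by have [p pn0 pz] := alg_1 z; exists p => //; rewrite (eq_map_poly (g := poly_ev c (1 + w))).
pose G1 : set (C * L) := fun x => exists a, jC x.1 = jK (FracField.tofrac a) /\ x.2 = cterm a.
have [||G [hG G1G GV Gval]] := @place_extension C L _ G1.
- exact: closed_has_root.
- split.
  + by exists 1; rewrite rmorph1 tofrac1 !rmorph1.
  + by move=> [x y] [x' y'] [a /= [xa ->]] [a' /= [xa' ->]]; exists (a - a'); rewrite rmorphB xa xa' tofracB !rmorphB.
  + by move=> [x y] [x' y'] [a /= [xa ->]] [a' /= [xa' ->]]; exists (a * a'); rewrite rmorphM xa xa' tofracM !rmorphM.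
  + move=> y [a /= [e ->]]; move/eqP: e; rewrite rmorph0 eq_sym fmorph_eq0 tofrac_eq0 => /eqP ->.
    by rewrite rmorph0.
apply: (transitivity jCc jCw jCt jc jt jS hG GV Gval _ Halg).
  by move=> a x xa; apply: G1G; exists a.
by move=> [k kK]; exact: YI kK.
Qed.

End Transitive.

(** * Free algebras, pushouts and etale products *)

Definition spans (R S : comPzRingType) (u : R -> S) (J : finType) (g : J -> S) :=
  forall z, exists r : J -> R, z = \sum_k u (r k) * g k.

Definition independent (R S : comPzRingType) (u : R -> S) (J : finType) (g : J -> S) :=
  forall r : J -> R, \sum_k u (r k) * g k = 0 -> forall k, r k = 0.

Section Reindex.
Variables (R S : comPzRingType) (u : R -> S) (J J' : finType) (h : J' -> J) (h' : J -> J').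
Hypotheses (hK : cancel h h') (h'K : cancel h' h).

Lemma spans_reindex (g : J -> S) : spans u g -> spans u (g \o h).
Proof.
move=> sg z; have [r ->] := sg z; exists (r \o h).
by rewrite (reindex h) //; exists h' => k _; rewrite ?hK ?h'K.
Qed.

Lemma independent_reindex (g : J -> S) : independent u g -> independent u (g \o h).
Proof.
move=> ig r r0 k; rewrite -[k]hK; apply: (ig (r \o h')) => {k}.
rewrite (reindex h) /=; last by exists h' => k _; rewrite ?hK ?h'K.
by under eq_bigr do rewrite hK.
Qed.

End Reindex.

Lemma free_finitely_presented (R S : comPzRingType) (u : {rmorphism R -> S}) (J : finType) (g : J -> S) :
  spans u g -> independent u g -> finitely_presented u.
Proof.
move=> /(spans_reindex (@enum_valK J) (@enum_rankK J)) sg.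
move=> /(independent_reindex (@enum_valK J) (@enum_rankK J)) ig.
exists 0%N, #|J|, (g \o enum_val), 0; split=> [z|r].
  by have [r ->] := sg z; exists (\row_k r k); apply: eq_bigr => k _; rewrite mxE.
split=> [/ig r0|[q ->]]; last by rewrite mulmx0 big1 // => k _; rewrite mxE rmorph0 mul0r.
by exists 0; rewrite mulmx0; apply/rowP => k; rewrite mxE r0.
Qed.

Lemma independent_base (A B C E : comPzRingType) (f : {rmorphism A -> B}) (g : {rmorphism A -> C})
    (b : {rmorphism B -> E}) (c : {rmorphism C -> E}) (J : finType) (e : J -> B) :
  b \o f =1 c \o g -> injective g -> independent c (b \o e) -> independent f e.
Proof.
move=> bc gI ind r r0 k; apply: gI; rewrite rmorph0; apply: (ind (g \o r)).
transitivity (b (\sum_k f (r k) * e k)); last by rewrite r0 rmorph0.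
rewrite rmorph_sum; apply: eq_bigr => l _; rewrite rmorphM; congr (_ * _).
exact: esym (bc _).
Qed.

(** A spanning family of [B] over [A] that becomes a basis of [E] over [C] forces E to be the tensor
    product, without any tensor product being formed. The universal map is defined on coordinates;
    that it sends c y * b x to c' y * b' x gives multiplicativity. *)
Lemma basis_pushout (A B C E : comPzRingType) (f : {rmorphism A -> B}) (g : {rmorphism A -> C})
    (b : {rmorphism B -> E}) (c : {rmorphism C -> E}) (J : finType) (e : J -> B) :
  b \o f =1 c \o g -> spans f e -> spans c (b \o e) -> independent c (b \o e) ->
  is_pushout f g b c.
Proof.
move=> bc sf sc ind; split=> // Z b' c' b'c'.
pose h y := \sum_k c' (sval (cid (sc y)) k) * b' (e k).
have hE r : h (\sum_k c (r k) * b (e k)) = \sum_k c' (r k) * b' (e k).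
  rewrite /h; case: (cid _) => r' /= er; apply: eq_bigr => k _; congr (c' _ * _).
  apply/eqP; rewrite -subr_eq0; apply/eqP; move: k; apply: (ind (fun k => r' k - r k)).
  under eq_bigr do rewrite rmorphB mulrBl.
  by rewrite sumrB /= -er subrr.
have hD x y : h (x + y) = h x + h y.
  have [r ->] := sc x; have [r' ->] := sc y; rewrite -big_split /=.
  under eq_bigr do rewrite -mulrDl -rmorphD.
  rewrite (hE (fun k => r k + r' k)) !hE -big_split; apply: eq_bigr => k _.
  by rewrite rmorphD mulrDl.
have hcb y x : h (c y * b x) = c' y * b' x.
  have [a ->] := sf x.
  have -> : c y * b (\sum_k f (a k) * e k) = \sum_k c (y * g (a k)) * b (e k).
    rewrite rmorph_sum mulr_sumr; apply: eq_bigr => k _.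
    by rewrite !rmorphM mulrA; congr (_ * _ * _); exact: bc.
  rewrite (hE (fun k => y * g (a k))) rmorph_sum mulr_sumr; apply: eq_bigr => k _.
  by rewrite !rmorphM mulrA; congr (_ * _ * _); exact: esym (b'c' _).
have hsum (y : J -> E) : h (\sum_k y k) = \sum_k h (y k).
  elim/big_rec2: _ => [|k x z _ <-]; last by rewrite hD.
  by have := hcb 0 0; rewrite !rmorph0 !mul0r.
have [||h' h'E] := @rmorphism_exists _ _ h.
- by move=> x y; rewrite -[in RHS](subrK y x) [in RHS]hD addrK.
- split=> [|x y]; first by rewrite -(mulr1 1) -{1}(rmorph1 c) -(rmorph1 b) hcb !rmorph1 mulr1.
  have [r ->] := sc x; have [r' ->] := sc y.
  rewrite mulr_suml !hsum mulr_suml; apply: eq_bigr => k _.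
  rewrite mulr_sumr hsum mulr_sumr; apply: eq_bigr => l _.
  by rewrite /= mulrACA -!rmorphM !hcb !rmorphM mulrACA.
exists h'; split=> [x|y|k kb kc y].
- by rewrite /= h'E -[b x]mul1r -(rmorph1 c) hcb rmorph1 mul1r.
- by rewrite /= h'E -[c y]mulr1 -(rmorph1 b) hcb rmorph1 mulr1.
- have [r ->] := sc y; rewrite h'E hE rmorph_sum; apply: eq_bigr => l _.
  by rewrite rmorphM; congr (_ * _); [exact: kc|exact: kb].
Qed.

Lemma independent_spans_ord (K : fieldType) (E : comPzRingType) (c : {rmorphism K -> E}) n
    (e b : 'I_n -> E) : spans c e -> independent c b -> spans c b.
Proof.
move=> se ib; pose M := \matrix_(k, l) sval (cid (se (b k))) l.
have bE k : b k = \sum_l c (M k l) * e l.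
  by rewrite [LHS](svalP (cid (se (b k)))); apply: eq_bigr => l _; rewrite mxE.
have comb (r : 'rV_n) : \sum_k c (r 0 k) * b k = \sum_l c ((r *m M) 0 l) * e l.
  under eq_bigr do rewrite bE mulr_sumr.
  rewrite exchange_big; apply: eq_bigr => l _; rewrite mxE rmorph_sum mulr_suml.
  by apply: eq_bigr => k _; rewrite rmorphM mulrA.
have Mfree : row_free M.
  rewrite -kermx_eq0; apply/rowV0P => r /sub_kermxP rM; apply/rowP => k; rewrite mxE.
  apply: (ib (fun k => r 0 k)); rewrite comb rM; apply: big1 => l _.
  by rewrite mxE rmorph0 mul0r.
move=> z; have [r ->] := se z.
exists (fun k => ((\row_l r l) *m invmx M) 0 k); rewrite comb mulmxKV.
  by apply: eq_bigr => l _; rewrite mxE.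
by rewrite -row_free_unit.
Qed.

Lemma independent_spans (K : fieldType) (E : comPzRingType) (c : {rmorphism K -> E})
    (J J' : finType) (e : J -> E) (b : J' -> E) :
  #|J| = #|J'| -> spans c e -> independent c b -> spans c b.
Proof.
move=> JJ' /(spans_reindex (@enum_valK J) (@enum_rankK J)) se ib.
pose h (k : 'I_#|J|) : J' := enum_val (cast_ord JJ' k).
pose h' (l : J') : 'I_#|J| := cast_ord (esym JJ') (enum_rank l).
have hK : cancel h h' by move=> k; rewrite /h /h' enum_valK cast_ordK.
have h'K : cancel h' h by move=> l; rewrite /h /h' cast_ordKV enum_rankK.
have := independent_spans_ord se (independent_reindex hK h'K ib).
move/(spans_reindex h'K hK); move=> sb z; have [r ->] := sb z.
by exists r; apply: eq_bigr => k _; rewrite /= h'K.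
Qed.

Section SquareZero.
Variables (T T0 : comPzRingType) (pi : {rmorphism T -> T0}).
Hypothesis pi_sq0 : forall x y, pi x = 0 -> pi y = 0 -> x * y = 0.
Hypothesis pi_surj : forall y, exists x, pi x = y.

Lemma lift_unit x y : pi x * y = 1 -> exists z, x * z = 1.
Proof.
have [y' <-] := pi_surj y; rewrite -rmorphM => xy.
have m0 : pi (1 - x * y') = 0 by rewrite rmorphB xy rmorph1 subrr.
exists (y' * (1 + (1 - x * y'))); transitivity (1 - (1 - x * y') * (1 - x * y')); first by ring.
by rewrite (pi_sq0 m0 m0) subr0.
Qed.

Lemma idempotent_eq0 x : x * x = x -> pi x = 0 -> x = 0.
Proof. by move=> xx x0; rewrite -xx; exact: pi_sq0. Qed.

Lemma idempotent_unique x y : x * x = x -> y * y = y -> pi x = pi y -> x = y.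
Proof.
move=> xx yy e.
have half z t : z * z = z -> t * t = t -> pi z = pi t -> z * (1 - t) = 0.
  move=> zz tt zt; apply: idempotent_eq0.
    transitivity ((z * z) * (1 - t - t + t * t)); first by ring.
    by rewrite zz tt; ring.
  by rewrite rmorphM rmorphB rmorph1 zt mulrBr mulr1 -rmorphM tt subrr.
have /eqP := half _ _ xx yy e; rewrite mulrBr mulr1 subr_eq0 => /eqP h1.
have /eqP := half _ _ yy xx (esym e); rewrite mulrBr mulr1 subr_eq0 => /eqP h2.
by rewrite h1 mulrC -h2.
Qed.

Lemma lift_idempotent y : y * y = y -> exists x, x * x = x /\ pi x = y.
Proof.
have [x <-] := pi_surj y => xx.
have m0 : pi (x * x - x) = 0 by rewrite rmorphB rmorphM xx subrr.
(* The polynomial 3 X^2 - 2 X^3 is 0 modulo X^2 and 1 modulo (X - 1)^2. *)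
exists (x * x *+ 3 - x * x * x *+ 2); split; last first.
  by rewrite rmorphB !rmorphMn !rmorphM !xx -mulrnBr.
apply/eqP; rewrite -subr_eq0; apply/eqP.
transitivity ((x * x - x) * (x * x - x) * (x * x *+ 4 - x *+ 4 - 1 *+ 3)); first by ring.
by rewrite (pi_sq0 m0 m0) mul0r.
Qed.

End SquareZero.

Lemma pz_eval_exists (R : comNzRingType) (T : comPzRingType) (a : {rmorphism R -> T}) x :
  exists f : {rmorphism {poly R} -> T}, (forall r, f r%:P = a r) /\ f 'X = x.
Proof.
have [T1|T1] := eqVneq (1 : T) 0.
  have T0 (y : T) : y = 0 by rewrite -[y]mul1r T1 mul0r.
  have [||f _] := @rmorphism_exists {poly R} T (fun=> 0).
  - by move=> y z; rewrite subrr.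
  - by split=> [|y z]; [rewrite T1|rewrite mulr0].
  exists f; split=> [r|]; first by rewrite (T0 (f _)) (T0 (a r)).
  by rewrite (T0 (f _)) (T0 x).
pose T' : comNzRingType := HB.pack (GRing.ComPzRing.sort T) (GRing.PzSemiRing_isNonZero.Build _ T1).
pose a' : {rmorphism R -> T'} := a.
pose f : {rmorphism {poly R} -> T'} := horner_eval (x : T') \o map_poly a'.
exists f; split=> [r|]; rewrite /f /= ?map_polyC ?map_polyX /horner_eval ?hornerC ?hornerX //.
Qed.

Lemma eval_taylor1 (R : comNzRingType) (T : comPzRingType) (f g : {rmorphism {poly R} -> T}) p :
  (forall r, f r%:P = g r%:P) ->
  exists q, f p = g p + g p^`() * (f 'X - g 'X) + (f 'X - g 'X) * (f 'X - g 'X) * q.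
Proof.
move=> fg; elim/poly_ind: p => [|p c [q IHp]].
  by exists 0; rewrite linear0 !rmorph0; ring.
exists (g p^`() + q * f 'X).
rewrite derivMXaddC !rmorphD !rmorphM IHp fg /=.
move: (f 'X) (g 'X) (g p) (g p^`()) (g c%:P) => x y z t s; ring.
Qed.

(** Standard étale algebras: [S] classifies the roots of [p] at which the derivative is invertible.
    Modulo a square-zero ideal, one Newton step turns any lift of the root into an exact root, and
    Taylor's formula shows that two roots with the same reduction coincide. *)
Lemma monogenic_etale (R : comNzRingType) (S : comPzRingType) (u : {rmorphism R -> S})
    (phi : {rmorphism {poly R} -> S}) (p : {poly R}) y :
    (forall r, phi r%:P = u r) -> phi p = 0 -> phi p^`() * y = 1 ->
    (forall (T : comPzRingType) (f : {rmorphism {poly R} -> T}) y,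
       f p = 0 -> f p^`() * y = 1 -> exists c : {rmorphism S -> T}, c \o phi =1 f) ->
    (forall (T : comPzRingType) (c c' : {rmorphism S -> T}), c \o phi =1 c' \o phi -> c =1 c') ->
  formally_etale u.
Proof.
move=> phiC phip phip' univ epi T T0 pi a b pis pin pab.
have [x0 x0b] := pis (b (phi 'X)).
have [f0 [f0C f0X]] := pz_eval_exists a x0.
have pif0 : pi \o f0 =1 b \o phi.
  apply: (polyhom_ext (f := pi \o f0) (g := b \o phi)) => [r|] /=; last by rewrite f0X.
  by rewrite f0C phiC; exact: pab.
have k0 : pi (f0 p) = 0 by rewrite -[LHS]/((pi \o f0) p) pif0 /= phip rmorph0.
have [|z z1] := @lift_unit _ _ pi pin pis (f0 p^`()) (b y).
  by rewrite -[X in X * _]/((pi \o f0) _) pif0 /= -rmorphM phip' rmorph1.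
have [f1 [f1C f1X]] := pz_eval_exists a (x0 - f0 p * z).
have f1f0 r : f1 r%:P = f0 r%:P by rewrite f1C f0C.
have d0 : pi (f1 'X - f0 'X) = 0 by rewrite f1X f0X addrC addKr rmorphN rmorphM k0 mul0r oppr0.
have f1p : f1 p = 0.
  have [q ->] := eval_taylor1 p f1f0.
  rewrite (pin _ _ d0 d0) mul0r addr0 f1X f0X [x0 - _]addrC addrK.
  by rewrite mulrN mulrCA z1 mulr1 subrr.
have pif1 : pi \o f1 =1 b \o phi.
  apply: (polyhom_ext (f := pi \o f1) (g := b \o phi)) => [r|] /=.
    by rewrite f1C phiC; exact: pab.
  by rewrite f1X rmorphB rmorphM k0 mul0r subr0.
have [|z' z'1] := @lift_unit _ _ pi pin pis (f1 p^`()) (b y).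
  by rewrite -[X in X * _]/((pi \o f1) _) pif1 /= -rmorphM phip' rmorph1.
have [c cphi] := univ _ f1 z' f1p z'1.
exists c; split.
- by move=> r; rewrite /= -phiC -[LHS]/((c \o phi) _) cphi f1C.
- apply: (epi _ (pi \o c) b) => q; rewrite -[LHS]/(pi ((c \o phi) q)) cphi.
  exact: pif1.
- move=> c' c'a c'b; apply: epi => q; rewrite [RHS]cphi.
  have cC r : (c' \o phi) r%:P = f1 r%:P by rewrite /= phiC f1C -c'a.
  move: q; apply: (polyhom_ext (f := c' \o phi) (g := f1)) => //.
  have e0 : pi (c' (phi 'X) - f1 'X) = 0.
    by rewrite rmorphB -[X in X - _]/((pi \o c') _) c'b -[X in _ - X]/((pi \o f1) _) pif1 subrr.
  have [q e] := @eval_taylor1 _ _ (c' \o phi) f1 p cC.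
  move: e; rewrite /= phip rmorph0 f1p add0r (pin _ _ e0 e0) mul0r addr0 => e.
  apply/eqP; rewrite -subr_eq0; apply/eqP.
  by rewrite -[LHS]mul1r -z'1 mulrAC -e mul0r.
Qed.

Section DProdMaps.
Variables (I : Type) (i0 : I) (R : comPzRingType) (S : comNzRingType).

Definition dprod_lift (u : I -> {rmorphism R -> S}) (r : R) : dprod i0 (fun=> S) :=
  DProd (fun k => u k r).
Variable u : I -> {rmorphism R -> S}.
Fact dprod_lift_is_zmod_morphism : zmod_morphism (dprod_lift u).
Proof. by move=> x y; apply: dprodP => k /=; rewrite rmorphB. Qed.
Fact dprod_lift_is_monoid_morphism : monoid_morphism (dprod_lift u).
Proof. by split=> [|x y]; apply: dprodP => k /=; rewrite ?rmorph1 ?rmorphM. Qed.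
HB.instance Definition _ := GRing.isZmodMorphism.Build R (dprod i0 (fun=> S))
  (dprod_lift u) dprod_lift_is_zmod_morphism.
HB.instance Definition _ := GRing.isMonoidMorphism.Build R (dprod i0 (fun=> S))
  (dprod_lift u) dprod_lift_is_monoid_morphism.
End DProdMaps.

Definition dprod_delta (I : eqType) (i0 : I) (S : comNzRingType) (k : I) (s : S) :
  dprod i0 (fun=> S) := DProd (fun l => if l == k then s else 0).

Section EtaleProduct.
Variables (I : finType) (i0 : I) (R : comPzRingType) (S : comNzRingType).
Variable u : I -> {rmorphism R -> S}.
Local Notation P := (dprod i0 (fun=> S)).
Local Notation delta := (@dprod_delta I i0 S).

Lemma dprod_deltaM k s t : delta k (s * t) = delta k s * delta k t.
Proof. by apply: dprodP => l /=; case: eqP; rewrite ?mulr0. Qed.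
Lemma dprod_deltaB k s t : delta k (s - t) = delta k s - delta k t.
Proof. by apply: dprodP => l /=; case: eqP; rewrite ?subr0. Qed.
Lemma dprod_delta_ortho k l s t : k != l -> delta k s * delta l t = 0.
Proof.
move=> kl; apply: dprodP => m /=; case: eqP => [->|]; last by rewrite mul0r.
by rewrite (negPf kl) mulr0.
Qed.
Lemma dprod_delta_mul k (x : P) : delta k 1 * x = delta k (dcomp x k).
Proof. by apply: dprodP => l /=; case: eqP => [->|]; rewrite ?mul1r ?mul0r. Qed.
Lemma dprod_sum (J : Type) (r : seq J) (Q : pred J) (f : J -> P) l :
  dcomp (\sum_(k <- r | Q k) f k) l = \sum_(k <- r | Q k) dcomp (f k) l.
Proof. by elim/big_rec2: _ => // k x y _ <-. Qed.
Lemma dprod_delta_sum (x : P) : \sum_k delta k (dcomp x k) = x.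
Proof.
apply: dprodP => l; rewrite dprod_sum (bigD1 l) //= eqxx big1 ?addr0 // => k.
by rewrite eq_sym => /negPf ->.
Qed.

Hypothesis u_etale : forall k, formally_etale (u k).

(** The idempotents of the product lift uniquely along a square-zero ideal, to orthogonal
    idempotents [e k] of sum 1. They cut [T] into corners; each factor is lifted into its own
    corner, and the lifts are summed. *)
Lemma etale_product : formally_etale (dprod_lift i0 u : {rmorphism R -> P}).
Proof.
move=> T T0 pi a b pis pin pab.
have exE k : exists x, x * x = x /\ pi x = b (delta k 1).
  by apply: lift_idempotent => //; rewrite -rmorphM -dprod_deltaM mul1r.
pose e k := sval (cid (exE k)).
have ee k : e k * e k = e k by case: (svalP (cid (exE k))).
have pie k : pi (e k) = b (delta k 1) by case: (svalP (cid (exE k))).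
have eo k l : k != l -> e k * e l = 0.
  move=> kl; apply: (idempotent_eq0 pin); first by rewrite mulrACA !ee.
  by rewrite rmorphM !pie -rmorphM dprod_delta_ortho ?rmorph0.
have esum : \sum_k e k = 1.
  apply/eqP; rewrite eq_sym -subr_eq0; apply/eqP; apply: (idempotent_eq0 pin).
    have eS : (\sum_k e k) * (\sum_k e k) = \sum_k e k.
      rewrite mulr_suml; apply: eq_bigr => k _; rewrite mulr_sumr (bigD1 k) //= ee.
      by rewrite big1 ?addr0 // => l; rewrite eq_sym => /eo.
    by rewrite mulrBr mulr1 mulrBl mul1r eS subrr subr0.
  rewrite rmorphB rmorph1 rmorph_sum (eq_bigr (fun k => b (delta k 1))) // -rmorph_sum.
  have -> : \sum_k delta k 1 = 1 by rewrite -[RHS]dprod_delta_sum.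
  by rewrite rmorph1 subrr.
(* The corner e_k T is the quotient of T by the annihilator of e_k.           *)
have ann (X : comPzRingType) (x : X) : {J : ideal X | forall y, J y <-> x * y = 0}.
  have h0 : x * 0 = 0 by rewrite mulr0.
  have hB y z : x * y = 0 -> x * z = 0 -> x * (y - z) = 0 by move=> y0 z0; rewrite mulrBr y0 z0 subrr.
  have hM r y : x * y = 0 -> x * (r * y) = 0 by move=> y0; rewrite mulrCA y0 mulr0.
  by exists (Ideal (ideal_set := fun y => x * y = 0) h0 hB hM).
pose J k := sval (ann T (e k)).
pose J0 k := sval (ann T0 (b (delta k 1))).
have JP k y : J k y <-> e k * y = 0 by exact: svalP (ann T (e k)) y.
have J0P k y : J0 k y <-> b (delta k 1) * y = 0 by exact: svalP (ann T0 (b (delta k 1))) y.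
have piJ k : exists q : {rmorphism iquot (J k) -> iquot (J0 k)},
    forall x, q (iquot_pi (J k) x) = iquot_pi (J0 k) (pi x).
  pose q (z : iquot (J k)) := iquot_pi (J0 k) (pi (sval z)).
  have qE x : q (iquot_pi (J k) x) = iquot_pi (J0 k) (pi x).
    apply/iquot_piP/J0P; rewrite -pie -rmorphB -rmorphM.
    have /iquot_piP/JP -> := iquot_piK (iquot_pi (J k) x); exact: rmorph0.
  have [||q' q'E] := @rmorphism_exists _ _ q.
  - by move=> x y; rewrite -(iquot_piK x) -(iquot_piK y) -rmorphB !qE !rmorphB.
  - split=> [|x y]; first by rewrite -(rmorph1 (@iquot_pi _ (J k))) qE !rmorph1.
    by rewrite -(iquot_piK x) -(iquot_piK y) -rmorphM !qE !rmorphM.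
  by exists q' => x; rewrite q'E qE.
have corner (X : comPzRingType) k (K : ideal X) (g : {rmorphism P -> X}) :
    (forall y, K y <-> g (delta k 1) * y = 0) ->
    exists h : {rmorphism S -> iquot K}, forall s, h s = iquot_pi K (g (delta k s)).
  move=> KP; have [||h hE] := @rmorphism_exists S (iquot K) (fun s => iquot_pi K (g (delta k s))).
  - by move=> s t; rewrite dprod_deltaB !rmorphB.
  - split=> [|s t]; last by rewrite dprod_deltaM !rmorphM.
    rewrite -(rmorph1 (@iquot_pi _ K)); apply/iquot_piP/KP.
    by rewrite mulrBr mulr1 -rmorphM -dprod_deltaM mul1r subrr.
  by exists h.
have lifts k : exists c : {rmorphism S -> iquot (J k)},
    (forall r, c (u k r) = iquot_pi (J k) (a r)) /\
    (forall s x, c s = iquot_pi (J k) x -> b (delta k 1) * pi x = b (delta k s)) /\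
    (forall c' : {rmorphism P -> T}, c' \o dprod_lift i0 u =1 a -> pi \o c' =1 b ->
       forall s, c s = iquot_pi (J k) (c' (delta k s))).
  have [q qE] := piJ k; have [b' b'E] := corner _ k _ b (J0P k).
  have [|||c [cu cb cuniq]] := @u_etale k _ _ q (@iquot_pi _ (J k) \o a) b'.
  - by move=> y; have [x xy] := pis (sval y); exists (iquot_pi (J k) x); rewrite qE xy iquot_piK.
  - move=> x y; rewrite -(iquot_piK x) -(iquot_piK y) !qE => /iquot_pi_eq0/J0P x0 /iquot_pi_eq0/J0P y0.
    rewrite -rmorphM; apply/iquot_pi_eq0/JP.
    by rewrite -ee mulrACA; apply: pin; rewrite rmorphM pie.
  - move=> r; rewrite /= qE b'E; apply/iquot_piP/J0P.
    have -> : pi (a r) = b (dprod_lift i0 u r) by exact: pab.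
    by rewrite -rmorphB -rmorphM mulrBr !dprod_delta_mul /= eqxx subrr rmorph0.
  exists c; split; first exact: cu.
  split=> [s x cs|c' c'a c'b s].
    have := cb s; rewrite /= cs qE b'E => /iquot_piP/J0P/eqP.
    by rewrite mulrBr subr_eq0 -[in X in _ == X]rmorphM -dprod_deltaM mul1r => /eqP.
  have c'e : c' (delta k 1) = e k.
    apply: (idempotent_unique pin) => //; first by rewrite -rmorphM -dprod_deltaM mul1r.
    by rewrite pie -c'b.
  have [|d dE] := corner _ k (J k) c'; first by move=> y; rewrite c'e; exact: JP.
  rewrite -dE; apply: esym; apply: cuniq => [r|t] /=; rewrite dE.
    apply/iquot_piP/JP; rewrite -c'a -c'e /= -rmorphB -rmorphM mulrBr !dprod_delta_mul /= eqxx.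
    by rewrite subrr rmorph0.
  by rewrite qE b'E; congr iquot_pi; exact: c'b.
pose c k := sval (cid (lifts k)).
have cu k r : c k (u k r) = iquot_pi (J k) (a r) by case: (svalP (cid (lifts k))).
have cb k s x : c k s = iquot_pi (J k) x -> b (delta k 1) * pi x = b (delta k s).
  by case: (svalP (cid (lifts k))) => _ [H _]; exact: H.
have cuniq k (c' : {rmorphism P -> T}) : c' \o dprod_lift i0 u =1 a -> pi \o c' =1 b ->
    forall s, c k s = iquot_pi (J k) (c' (delta k s)).
  by case: (svalP (cid (lifts k))) => _ [_ H]; exact: H.
pose C (x : P) := \sum_k e k * sval (c k (dcomp x k)).
have eC k (z : iquot (J k)) x : z = iquot_pi (J k) x -> e k * sval z = e k * x.
  rewrite -{1}(iquot_piK z) => /iquot_piP/JP/eqP; by rewrite mulrBr subr_eq0 => /eqP.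
have eC' k x : e k * C x = e k * sval (c k (dcomp x k)).
  rewrite /C mulr_sumr (bigD1 k) //= mulrA ee big1 ?addr0 // => l.
  by rewrite mulrA eq_sym => /eo ->; rewrite mul0r.
have Cext x y : (forall k, e k * x = e k * y) -> x = y.
  move=> xy; rewrite -[x]mul1r -[y]mul1r -esum !mulr_suml; apply: eq_bigr => k _; exact: xy.
have [||C' C'E] := @rmorphism_exists _ _ C.
- move=> x y; apply: Cext => k; rewrite mulrBr !eC' -mulrBr; apply: eC.
  by rewrite [RHS]rmorphB /= !iquot_piK -rmorphB.
- split=> [|x y]; apply: Cext => k.
    by rewrite eC'; apply: eC; rewrite /= !rmorph1.
  transitivity (e k * (sval (c k (dcomp x k)) * sval (c k (dcomp y k)))).
    by rewrite eC'; apply: eC; rewrite [RHS]rmorphM /= !iquot_piK -rmorphM.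
  by rewrite mulrA -eC' [RHS]mulrA -!mulrA [RHS]mulrCA [in RHS]eC' mulrCA.
exists C'; split=> [r|x|c' c'a c'b x] /=.
- rewrite C'E; apply: Cext => k; rewrite eC'; apply: eC; exact: cu.
- rewrite C'E rmorph_sum -[in RHS](dprod_delta_sum x) rmorph_sum; apply: eq_bigr => k _.
  by rewrite rmorphM pie; apply: cb; rewrite iquot_piK.
- rewrite C'E; apply: Cext => k; rewrite eC'; apply: esym; rewrite (eC _ _ _ (cuniq k c' c'a c'b _)).
  have -> : e k = c' (delta k 1).
    apply: (idempotent_unique pin) => //; first by rewrite -rmorphM -dprod_deltaM mul1r.
    by rewrite pie -c'b.
  by rewrite -!rmorphM !dprod_delta_mul /= eqxx.
Qed.

End EtaleProduct.

(** * Ramified extensions of the field of Laurent series *)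

Section Ramification.
Variable L : fieldType.

Lemma coef_comp_scaleXn (p : {poly L}) k e n : (0 < e)%N ->
  (p \Po (k *: 'X^e))`_n = if (e %| n)%N then p`_(n %/ e) * k ^+ (n %/ e) else 0.
Proof.
move=> e0; rewrite comp_polyE coef_sum.
under eq_bigr do rewrite coefZ exprZn -exprM coefZ coefXn.
case: ifP => [/dvdnP[m ->]|ndv]; last first.
  apply: big1 => i _; case: eqP => [en|_]; last by rewrite !mulr0.
  by move: ndv; rewrite en dvdn_mulr.
rewrite mulnK //; have [lt|le] := ltnP m (size p).
  rewrite (bigD1 (Ordinal lt)) //= [(m * e)%N]mulnC eqxx mulr1 big1 ?addr0 // => j.
  by rewrite -val_eqE /= eqn_pmul2l // eq_sym => /negPf ->; rewrite !mulr0.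
rewrite nth_default // mul0r; apply: big1 => j _.
rewrite [(m * e)%N]mulnC eqn_pmul2l // eq_sym ltn_eqF ?mulr0 //.
exact: leq_trans (ltn_ord j) le.
Qed.

Definition ptrunc n (a : powser L) : {poly L} := \poly_(k < n.+1) scoef a k.

Lemma coef_ptruncM n m (a b : powser L) :
  (m <= n)%N -> (ptrunc n a * ptrunc n b)`_m = scoef (a * b) m.
Proof.
move=> lemn; rewrite coefM; apply: eq_bigr => k _ /=.
rewrite !coef_poly !ltnS (leq_trans _ lemn) ?(leq_trans (leq_subr _ _)) //.
by rewrite -ltnS.
Qed.

Section Substitution.
Variables (k : L) (e : nat).
Hypotheses (k0 : k != 0) (e0 : (0 < e)%N).

(** The substitution x |-> k x^e. The two proofs are arguments so that the morphism structure, which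
    relies on them, attaches to the term [psub k0 e0]. *)
Definition psub of k != 0 & (0 < e)%N := fun a : powser L =>
  Powser (fun n => if (e %| n)%N then scoef a (n %/ e) * k ^+ (n %/ e) else 0).

Let psub_trunc n m a : (m <= n)%N ->
  scoef (psub k0 e0 a) m = (ptrunc n a \Po (k *: 'X^e))`_m.
Proof.
move=> lemn; rewrite coef_comp_scaleXn //= coef_poly ltnS.
by rewrite (leq_trans (leq_div _ _) lemn).
Qed.

Fact psub_is_zmod_morphism : zmod_morphism (psub k0 e0).
Proof.
by move=> a b; apply: powserP => n /=; case: ifP; rewrite ?mulrBl ?subr0.
Qed.
Fact psub_is_monoid_morphism : monoid_morphism (psub k0 e0).
Proof.
split=> [|a b]; apply: powserP => n.
  rewrite /=; case: n => [|n]; first by rewrite dvdn0 div0n mul1r expr0.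
  case: ifP => // /dvdnP[m en]; have -> : (n.+1 %/ e)%N = m by rewrite en mulnK.
  by case: m en => //= m _; rewrite mul0r.
rewrite -[LHS]/(if (e %| n)%N then scoef (a * b) (n %/ e) * k ^+ (n %/ e) else 0).
rewrite -(coef_ptruncM a b (leq_div n e)) -(coef_comp_scaleXn _ _ _ e0) comp_polyM coefM.
by apply: eq_bigr => j _; rewrite -!psub_trunc ?leq_subr // -ltnS.
Qed.
HB.instance Definition _ := GRing.isZmodMorphism.Build (powser L) (powser L)
  (psub k0 e0) psub_is_zmod_morphism.
HB.instance Definition _ := GRing.isMonoidMorphism.Build (powser L) (powser L)
  (psub k0 e0) psub_is_monoid_morphism.

Lemma psub_inj : injective (psub k0 e0).
Proof.
move=> a b ab; apply: powserP => n.
have := congr1 (fun c => scoef c (n * e)) ab; rewrite /= dvdn_mull // mulnK //.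
by apply: mulIf; rewrite expf_neq0.
Qed.

Lemma psub_eq0 a : (psub k0 e0 a == 0) = (a == 0).
Proof.
have z0 : psub k0 e0 0 = 0 by exact: (rmorph0 (psub k0 e0)).
by rewrite -{1}z0 (inj_eq psub_inj).
Qed.

Lemma cterm_psub a : cterm (psub k0 e0 a) = cterm a.
Proof. by rewrite /cterm /= dvdn0 div0n expr0 mulr1. Qed.

Lemma psub_const x : psub k0 e0 (const_powser L x) = const_powser L x.
Proof.
apply: powserP => n /=; rewrite !coefC; case: n => [|n].
  by rewrite dvdn0 div0n expr0 mulr1.
case: ifP => // /dvdnP[m en]; have -> : (n.+1 %/ e)%N = m by rewrite en mulnK.
by case: m en => //= m _; rewrite mul0r.
Qed.

Lemma psub_pvar : psub k0 e0 pvar = const_powser L k * pvar ^+ e.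
Proof.
apply: powserP => n; rewrite mulrC scoef_pvarX /= coefX coefC.
case: ltnP => [lt|le].
  case: ifP => // /dvdnP[m en]; move: lt; rewrite en mulnK //.
  by case: m {en} => [|m]; [rewrite mul0r|rewrite mulSn ltnNge leq_addr].
case: ifP => [/dvdnP[m en]|ndv].
  have -> : (n %/ e)%N = m by rewrite en mulnK.
  have -> : (n - e == 0)%N = (m <= 1)%N.
    by rewrite en -{2}[e]mul1n -mulnBl muln_eq0 (gtn_eqF e0) orbF subn_eq0.
  case: m en => [|[|m]] en; last by rewrite mul0r.
    by move: le; rewrite en mul0n leqNgt e0.
  by rewrite mul1r expr1.
case: eqP => // en; move: ndv; have -> : n = e by apply/eqP; rewrite eqn_leq le -subn_eq0 en.
by rewrite dvdnn.
Qed.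

Lemma pdvd_psub a : pdvd e (psub k0 e0 a - const_powser L (cterm a)).
Proof.
have [b ab] : pdvd 1 (a - const_powser L (cterm a)).
  by apply/pdvd1P; rewrite ctermB cterm_const subrr.
rewrite -[const_powser _ _]psub_const -rmorphB ab rmorphM rmorphXn expr1 /= psub_pvar.
exists (const_powser L k * psub k0 e0 b); ring.
Qed.

Definition ksub : {rmorphism {laurent L} -> {laurent L}} := frac_map psub_inj.

Lemma ksubE a : ksub (FracField.tofrac a) = FracField.tofrac (psub k0 e0 a).
Proof. exact: frac_map_tofrac. Qed.

Lemma psub_spans b : exists a : 'I_e -> powser L, b = \sum_j psub k0 e0 (a j) * pvar ^+ j.
Proof.
exists (fun j => Powser (fun m => scoef b (m * e + j) / k ^+ m)).
apply: powserP => n.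
have -> (F : 'I_e -> powser L) : scoef (\sum_j F j) n = \sum_j scoef (F j) n.
  by elim/big_rec2: _ => // j x y _ <-.
rewrite (bigD1 (Ordinal (ltn_pmod n e0))) // big1 => [|j jn].
  rewrite [RHS]addr0 mulrC scoef_pvarX /=.
  have le : (n %% e <= n)%N by exact: leq_mod.
  rewrite ltnNge le /=.
  have en : (n - n %% e)%N = (n %/ e * e)%N by rewrite {1}(divn_eq n e) addnK.
  by rewrite en dvdn_mull // mulnK // -divn_eq divfK ?expf_neq0.
rewrite mulrC scoef_pvarX; case: ltnP => //= lej; case: ifP => // dv.
case/eqP: jn; apply: val_inj => /=.
have := subnK lej; case/dvdnP: dv => m -> <-.
by rewrite modnMDl modn_small.
Qed.

End Substitution.

Lemma powser_factor (a : powser L) : a != 0 -> exists n b, a = pvar ^+ n * b /\ cterm b != 0.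
Proof.
move=> a0; have ex : exists n, scoef a n != 0.
  apply: contrapT => H; case/eqP: a0; apply: powserP => n.
  by apply/eqP/negPn/negP => an; apply: H; exists n.
case: (ex_minnP ex) => n an minn; have [|b ab] := iffRL (@pdvdP L n a).
  by move=> m lt; apply/eqP; rewrite -[_ == _]negbK; apply/negP => /minn; rewrite leqNgt lt.
by exists n, b; split=> //; move: an; rewrite ab scoef_pvarX ltnn subnn.
Qed.

Lemma ksub_spans k e (k0 : k != 0) (e0 : (0 < e)%N) :
  spans (ksub k0 e0) (fun j : 'I_e => FracField.tofrac (pvar ^+ j)).
Proof.
move=> z; case: (fracE z) => -[a b] /= b0 ->.
have [n [v [bv v0]]] := powser_factor b0; have [v' vv'] := powser_inv v0.
(* The denominator x^n v is replaced by k^n x^(e n), which is the image of x^n under the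
   substitution and so belongs to the base field. The numerator is multiplied accordingly by v^-1,
   x^((e - 1) n) and k^n. *)
have [c cE] := psub_spans k0 e0 (a * v' * pvar ^+ ((e - 1) * n) * const_powser L (k ^+ n)).
pose d := FracField.tofrac (pvar ^+ n : powser L).
have d0 : d != 0 by rewrite tofrac_eq0 expf_neq0 // pvar_neq0.
exists (fun j => FracField.tofrac (c j) / d).
under eq_bigr do rewrite fmorph_div /= ksubE mulrAC -tofracM.
rewrite -mulr_suml -(rmorph_sum (@FracField.tofrac (powser L))) /= -cE.
rewrite /d ksubE; apply/eqP; rewrite eqr_div ?tofrac_eq0 //; last first.
  by rewrite psub_eq0 expf_neq0 ?pvar_neq0.
rewrite -!tofracM; apply/eqP; congr FracField.tofrac.
have -> : psub k0 e0 (pvar ^+ n) = (const_powser L k * pvar ^+ e) ^+ n.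
  rewrite -(psub_pvar k0 e0); exact: (rmorphXn (psub k0 e0)).
rewrite exprMn -rmorphXn -exprM bv.
have -> : pvar ^+ (e * n) = pvar ^+ ((e - 1) * n) * pvar ^+ n :> powser L.
  by rewrite -exprD mulnBl mul1n subnK // leq_pmull.
transitivity (a * pvar ^+ ((e - 1) * n) * pvar ^+ n * const_powser L (k ^+ n) * (v * v')).
  by rewrite vv'; ring.
ring.
Qed.

Lemma common_denominator n (r : 'I_n -> {laurent L}) :
  exists2 d, d != 0 & exists a : 'I_n -> powser L,
    forall j, r j = FracField.tofrac (a j) / FracField.tofrac d.
Proof.
pose p := \poly_(j < n) (if insub j is Some l then r l else 0).
have [d d0 [q qE]] := clear_denominators p.
exists d => //; exists (fun j => q`_j) => j.
have qj : FracField.tofrac q`_j = FracField.tofrac d * r j.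
  rewrite -[LHS](coef_map (@FracField.tofrac (powser L))) qE coefZ coef_poly ltn_ord insubT //.
  by move=> lt; congr (_ * r _); apply: val_inj.
by rewrite qj mulrC mulKf ?tofrac_eq0.
Qed.

(** For a unit [v], x |-> a + x v is a local coordinate at [a], so the order of p along it is the
    multiplicity of the root [a]. *)
Lemma dvdp_of_pdvd (p : {poly L}) a (v : powser L) e : cterm v != 0 ->
  pdvd e (map_poly (const_powser L) p).[const_powser L a + pvar * v] -> ('X - a%:P) ^+ e %| p.
Proof.
move=> v0; have [p0|p0] := eqVneq p 0; first by rewrite p0 dvdp0.
have [m [q]] := multiplicity_XsubC p a; rewrite p0 /= => qa ->.
rewrite rmorphM rmorphXn rmorphB /= map_polyX map_polyC hornerM horner_exp hornerXsubC.
rewrite [_ + pvar * v - _]addrC addKr exprMn; set w := horner _ _ => /pdvdP pd.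
apply: dvdp_mull; apply: dvdp_exp2l; rewrite leqNgt; apply/negP => lt.
have := pd m lt; rewrite mulrCA scoef_pvarX ltnn subnn -[LHS]/(cterm _) ctermM ctermXn.
move/eqP; rewrite mulf_eq0 expf_eq0 (negPf v0) andbF orbF.
rewrite /w cterm_horner -map_poly_comp ctermD ctermM cterm_pvar mul0r addr0 cterm_const.
by rewrite map_poly_id => [q0|x _]; [case/negP: qa|exact: cterm_const].
Qed.

(** After clearing denominators and dividing by the largest common power of x, some coefficient has
    a nonzero constant term. The substitution x |-> k x^e makes every coefficient constant modulo
    x^e, so the polynomial p of constant terms vanishes to order e i along the i-th branch. It is
    then divisible by each (X - a i)^(e i), and [small] forces p = 0, a contradiction. *)
Lemma ksub_independent (I : Type) (k : I -> L) (e : I -> nat) (k0 : forall i, k i != 0)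
    (e0 : forall i, (0 < e i)%N) (a : I -> L) (v : I -> powser L) n (r : 'I_n -> {laurent L}) :
    (forall i, cterm (v i) != 0) ->
    (forall p : {poly L}, (size p <= n)%N -> (forall i, ('X - (a i)%:P) ^+ e i %| p) -> p = 0) ->
    (forall i, \sum_j ksub (k0 i) (e0 i) (r j) *
      FracField.tofrac (const_powser L (a i) + pvar * v i) ^+ j = 0) ->
  forall j, r j = 0.
Proof.
move=> v0 small; have [d d0 [b rb]] := common_denominator r => rel.
suff b0 j : b j = 0 by move=> j; rewrite rb b0 tofrac0 mul0r.
move: j; apply: contrapT => nb.
have ex : exists m, [exists j, scoef (b j) m != 0].
  apply: contrapT => H; apply: nb => j; apply: powserP => m.
  by apply/eqP/negPn/negP => bm; apply: H; exists m; apply/existsP; exists j.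
case: (ex_minnP ex) => m /existsP[j0 bm] minm.
have dv j : pdvd m (b j).
  apply/pdvdP => l lt; apply/eqP; rewrite -[_ == _]negbK; apply/negP => bl.
  have /minm : [exists j, scoef (b j) l != 0] by apply/existsP; exists j.
  by rewrite leqNgt lt.
pose c j := sval (cid (dv j)).
have bc j : b j = pvar ^+ m * c j by exact: svalP (cid (dv j)).
pose p := \poly_(j < n) (if insub j is Some l then cterm (c l) else 0).
have pE (j : 'I_n) : p`_j = cterm (c j).
  by rewrite coef_poly ltn_ord insubT // => lt; congr (cterm (c _)); apply: val_inj.
suff p0 : p = 0.
  by move: bm; rewrite bc scoef_pvarX ltnn subnn -[scoef _ _]/(cterm _) -pE p0 coef0 eqxx.
apply: small => [|i]; first exact: size_poly.
apply: dvdp_of_pdvd (v0 i) _; set z := const_powser L (a i) + pvar * v i.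
have rel' : \sum_j psub (k0 i) (e0 i) (c j) * z ^+ j = 0.
  have := rel i; under eq_bigr do rewrite rb fmorph_div /= !ksubE mulrAC -tofracXn -tofracM.
  rewrite -mulr_suml -(rmorph_sum (@FracField.tofrac (powser L))) /= => /eqP.
  rewrite mulf_eq0 invr_eq0 !tofrac_eq0.
  rewrite psub_eq0 (negPf d0) orbF => /eqP.
  under eq_bigr do rewrite bc rmorphM -mulrA.
  rewrite -mulr_sumr => /eqP; rewrite mulf_eq0 => /orP[|/eqP //].
  by rewrite psub_eq0 expf_eq0 (negPf (pvar_neq0 L)) andbF.
have -> : (map_poly (const_powser L) p).[z] = \sum_j const_powser L (cterm (c j)) * z ^+ j.
  rewrite (@horner_coef_wide _ n); last by rewrite size_map_poly size_poly.
  by apply: eq_bigr => j _; rewrite coef_map pE.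
rewrite -[X in pdvd _ X]subr0 -[X in pdvd _ (_ - X)]rel' -sumrB.
elim/big_rec: _ => [|j y _ yd]; first by exists 0; rewrite mulr0.
apply: pdvdD yd; rewrite -mulrBl; apply: pdvdMr; rewrite -opprB -[X in pdvd _ X]sub0r.
by apply: pdvdB; [exists 0; rewrite mulr0|exact: pdvd_psub].
Qed.

End Ramification.

Section PowerSpan.
Variables (A S : comPzRingType) (u : {rmorphism A -> S}) (z : S) (N : nat).

Definition pspan (y : S) := exists r : 'I_N -> A, y = \sum_(k < N) u (r k) * z ^+ k.

Lemma pspanD x y : pspan x -> pspan y -> pspan (x + y).
Proof.
move=> [r ->] [r' ->]; exists (fun k => r k + r' k); rewrite -big_split.
by apply: eq_bigr => k _; rewrite rmorphD mulrDl.
Qed.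
Lemma pspanZ a y : pspan y -> pspan (u a * y).
Proof.
move=> [r ->]; exists (fun k => a * r k); rewrite mulr_sumr.
by apply: eq_bigr => k _; rewrite rmorphM mulrA.
Qed.
Lemma pspan0 : pspan 0.
Proof. by exists (fun=> 0); rewrite big1 // => k _; rewrite rmorph0 mul0r. Qed.
Lemma pspan_pow k : (k < N)%N -> pspan (z ^+ k).
Proof.
move=> lt; exists (fun l => if l == k :> nat then 1 else 0).
rewrite (bigD1 (Ordinal lt)) //= eqxx rmorph1 mul1r big1 ?addr0 // => l.
by rewrite -val_eqE /= => /negPf ->; rewrite rmorph0 mul0r.
Qed.
Lemma pspan_sum (J : finType) (f : J -> S) : (forall k, pspan (f k)) -> pspan (\sum_k f k).
Proof. by move=> H; elim/big_rec: _ => [|k y _]; [exact: pspan0|exact: pspanD]. Qed.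

Hypothesis zN : pspan (z ^+ N).

Lemma pspanM y : pspan y -> pspan (z * y).
Proof.
move=> [r ->]; rewrite mulr_sumr; apply: pspan_sum => k.
rewrite mulrCA -exprS; apply: pspanZ.
by have := ltn_ord k; rewrite leq_eqVlt => /predU1P[->|/pspan_pow].
Qed.
Lemma pspanMX k y : pspan y -> pspan (z ^+ k * y).
Proof. by move=> yP; elim: k => [|k]; rewrite ?mul1r // exprS -mulrA; exact: pspanM. Qed.

End PowerSpan.

Lemma deriv_subCM (R : comNzRingType) (p q : {poly R}) c :
  (p - c%:P * q)^`() = p^`() - c%:P * q^`().
Proof. by rewrite derivB derivM derivC mul0r add0r. Qed.

(** With P = x Q, the product P Q (P - Q) equals - x (1 - x) Q^3, which dictates the inverse. *)
Lemma crit_inv (T : comPzRingType) (x q y xi yi : T) :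
  x * xi = 1 -> (1 - x) * yi = 1 -> q * y = 1 ->
  x * q * q * (x * q - q) * (y ^+ 3 * xi * - yi) = 1.
Proof.
move=> xK yK qK; transitivity ((x * xi) * ((1 - x) * yi) * (q * y) ^+ 3); first by ring.
by rewrite xK yK qK expr1n !mulr1.
Qed.

Section Units.
Variables (L : fieldType).

Definition P1_x : P1_minus3 L := loc_of _ 'X.
Definition P1_xinv : P1_minus3 L := loc_of _ (1 - 'X) * loc_inv _.
Definition P1_yinv : P1_minus3 L := loc_of _ 'X * loc_inv _.

Lemma P1_xinvK : P1_x * P1_xinv = 1.
Proof. by rewrite /P1_x /P1_xinv mulrA -rmorphM loc_invK ?X1X_neq0. Qed.
Lemma P1_yinvK : (1 - P1_x) * P1_yinv = 1.
Proof.
have -> : 1 - P1_x = loc_of _ (1 - 'X) by rewrite rmorphB rmorph1.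
by rewrite mulrA -rmorphM [(1 - 'X) * _]mulrC loc_invK ?X1X_neq0.
Qed.

Definition P1_const : {rmorphism L -> P1_minus3 L} := @loc_of _ ('X * (1 - 'X)) \o polyC.

Lemma P1_ext (T : comPzRingType) (f g : {rmorphism P1_minus3 L -> T}) :
  (forall a, f (P1_const a) = g (P1_const a)) -> f P1_x = g P1_x -> f =1 g.
Proof.
move=> fg fgX; apply: loc_ext => [|p]; first exact: X1X_neq0.
exact: (polyhom_ext (f := f \o loc_of _) (g := g \o loc_of _)).
Qed.

Definition Gm_const : {rmorphism L -> Gm L} := @loc_of _ 'X \o polyC.
Definition Gm_t : Gm L := loc_of _ 'X.
Definition Gm_tinv : Gm L := loc_inv _.
Lemma Gm_tinvK : Gm_t * Gm_tinv = 1.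
Proof. by rewrite loc_invK ?polyX_neq0. Qed.
Lemma Gm_ext (T : comPzRingType) (f g : {rmorphism Gm L -> T}) :
  (forall a, f (Gm_const a) = g (Gm_const a)) -> f Gm_t = g Gm_t -> f =1 g.
Proof.
move=> fg fgX; apply: loc_ext => [|p]; first exact: polyX_neq0.
exact: (polyhom_ext (f := f \o loc_of _) (g := g \o loc_of _)).
Qed.

End Units.

(** * The cover given by a rational function *)

Section RationalFunction.
Variables (L : fieldType) (P Q : {poly L}).
Hypothesis Pm : P \is monic.
Hypothesis Qm : Q \is monic.
Hypothesis PQsize : size Q = size P.
Hypothesis PQ1 : (1 < size P)%N.
Hypothesis PQcop : coprimep P Q.
Hypothesis wronskian : exists R m, (P^`() * Q - P * Q^`()) * R = (P * Q) ^+ m.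

(** Its roots are the points of the affine line where P / Q is 0, infinity or 1. Since [P] and [Q]
    are monic of the same degree, the point at infinity lies above 1; inverting [crit_poly] thus
    gives the whole preimage of P^1 - {0,1,oo}. *)
Definition crit_poly := P * Q * (P - Q).

Lemma PQ_neq : P != Q.
Proof.
apply/eqP => e; move: PQcop; rewrite e coprimepp => /eqP sQ.
by move: PQ1; rewrite e sQ.
Qed.

Lemma crit_poly_neq0 : crit_poly != 0.
Proof.
by rewrite mulf_neq0 ?subr_eq0 ?PQ_neq // (mulf_neq0 (monic_neq0 Pm) (monic_neq0 Qm)).
Qed.

Local Notation cover_X := (loc crit_poly).
Definition cX (p : {poly L}) : cover_X := loc_of crit_poly p.
Fact cX_is_zmod_morphism : zmod_morphism cX.
Proof. exact: loc_of_is_zmod_morphism. Qed.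
Fact cX_is_monoid_morphism : monoid_morphism cX.
Proof. exact: loc_of_is_monoid_morphism. Qed.
HB.instance Definition _ := GRing.isZmodMorphism.Build {poly L} cover_X cX cX_is_zmod_morphism.
HB.instance Definition _ := GRing.isMonoidMorphism.Build {poly L} cover_X cX cX_is_monoid_morphism.
Definition cXv : cover_X := loc_inv crit_poly.
Definition cXqi : cover_X := cX (P * (P - Q)) * cXv.

Lemma cXvK : cX P * cX Q * (cX P - cX Q) * cXv = 1.
Proof. by rewrite -rmorphB -!rmorphM loc_invK // crit_poly_neq0. Qed.

Lemma cXqiK : cX Q * cXqi = 1.
Proof. by rewrite -[RHS]cXvK /cXqi rmorphM rmorphB; ring. Qed.

Fact str_cover_X_subproof :
  (horner_eval (cX P * cXqi) \o map_poly (cX \o polyC)) ('X * (1 - 'X)) * (- cX Q ^+ 3 * cXv) = 1.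
Proof.
rewrite /= rmorphM rmorphB rmorph1 /= map_polyX /horner_eval hornerM hornerD hornerN hornerX hornerC.
have q := cXqiK; have v := cXvK; move: (cX P) (cX Q) cXqi cXv q v => a b c d q v.
transitivity ((a * b * (a - b) * d) * (b * c) * (b * c) + a * c * (- b ^+ 3 * d) * (1 - b * c)); first by ring.
by rewrite v q subrr; ring.
Qed.

Definition str_cover_X : {rmorphism P1_minus3 L -> cover_X} := loc_lift str_cover_X_subproof.

Lemma str_cover_XC a : str_cover_X (P1_const L a) = cX a%:P.
Proof. by rewrite /= loc_lift_of /= map_polyC /horner_eval hornerC. Qed.
Lemma str_cover_Xx : str_cover_X (P1_x L) = cX P * cXqi.
Proof. by rewrite /= loc_lift_of /= map_polyX /horner_eval hornerX. Qed.
Lemma str_cover_XxQ : str_cover_X (P1_x L) * cX Q = cX P.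
Proof. by rewrite str_cover_Xx mulrAC -mulrA cXqiK mulr1. Qed.

Definition cover_eqn : {poly P1_minus3 L} :=
  map_poly (P1_const L) P - (P1_x L)%:P * map_poly (P1_const L) Q.

Lemma cover_X_ext (T : comPzRingType) (f g : {rmorphism cover_X -> T}) :
  (forall a, f (cX a%:P) = g (cX a%:P)) -> f (cX 'X) = g (cX 'X) -> f =1 g.
Proof.
move=> fg fgX; apply: loc_ext => [|p]; first exact: crit_poly_neq0.
exact: (polyhom_ext (f := f \o cX) (g := g \o cX)).
Qed.

Lemma polyhom_map (R S : nzRingType) (T : pzRingType) (h : {rmorphism R -> S})
    (f : {rmorphism {poly S} -> T}) (g : {rmorphism {poly R} -> T}) p :
  (forall a, f (h a)%:P = g a%:P) -> f 'X = g 'X -> f (map_poly h p) = g p.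
Proof.
move=> fg fgX; apply: (polyhom_ext (f := f \o map_poly h) (g := g)) => [a|] /=.
  by rewrite map_polyC /= fg.
by rewrite map_polyX.
Qed.

Let bezout : exists a b : {poly L}, a * P + b * Q = 1.
Proof.
have /Bezout_eq1_coprimepP[[a b] /= e] := PQcop; by exists a, b.
Qed.

(** The coordinate z is a root of P - x Q, where the derivative P' - (P / Q) Q' is the Wronskian
    over Q, a unit by hypothesis. Conversely, at any root of P - x Q Bezout's identity makes Q
    invertible, hence [crit_poly] too, because x and 1 - x are units. *)
Lemma cover_X_etale : formally_etale str_cover_X.
Proof.
have [phi [phiC phiX]] := pz_eval_exists str_cover_X (cX 'X).
have phim p : phi (map_poly (P1_const L) p) = cX p.
  by apply: polyhom_map => // a; rewrite phiC str_cover_XC.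
have [a [b ab]] := bezout.
have [R [m WR]] := wronskian.
pose u := cX R * (cX (P - Q) * cXv) ^+ m.
have deg : cX P^`() - cX P * cXqi * cX Q^`() = (cX P^`() * cX Q - cX P * cX Q^`()) * cXqi.
  transitivity (cX P^`() * (cX Q * cXqi) - cX P * cX Q^`() * cXqi); last by ring.
  by rewrite cXqiK; ring.
have WR' : (cX P^`() * cX Q - cX P * cX Q^`()) * cX R = (cX P * cX Q) ^+ m.
  by rewrite -!rmorphM -rmorphB -rmorphM WR rmorphXn.
have vm : (cX P * cX Q) ^+ m * (cX (P - Q) * cXv) ^+ m = 1.
  by rewrite -exprMn rmorphB mulrA cXvK expr1n.
apply: (@monogenic_etale _ _ str_cover_X phi cover_eqn (cX Q * u)) => [x|||T f y|T c c' cc'].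
- exact: phiC.
- by rewrite /cover_eqn rmorphB rmorphM phiC !phim str_cover_XxQ subrr.
- have -> : cover_eqn^`() = map_poly (P1_const L) P^`() - (P1_x L)%:P * map_poly (P1_const L) Q^`().
    by rewrite /cover_eqn deriv_subCM (deriv_map (P1_const L) P) (deriv_map (P1_const L) Q).
  rewrite rmorphB rmorphM phiC !phim str_cover_Xx deg /u.
  set W := cX P^`() * cX Q - cX P * cX Q^`() in WR' *.
  transitivity ((W * cX R) * (cX Q * cXqi) * (cX (P - Q) * cXv) ^+ m); first by ring.
  by rewrite WR' cXqiK mulr1.
- move=> fp fp'.
  pose xi := f (P1_x L)%:P.
  have [h hE] : exists h : {rmorphism {poly L} -> T}, forall p, h p = f (map_poly (P1_const L) p).
    by exists (f \o map_poly (P1_const L)).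
  have hP : h P = xi * h Q.
    by apply/eqP; rewrite -subr_eq0 !hE -rmorphM -rmorphB; apply/eqP.
  pose y1 := h a * xi + h b.
  have hQ : h Q * y1 = 1.
    transitivity (h a * (xi * h Q) + h b * h Q); first by rewrite /y1; ring.
    by rewrite -hP -!rmorphM -rmorphD ab rmorph1.
  have xiK : xi * f (P1_xinv L)%:P = 1 by rewrite -rmorphM -polyCM P1_xinvK !rmorph1.
  have yiK : (1 - xi) * f (P1_yinv L)%:P = 1.
    by rewrite -[1](rmorph1 f) -[1](rmorph1 polyC) -!rmorphB -rmorphM -polyCM P1_yinvK.
  have hcrit : h crit_poly * (y1 ^+ 3 * f (P1_xinv L)%:P * - f (P1_yinv L)%:P) = 1.
    by rewrite -(crit_inv xiK yiK hQ) -hP -rmorphB -!rmorphM.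
  pose c : {rmorphism cover_X -> T} := loc_lift hcrit.
  have cE p : c (cX p) = h p by exact: loc_lift_of.
  exists c; apply: (polyhom_ext (f := c \o phi)) => [x|].
    rewrite -[LHS]/(c (phi x%:P)) phiC.
    apply: (P1_ext (f := c \o str_cover_X) (g := f \o polyC)) => [{}x|].
      rewrite -[LHS]/(c (str_cover_X _)) str_cover_XC cE hE.
      by rewrite map_polyC.
    rewrite -[LHS]/(c (str_cover_X _)) -[RHS]/xi.
    rewrite -[LHS]mulr1 -hQ mulrA -cE -rmorphM str_cover_XxQ cE hP -mulrA hQ mulr1 //.
  by rewrite -[LHS]/(c (phi 'X)) phiX cE hE map_polyX.
- apply: cover_X_ext => [x|].
    by rewrite -str_cover_XC -phiC; exact: cc'.
  by rewrite -phiX; exact: cc'.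
Qed.

(* The relation P - x Q = 0 has leading coefficient 1 - x, which is a unit.    *)
Lemma cover_X_spans : spans str_cover_X (fun k : 'I_(size P).-1 => cX 'X ^+ k).
Proof.
pose N := (size P).-1; pose ps := @pspan _ _ str_cover_X (cX 'X) N.
have PN : size P = N.+1 by rewrite /N prednK // (ltn_trans _ PQ1).
have QN : size Q = N.+1 by rewrite PQsize.
have cXE (p : {poly L}) n : (size p <= n)%N -> cX p = \sum_(k < n) str_cover_X (P1_const L p`_k) * cX 'X ^+ k.
  move=> pn; transitivity (cX (\poly_(k < n) p`_k)).
    congr cX; apply/polyP => k; rewrite coef_poly; case: ltnP => // nk.
    by rewrite nth_default // (leq_trans pn).
  rewrite poly_def rmorph_sum; apply: eq_bigr => k _.
  by rewrite str_cover_XC -rmorphXn -rmorphM mul_polyC.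
have zN : ps (cX 'X ^+ N).
  have e : (1 - str_cover_X (P1_x L)) * cX 'X ^+ N =
      - \sum_(k < N) str_cover_X (P1_const L P`_k - P1_x L * P1_const L Q`_k) * cX 'X ^+ k.
    have := str_cover_XxQ; rewrite (cXE Q N.+1) ?QN // (cXE P N.+1) ?PN // !big_ord_recr /=.
    have -> : P`_N = 1 by move: (monicP Pm); rewrite lead_coefE PN.
    have -> : Q`_N = 1 by move: (monicP Qm); rewrite lead_coefE QN.
    rewrite !rmorph1 !mul1r => e.
    under eq_bigr do rewrite rmorphB rmorphM mulrBl -mulrA.
    rewrite sumrB -mulr_sumr opprB; set A := \sum_(k < N) _ in e *; set B := \sum_(k < N) _ in e *.
    change ((1 - str_cover_X (P1_x L)) * cX 'X ^+ N = str_cover_X (P1_x L) * A - B).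
    have {}e : str_cover_X (P1_x L) * (A + cX 'X ^+ N) = B + cX 'X ^+ N by exact: e.
    move: e.
    move: (str_cover_X (P1_x L)) (cX 'X ^+ N) => x z e.
    transitivity (z - (x * (A + z)) + x * A); first by ring.
    by rewrite e; ring.
  have -> : cX 'X ^+ N = str_cover_X (P1_yinv L) * ((1 - str_cover_X (P1_x L)) * cX 'X ^+ N).
    rewrite mulrA [str_cover_X (P1_yinv L) * _]mulrC -[1](rmorph1 str_cover_X).
    by rewrite -rmorphB -rmorphM P1_yinvK rmorph1 mul1r.
  apply: pspanZ; rewrite e -[- _]mul1r mulrN -mulNr -[- 1](rmorphN1 str_cover_X).
  apply: pspanZ; apply: pspan_sum => k; apply: pspanZ; exact: pspan_pow.
have psX y p : ps y -> ps (cX p * y).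
  move=> py; rewrite (cXE p (size p)) // mulr_suml; apply: pspan_sum => k.
  by rewrite -mulrA; apply: pspanZ; apply: pspanMX.
have ps1 : ps 1 by rewrite -[1](expr0 (cX 'X)); apply: pspan_pow; rewrite -ltnS -PN.
have [a [b ab]] := bezout.
(* Bezout's identity divided by Q writes 1 / Q as a x + b, so that no denominator survives in the
   span. *)
have qiE : cXqi = cX a * str_cover_X (P1_x L) + cX b.
  rewrite -[RHS]mulr1 -cXqiK mulrA mulrDl -mulrA str_cover_XxQ -!rmorphM -rmorphD ab.
  by rewrite rmorph1 mul1r.
have psqi y : ps y -> ps (cXqi * y).
  move=> py; rewrite qiE mulrDl; apply: pspanD; last exact: psX.
  by rewrite -mulrA; apply: psX; apply: pspanZ.
have vE : cXv = - str_cover_X (P1_xinv L * P1_yinv L) * cXqi ^+ 3.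
  have xK : str_cover_X (P1_x L) * str_cover_X (P1_xinv L) = 1 by rewrite -rmorphM P1_xinvK rmorph1.
  have yK : (1 - str_cover_X (P1_x L)) * str_cover_X (P1_yinv L) = 1.
    by rewrite -[1](rmorph1 str_cover_X) -rmorphB -rmorphM P1_yinvK.
  have := cXqiK; have := cXvK; rewrite -str_cover_XxQ rmorphM; move: xK yK.
  move: (str_cover_X (P1_x L)) (str_cover_X (P1_xinv L)) (str_cover_X (P1_yinv L)).
  move: (cX Q) cXqi cXv => q c v x xi yi xK yK vK qK.
  transitivity ((x * xi) * ((1 - x) * yi) * (q * c) ^+ 3 * v).
    by rewrite xK yK qK expr1n !mul1r.
  transitivity (- (xi * yi) * c ^+ 3 * (x * q * q * (x * q - q) * v)); first by ring.
  by rewrite vK mulr1.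
have psqn n y : ps y -> ps (cXqi ^+ n * y).
  move: cXqi psqi {qiE vE} => q psq py.
  by elim: n => [|n IHn]; [rewrite mul1r|rewrite exprS -mulrA; exact: psq].
have psv y : ps y -> ps (cXv * y).
  move=> py; rewrite vE -[- _](rmorphN str_cover_X) -mulrA; apply: pspanZ.
  exact: psqn.
move=> z.
have [p [n zE]] := loc_image (idfun : {rmorphism cover_X -> cover_X}) z crit_poly_neq0.
have -> : z = cXv ^+ n * (cX p * 1).
  have critK : cX crit_poly * cXv = 1 by exact: loc_invK crit_poly_neq0.
  have <- : z * cX crit_poly ^+ n = cX p by exact: zE.
  by rewrite mulr1 mulrCA -exprMn [cXv * _]mulrC critK expr1n mulr1.
by elim: n {zE} => [|n IHn]; [rewrite mul1r; exact: psX|rewrite exprS -mulrA; exact: psv].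
Qed.

End RationalFunction.

Section DProdMap.
Variables (I : Type) (i0 : I) (R S : comNzRingType) (h : I -> I).
Variable f : I -> {rmorphism R -> S}.

Definition dprod_map (x : dprod i0 (fun=> R)) : dprod i0 (fun=> S) :=
  DProd (fun k => f k (dcomp x (h k))).
Fact dprod_map_is_zmod_morphism : zmod_morphism dprod_map.
Proof. by move=> x y; apply: dprodP => k /=; rewrite rmorphB. Qed.
Fact dprod_map_is_monoid_morphism : monoid_morphism dprod_map.
Proof. by split=> [|x y]; apply: dprodP => k /=; rewrite ?rmorph1 ?rmorphM. Qed.
HB.instance Definition _ := GRing.isZmodMorphism.Build
  (dprod i0 (fun=> R)) (dprod i0 (fun=> S)) dprod_map dprod_map_is_zmod_morphism.
HB.instance Definition _ := GRing.isMonoidMorphism.Build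
  (dprod i0 (fun=> R)) (dprod i0 (fun=> S)) dprod_map dprod_map_is_monoid_morphism.
End DProdMap.

Section DProdBasis.
Variables (I : finType) (i0 : I) (R : comPzRingType) (S : comNzRingType).
Variables (u : I -> {rmorphism R -> S}) (e : I -> nat).
Variable g : forall k, 'I_(e k) -> S.

Definition dprod_basis (x : {k & 'I_(e k)}) : dprod i0 (fun=> S) :=
  dprod_delta i0 (tag x) (g (tagged x)).

Lemma dprod_basis_sum (r : {k & 'I_(e k)} -> R) l :
  dcomp (\sum_x dprod_lift i0 u (r x) * dprod_basis x) l =
  \sum_(j < e l) u l (r (Tagged (fun k => 'I_(e k)) j)) * g j.
Proof.
pose F k (j : 'I_(e k)) := dcomp (dprod_lift i0 u (r (Tagged (fun k => 'I_(e k)) j)) *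
  dprod_basis (Tagged (fun k => 'I_(e k)) j)) l.
rewrite dprod_sum; transitivity (\sum_k \sum_(j < e k) F k j).
  by rewrite (sig_big_dep xpredT (fun _ => xpredT) F); apply: eq_bigr => -[].
rewrite (bigD1 l) //= [X in _ + X]big1 ?addr0 => [|k kl].
  by apply: eq_bigr => j _; rewrite /F /= eqxx.
by apply: big1 => j _; rewrite /F /= eq_sym (negPf kl) mulr0.
Qed.

Lemma dprod_spans : (forall k, spans (u k) (@g k)) -> spans (dprod_lift i0 u) dprod_basis.
Proof.
move=> sg z; exists (fun x => sval (cid (sg (tag x) (dcomp z (tag x)))) (tagged x)).
apply: dprodP => l; rewrite dprod_basis_sum /=.
by case: (cid (sg l (dcomp z l))).
Qed.

Lemma dprod_independent : (forall k, independent (u k) (@g k)) ->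
  independent (dprod_lift i0 u) dprod_basis.
Proof.
move=> ig r r0 [k j]; apply: (ig k (fun j => r (Tagged (fun k => 'I_(e k)) j))).
by rewrite -dprod_basis_sum r0.
Qed.

End DProdBasis.

Arguments Gm_const L : simpl never.
Arguments P1_const L : simpl never.

Lemma mulr_inv_cancel (R : comPzRingType) (t ti x y z : R) :
  t * ti = 1 -> x * (t * y) * z * ti = x * z * y.
Proof.
move=> tK; transitivity ((t * ti) * (x * z * y)); first by ring.
by rewrite tK mul1r.
Qed.

(** * Cyclic covers of the multiplicative group *)

Section PowerMap.
Variables (L : fieldType) (c : L) (e : nat).
Hypotheses (c0 : c != 0) (e0 : (0 < e)%N).

Lemma Gm_const_mulV : Gm_const L c^-1 * Gm_const L c = 1.
Proof. by rewrite -rmorphM mulVf // rmorph1. Qed.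
Lemma Gm_const_mulfV : Gm_const L c * Gm_const L c^-1 = 1.
Proof. by rewrite mulrC Gm_const_mulV. Qed.

Fact power_map_subproof :
  (horner_eval (Gm_const L c^-1 * Gm_t L ^+ e) \o map_poly (Gm_const L)) 'X *
    (Gm_const L c * Gm_tinv L ^+ e) = 1.
Proof.
rewrite -[X in X * _]/((map_poly (Gm_const L) 'X).[_]) map_polyX hornerX mulrACA.
rewrite Gm_const_mulV mul1r.
by rewrite -exprMn Gm_tinvK expr1n.
Qed.

(** The cover T = s^e / c. The constant is placed so that the fiber above T = 1 has the equation s^e
    = c. *)
Definition power_map : {rmorphism Gm L -> Gm L} := loc_lift power_map_subproof.

Lemma power_mapC a : power_map (Gm_const L a) = Gm_const L a.
Proof. by rewrite [LHS]loc_lift_of -[LHS]/((map_poly (Gm_const L) a%:P).[_]) map_polyC hornerC. Qed.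
Lemma power_mapX : power_map (Gm_t L) = Gm_const L c^-1 * Gm_t L ^+ e.
Proof. by rewrite [LHS]loc_lift_of -[LHS]/((map_poly (Gm_const L) 'X).[_]) map_polyX hornerX. Qed.
Lemma power_mapXn : Gm_t L ^+ e = power_map (Gm_const L c * Gm_t L).
Proof.
by rewrite rmorphM power_mapC power_mapX mulrA Gm_const_mulfV mul1r.
Qed.

Hypothesis e_unit : e%:R != 0 :> L.

Lemma power_map_etale : formally_etale power_map.
Proof.
have [phi [phiC phiX]] := pz_eval_exists power_map (Gm_t L).
pose b := Gm_const L c * Gm_t L.
have bE : Gm_const L c^-1 * b = Gm_t L by rewrite /b mulrA Gm_const_mulV mul1r.
have d : ('X^e - b%:P : {poly Gm L})^`() = 'X^(e.-1) *+ e by rewrite derivB derivXn derivC subr0.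
apply: (@monogenic_etale _ _ power_map phi ('X^e - b%:P)
  (Gm_const L e%:R^-1 * Gm_tinv L ^+ e.-1)) => [x|||T f y|T g g' gg'].
- exact: phiC.
- by rewrite rmorphB rmorphXn phiC phiX power_mapXn subrr.
- rewrite d rmorphMn rmorphXn phiX mulrCA mulrnAl -exprMn Gm_tinvK expr1n.
  by rewrite -(rmorph_nat (Gm_const L)) -rmorphM mulVf // rmorph1.
- rewrite rmorphB rmorphXn => /eqP; rewrite subr_eq0 => /eqP fX _.
  have u : f 'X * (f 'X ^+ e.-1 * f (Gm_const L c^-1 * Gm_tinv L)%:P) = 1.
    rewrite mulrA -exprS prednK // fX -rmorphM -polyCM /b mulrACA Gm_const_mulfV.
    by rewrite Gm_tinvK mulr1 !rmorph1.
  have [h [hC hX]] := pz_eval_exists (f \o polyC \o Gm_const L) (f 'X).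
  have {}u : h 'X * (f 'X ^+ e.-1 * f (Gm_const L c^-1 * Gm_tinv L)%:P) = 1 by rewrite hX.
  have [g gE] : exists g : {rmorphism Gm L -> T}, forall p, g (loc_of _ p) = h p.
    by exists (loc_lift u); exact: loc_lift_of.
  have gC a : g (Gm_const L a) = f (Gm_const L a)%:P by exact: etrans (gE _) (hC _).
  have gX : g (Gm_t L) = f 'X by exact: etrans (gE _) hX.
  exists g; apply: (polyhom_ext (f := g \o phi)) => [x|]; last by rewrite /= phiX.
  rewrite -[LHS]/(g (phi x%:P)) phiC.
  apply: (Gm_ext (f := g \o power_map) (g := f \o polyC)) => [a|].
    exact: etrans (congr1 g (power_mapC a)) (gC a).
  apply: (etrans (congr1 g power_mapX)); rewrite rmorphM rmorphXn gC gX fX.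
  transitivity (f (Gm_const L c^-1 * b)%:P); last exact: (congr1 (fun x => f x%:P) bE).
  exact: esym (etrans (congr1 f (polyCM _ _)) (rmorphM f _ _)).
- apply: Gm_ext => [a|].
    by rewrite -power_mapC -phiC; exact: gg'.
  by rewrite -phiX; exact: gg'.
Qed.

Lemma power_map_spans : spans power_map (fun j : 'I_e => Gm_t L ^+ j).
Proof.
pose ps := @pspan _ _ power_map (Gm_t L) e.
have ps1 : ps 1 by rewrite -[1](expr0 (Gm_t L)); exact: pspan_pow.
have tn : ps (Gm_t L ^+ e) by rewrite power_mapXn -[X in ps X]mulr1; exact: pspanZ.
have psC a y : ps y -> ps (Gm_const L a * y) by rewrite -power_mapC; exact: pspanZ.
have psX p y : ps y -> ps (loc_of _ p * y).
  move=> py; elim/poly_ind: p => [|p a IHp]; first by rewrite rmorph0 mul0r; exact: pspan0.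
  rewrite rmorphD rmorphM mulrDl; apply: pspanD; last exact: psC.
  by rewrite mulrAC mulrC; apply: pspanM.
have psV y : ps y -> ps (Gm_tinv L * y).
  have -> : Gm_tinv L = power_map (Gm_const L c^-1 * Gm_tinv L) * Gm_t L ^+ e.-1.
    rewrite rmorphM power_mapC -[LHS]mul1r -(rmorph1 power_map) -Gm_tinvK rmorphM power_mapX.
    have -> : Gm_t L ^+ e = Gm_t L * Gm_t L ^+ e.-1 by rewrite -exprS prednK.
    exact: (@mulr_inv_cancel (Gm L) (Gm_t L) (Gm_tinv L) (Gm_const L c^-1) (Gm_t L ^+ e.-1) (power_map (Gm_tinv L)) (Gm_tinvK L)).
  by move=> py; rewrite -mulrA; apply: pspanZ; apply: pspanMX.
move=> z.
have [p [n zE]] := loc_image (idfun : {rmorphism Gm L -> Gm L}) z (polyX_neq0 _).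
have -> : z = Gm_tinv L ^+ n * (loc_of _ p * 1).
  have <- : z * Gm_t L ^+ n = loc_of _ p by exact: zE.
  by rewrite mulr1 mulrCA -exprMn [Gm_tinv L * _]mulrC Gm_tinvK expr1n mulr1.
by elim: n {zE} => [|n IHn]; [rewrite mul1r; exact: psX|rewrite exprS -mulrA; exact: psV].
Qed.

End PowerMap.

(** * Power series solutions: roots and local branches *)

Section SeriesEvaluation.
Variables (L : fieldType) (x : powser L).

Definition sev (p : {poly L}) : powser L := (map_poly (const_powser L) p).[x].
Fact sev_is_zmod_morphism : zmod_morphism sev.
Proof. by move=> p q; rewrite /sev rmorphB hornerD hornerN. Qed.
Fact sev_is_monoid_morphism : monoid_morphism sev.
Proof. by split=> [|p q]; rewrite /sev ?rmorph1 ?hornerC // rmorphM hornerM. Qed.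
HB.instance Definition _ := GRing.isZmodMorphism.Build {poly L} (powser L)
  sev sev_is_zmod_morphism.
HB.instance Definition _ := GRing.isMonoidMorphism.Build {poly L} (powser L)
  sev sev_is_monoid_morphism.

Lemma sevC a : sev a%:P = const_powser L a.
Proof. by rewrite /sev map_polyC hornerC. Qed.
Lemma sevX : sev 'X = x.
Proof. by rewrite /sev map_polyX hornerX. Qed.
Lemma sev_XsubC a : sev ('X - a%:P) = x - const_powser L a.
Proof. by rewrite /sev rmorphB /= map_polyX map_polyC hornerXsubC. Qed.
Lemma cterm_sev p : cterm (sev p) = p.[cterm x].
Proof.
rewrite /sev cterm_horner -map_poly_comp /=; congr horner.
by rewrite map_poly_id // => a _; exact: cterm_const.
Qed.

End SeriesEvaluation.

Lemma map_ctermC (L : fieldType) (x : powser L) : map_poly (@cterm L) x%:P = (cterm x)%:P.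
Proof. exact: map_polyC. Qed.

Lemma expX_sub1_derivable (L : fieldType) e : (0 < e)%N -> e%:R != 0 :> L ->
  root ('X^e - 1 : {poly L}) 1 /\ ('X^e - 1 : {poly L})^`().[1] != 0.
Proof.
move=> e0 eu; rewrite rootE hornerD hornerN hornerC hornerXn expr1n subrr eqxx; split=> //.
by rewrite derivB derivXn derivC subr0 hornerMn hornerXn expr1n.
Qed.

Section RootOfUnity.
Variables (L : fieldType) (e : nat) (b : powser L).
Hypotheses (e0 : (0 < e)%N) (e_unit : e%:R != 0 :> L) (b1 : cterm b = 1).

Let p : {poly powser L} := 'X^e - b%:P.
Let pE : map_poly (@cterm L) p = 'X^e - 1.
Proof. by rewrite rmorphB /= map_polyXn map_ctermC b1. Qed.
Let proot x : (p.[x] = 0) <-> x ^+ e = b.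
Proof.
rewrite hornerD hornerN hornerC hornerXn; split=> [/eqP|->]; last by rewrite subrr.
by rewrite subr_eq0 => /eqP.
Qed.

Lemma series_root : exists x, cterm x = 1 /\ x ^+ e = b.
Proof.
have [r1 r1'] := expX_sub1_derivable e0 e_unit.
have [||x [x1 /proot xe]] := @hensel L p 1; rewrite ?pE //.
by exists x.
Qed.

(** Fixing the constant term at 1 removes the ambiguity by roots of unity; this is what makes the
    chosen roots commute with Galois in [eps_gal]. *)
Lemma series_root_unique x y : cterm x = 1 -> cterm y = 1 ->
  x ^+ e = b -> y ^+ e = b -> x = y.
Proof.
have [r1 r1'] := expX_sub1_derivable e0 e_unit.
move=> x1 y1 /proot xe /proot ye.
by apply: (@hensel_unique L p 1 _ x y x1 y1 xe ye); rewrite pE.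
Qed.

End RootOfUnity.

Section LocalExpansion.
Variables (L : fieldType) (P Q : {poly L}) (a : L).
Hypotheses (P0 : P != 0) (Pa : root P a) (Qa : Q.[a] != 0).
Hypothesis char0 : forall n, (0 < n)%N -> n%:R != 0 :> L.

Definition ram := mup a P.
Definition cofac := P %/ ('X - a%:P) ^+ ram.

Lemma ram_gt0 : (0 < ram)%N.
Proof. by rewrite /ram -XsubC_dvd // dvdp_XsubCl. Qed.
Lemma ramE : P = cofac * ('X - a%:P) ^+ ram.
Proof. by rewrite divpK // -mup_geq. Qed.
Lemma cofac_neq0 : cofac.[a] != 0.
Proof.
apply/negP => /factor_theorem[q qE].
have : (ram.+1 <= ram)%N; last by rewrite ltnn.
by rewrite {2}/ram mup_geq // [X in _ %| X]ramE qE -mulrA -exprS dvdp_mull.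
Qed.

Definition lead := cofac.[a] / Q.[a].
Lemma lead_neq0 : lead != 0.
Proof. by rewrite mulf_neq0 ?invr_neq0 // cofac_neq0. Qed.

Definition expansion (nu : powser L) := const_powser L a + pvar * nu.
Lemma cterm_expansion nu : cterm (expansion nu) = a.
Proof.
by rewrite ctermD ctermM cterm_const cterm_pvar mul0r addr0.
Qed.

Lemma sev_P nu : sev (expansion nu) P = sev (expansion nu) cofac * (pvar * nu) ^+ ram.
Proof.
rewrite {1}ramE rmorphM rmorphXn /= sev_XsubC /expansion.
by rewrite [const_powser L a + _]addrC addrK.
Qed.

(** On the branch z = a + x nu, the function P / Q is exactly [lead] times x^[ram]. Solutions differ
    by [ram]-th roots of unity, and the constant term 1 selects one of them. *)
Definition solves (nu : powser L) := cterm nu = 1 /\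
  sev (expansion nu) P = const_powser L lead * pvar ^+ ram * sev (expansion nu) Q.

Let lin : {poly powser L} := pvar%:P * 'X + (const_powser L a)%:P.
Let comp (p : {poly L}) : {poly powser L} := map_poly (const_powser L) p \Po lin.
Let eqn : {poly powser L} := 'X^ram * comp cofac - (const_powser L lead)%:P * comp Q.

Let compE p nu : (comp p).[nu] = sev (expansion nu) p.
Proof.
rewrite horner_comp /lin hornerD hornerC hornerM hornerC hornerX.
by rewrite /sev /expansion addrC.
Qed.

Let comp_cterm p : map_poly (@cterm L) (comp p) = p.[a]%:P.
Proof.
have -> : map_poly (@cterm L) (comp p) = map_poly (@cterm L \o const_powser L) p \Po map_poly (@cterm L) lin.
  by rewrite map_comp_poly -map_poly_comp.
have -> : map_poly (@cterm L) lin = a%:P.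
  rewrite rmorphD rmorphM /= map_polyX.
  by rewrite !map_ctermC cterm_pvar mul0r add0r cterm_const.
rewrite map_poly_id => [|x _]; last exact: cterm_const.
by rewrite comp_polyCr.
Qed.

(** After division by x^[ram], the equation for nu reduces at x = 0 to nu^[ram] = 1. In
    characteristic 0 the root 1 is simple, so Hensel's lemma applies. *)
Let eqn_cterm : map_poly (@cterm L) eqn = cofac.[a] *: ('X^ram - 1).
Proof.
transitivity ('X^ram * cofac.[a]%:P - lead%:P * Q.[a]%:P).
  have -> : map_poly (@cterm L) eqn = map_poly (@cterm L) 'X^ram * map_poly (@cterm L) (comp cofac) -
      map_poly (@cterm L) (const_powser L lead)%:P * map_poly (@cterm L) (comp Q).
    rewrite /eqn; move: 'X^ram (comp cofac) (const_powser L lead)%:P (comp Q) => x y z t.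
    by rewrite rmorphB !rmorphM.
  by rewrite !comp_cterm map_polyXn map_ctermC cterm_const.
by rewrite -polyCM divfK // scalerBr alg_polyC mulrC mul_polyC.
Qed.

Let eqn_root nu : cterm nu = 1 -> (eqn.[nu] = 0 <-> solves nu).
Proof.
move=> nu1.
have -> : eqn.[nu] = nu ^+ ram * sev (expansion nu) cofac -
    const_powser L lead * sev (expansion nu) Q.
  by rewrite hornerD hornerN !hornerM hornerC hornerXn !compE.
rewrite /solves sev_P exprMn; move: (sev _ cofac) (sev _ Q) => u q.
have := expf_neq0 ram (pvar_neq0 L); move: (pvar ^+ ram) (nu ^+ ram) (const_powser L lead) => w n k w0.
split=> [/eqP|[_ /eqP]]; rewrite ?subr_eq0 => /eqP e.
  split=> //; transitivity (w * (n * u)); first by ring.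
  by rewrite e; ring.
apply: (mulfI w0); rewrite mulr0 mulrBr; apply/eqP.
rewrite subr_eq0; apply/eqP; transitivity (u * (w * n)); first by ring.
by rewrite e; ring.
Qed.

Lemma solves_exists : exists nu, solves nu.
Proof.
have [r1 r1'] := expX_sub1_derivable ram_gt0 (char0 ram_gt0).
have [||nu [nu1 e]] := @hensel L eqn 1.
- by rewrite eqn_cterm rootZ ?cofac_neq0.
- by rewrite eqn_cterm derivZ hornerZ mulf_neq0 ?cofac_neq0.
by exists nu; apply/eqn_root.
Qed.

Lemma solves_unique nu nu' : solves nu -> solves nu' -> nu = nu'.
Proof.
have [r1 r1'] := expX_sub1_derivable ram_gt0 (char0 ram_gt0).
move=> s s'; have [n1 _] := s; have [n1' _] := s'.
apply: (@hensel_unique L eqn 1 _ nu nu' n1 n1'); [|exact/eqn_root|exact/eqn_root].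
by rewrite eqn_cterm derivZ hornerZ mulf_neq0 ?cofac_neq0.
Qed.

Definition nu_series := sval (cid solves_exists).
Lemma nu_solves : solves nu_series.
Proof. exact: svalP (cid solves_exists). Qed.

End LocalExpansion.

Lemma sum_count_seq_sub (T : choiceType) (r s : seq T) :
  (\sum_(k : seq_sub r) count_mem (val k) s = count [in r] s)%N.
Proof.
elim: s => [|z s IHs] /=; first by rewrite big1.
rewrite big_split /= IHs; congr (_ + _)%N; case: (boolP (z \in r)) => zr.
  rewrite (bigD1 (SeqSub zr)) //= eqxx big1 ?addn0 // => k.
  by rewrite -val_eqE /= eq_sym => /negPf ->.
by rewrite big1 // => k _; case: eqP => // e; rewrite e (valP k) in zr.
Qed.

Section Roots.
Variables (L : closedFieldType) (P : {poly L}).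
Hypothesis Pm : P \is monic.

Definition root_seq : seq L := sval (closed_field_poly_normal P).
Lemma rtsE : P = \prod_(z <- root_seq) ('X - z%:P).
Proof.
by have := svalP (closed_field_poly_normal P); rewrite -/root_seq (monicP Pm) scale1r.
Qed.
Lemma mem_rts z : (z \in root_seq) = root P z.
Proof. by rewrite rtsE root_prod_XsubC. Qed.
Lemma size_rts : size P = (size root_seq).+1.
Proof. by rewrite {1}rtsE size_prod_XsubC. Qed.
Lemma ram_count z : ram P z = count_mem z root_seq.
Proof. by rewrite /ram {1}rtsE mu_prod_XsubC. Qed.

Lemma sum_ram : (\sum_(k : seq_sub root_seq) ram P (val k) = (size P).-1)%N.
Proof.
rewrite size_rts; under eq_bigr do rewrite ram_count.
by rewrite sum_count_seq_sub; apply/eqP; rewrite -all_count; apply/allP.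
Qed.

Lemma ram_dvd_eq0 (p : {poly L}) : (size p <= (size P).-1)%N ->
  (forall k : seq_sub root_seq, ('X - (val k)%:P) ^+ ram P (val k) %| p) -> p = 0.
Proof.
move=> sp dvd; apply/eqP/negPn/negP => p0; have [s sE] := closed_field_poly_normal p.
have ss : size p = (size s).+1 by rewrite sE size_scale ?lead_coef_eq0 // size_prod_XsubC.
suff : ((size P).-1 <= size s)%N by rewrite leqNgt -ss sp.
rewrite -sum_ram (leq_trans _ (count_size [in root_seq] s)) // -sum_count_seq_sub.
apply: leq_sum => k _; have := dvd k; rewrite -mup_geq // [in mup _ _]sE -mul_polyC mupMr.
  by rewrite mu_prod_XsubC.
by rewrite -/(root _ _) rootC lead_coef_eq0.
Qed.

End Roots.

Lemma tpar_series (F L : fieldType) (i : {rmorphism F -> L}) (bp : tangential_base_point F) :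
  exists a : powser L, tpar i bp = FracField.tofrac (pvar * a) /\ cterm a * i (tbp_vec bp) = 1.
Proof.
have [P [Q [tE Q0 P0 dPQ]]] := tparE i bp.
have Qc : cterm (poly_powser Q) != 0 by rewrite /cterm /= -horner_coef0.
have [b Qb] := powser_inv Qc.
have [q qE] : exists q, P = q * 'X.
  by have /factor_theorem[q] : root P 0 by [apply/eqP]; rewrite subr0; exists q.
exists (poly_powser q * b); split.
  have Q0' : FracField.tofrac (poly_powser Q) != 0.
    by rewrite tofrac_eq0; apply: contraNneq Qc => ->; rewrite raddf0.
  apply: (mulIf Q0'); rewrite tE divfK // qE -tofracM; congr FracField.tofrac.
  have -> : poly_powser (q * 'X) = poly_powser q * pvar by rewrite rmorphM.
  move: (poly_powser q) (poly_powser Q) pvar Qb => x y w yb.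
  transitivity (w * x * (y * b)); last by ring.
  by rewrite yb mulr1 mulrC.
have bc : cterm (poly_powser Q) * cterm b = 1 by rewrite -ctermM Qb rmorph1.
have Qq : cterm (poly_powser Q) = cterm (poly_powser q) * i (tbp_vec bp).
  have -> : cterm (poly_powser Q) = Q.[0] by rewrite horner_coef0.
  by rewrite -dPQ qE derivM derivX mulr1 hornerD hornerM hornerX mulr0 add0r horner_coef0.
by move: bc; rewrite Qq ctermM => <-; ring.
Qed.

Local Notation "x %:F" := (@FracField.tofrac _ x).

Section LaurentValues.
Variable L : fieldType.

Lemma sevM (x : powser L) p q : sev x (p * q) = sev x p * sev x q.
Proof. exact: rmorphM. Qed.
Lemma const_powser_neq0 (a : L) : a != 0 -> const_powser L a != 0.
Proof. by move=> a0; apply: contra_neq a0 => e; rewrite -[a]cterm_const e raddf0. Qed.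

Lemma laurent_substE (x : powser L) p : laurent_subst x%:F p = (sev x p)%:F.
Proof.
move: p; apply: (polyhom_ext (g := @FracField.tofrac _ \o sev x)) => [a|].
  rewrite -[LHS]/((map_poly (@laurent_const L) a%:P).[x%:F]) map_polyC hornerC.
  by rewrite -[RHS]/((sev x a%:P)%:F) sevC.
rewrite -[LHS]/((map_poly (@laurent_const L) 'X).[x%:F]) map_polyX hornerX.
by rewrite -[RHS]/((sev x 'X)%:F) sevX.
Qed.

Lemma iotaX_C a : iotaX (P1_const L a) = (const_powser L a)%:F.
Proof. exact: iotaXE. Qed.
Lemma iotaX_x : iotaX (P1_x L) = pvar%:F.
Proof. exact: iotaXE. Qed.

Lemma iotaG_C (t : {laurent L}) (t0 : t != 0) a : iotaG t0 (Gm_const L a) = (const_powser L a)%:F.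
Proof.
rewrite -[Gm_const L a]/(loc_of _ a%:P) iotaGE.
by rewrite -[LHS]/((map_poly (@laurent_const L) a%:P).[t]) map_polyC hornerC.
Qed.
Lemma iotaG_t (t : {laurent L}) (t0 : t != 0) : iotaG t0 (Gm_t L) = t.
Proof.
rewrite -[Gm_t L]/(loc_of _ 'X) iotaGE.
by rewrite -[LHS]/((map_poly (@laurent_const L) 'X).[t]) map_polyX hornerX.
Qed.

Lemma iotaX_inj : injective (@iotaX L).
Proof.
apply: raddf_inj => z z0; have [p [n zE]] := loc_image (idfun : {rmorphism P1_minus3 L -> P1_minus3 L}) z (X1X_neq0 _).
have {}zE : z * loc_of _ ('X * (1 - 'X)) ^+ n = loc_of _ p by exact: zE.
have p0 : p = 0.
  by apply/eqP; rewrite -(@laurent_of_poly_eq0 L) -iotaXE -zE rmorphM z0 mul0r.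
rewrite -[z]mulr1 -(expr1n _ n) -(loc_invK (X1X_neq0 L)) exprMn mulrA zE p0.
by rewrite rmorph0 mul0r.
Qed.

Lemma sev_inj (x : powser L) : cterm x != 0 -> injective (sev (pvar * x)).
Proof.
move=> x0; apply: raddf_inj => p p0; apply/eqP/negPn/negP => pn0.
have := @dvdp_of_pdvd _ p 0 x (size p) x0; rewrite rmorph0 add0r -/(sev _ p) p0 subr0.
move=> /(_ _)/(dvdp_leq pn0); rewrite size_polyXn ltnn => H.
by apply: notF; apply: H; exists 0; rewrite mulr0.
Qed.

Lemma iotaG_inj (x : powser L) (x0 : cterm x != 0) (t : {laurent L}) (t0 : t != 0) : t = (pvar * x)%:F -> injective (iotaG t0).
Proof.
move=> tE; apply: raddf_inj => z z0; have [p [n zE]] := loc_image (idfun : {rmorphism Gm L -> Gm L}) z (polyX_neq0 _).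
have {}zE : z * loc_of _ 'X ^+ n = loc_of _ p by exact: zE.
have p0 : p = 0.
  apply: (sev_inj x0); rewrite rmorph0; apply/eqP; rewrite -tofrac_eq0 -laurent_substE -tE.
  by rewrite -iotaGE -zE rmorphM z0 mul0r.
rewrite -[z]mulr1 -(expr1n _ n) -(loc_invK (polyX_neq0 L)) exprMn mulrA zE p0.
by rewrite rmorph0 mul0r.
Qed.

End LaurentValues.

(** * Assembling the cover *)

(** A Belyi function P / Q with value 1 at infinity: the last condition says that all its finite
    critical points are zeros or poles. *)
Definition wronskian_pair (L : fieldType) (P Q : {poly L}) : Prop :=
  [/\ [/\ P \is monic, Q \is monic & size Q = size P], (1 < size P)%N, coprimep P Q &
      exists R m, (P^`() * Q - P * Q^`()) * R = (P * Q) ^+ m].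

Section Cover.
Variables (F : fieldType) (L : closedFieldType) (i : {rmorphism F -> L}).
Variable bp : tangential_base_point F.
Hypothesis char0 : forall n, (0 < n)%N -> n%:R != 0 :> L.
Variables (P Q : {poly L}).
Hypothesis PQ : wronskian_pair P Q.
Let Pm : P \is monic. Proof. by case: PQ => [[]]. Qed.
Let Qm : Q \is monic. Proof. by case: PQ => [[]]. Qed.
Let PQsize : size Q = size P. Proof. by case: PQ => [[]]. Qed.
Let PQ1 : (1 < size P)%N. Proof. by case: PQ. Qed.
Let PQcop : coprimep P Q. Proof. by case: PQ. Qed.
Let PQw : exists R m, (P^`() * Q - P * Q^`()) * R = (P * Q) ^+ m. Proof. by case: PQ. Qed.
Let P0 : P != 0. Proof. exact: monic_neq0. Qed.

Definition tvec : L := i (tbp_vec bp).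
Lemma tvec_neq0 : tvec != 0.
Proof. by rewrite fmorph_eq0 tbp_vec_neq0. Qed.
Definition tser : powser L := sval (cid (tpar_series i bp)).
Lemma tparF : tpar i bp = (pvar * tser)%:F.
Proof. by case: (svalP (cid (tpar_series i bp))). Qed.
Lemma cterm_tser : cterm tser * tvec = 1.
Proof. by case: (svalP (cid (tpar_series i bp))). Qed.

Local Notation I := (seq_sub (root_seq P)).
Implicit Types k : I.
Definition root_val k : L := val k.
Lemma rt_root k : root P (root_val k).
Proof. by rewrite -mem_rts ?Pm //; exact: (valP k). Qed.
Lemma rt_Q k : Q.[root_val k] != 0.
Proof.
by have := coprimep_root PQcop (rt_root k).
Qed.
Definition root_ram k := ram P (root_val k).
Lemma rm_gt0 k : (0 < root_ram k)%N.
Proof. exact: ram_gt0 P0 (rt_root k). Qed.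
Definition root_lead k := lead P Q (root_val k).
Lemma ld_neq0 k : root_lead k != 0.
Proof. exact: lead_neq0 P0 (rt_Q k). Qed.
Definition root_nu k := nu_series P0 (rt_root k) (rt_Q k) char0.
Lemma nusP k : solves P Q (root_val k) (root_nu k).
Proof. exact: nu_solves. Qed.
Definition root_series k := expansion (root_val k) (root_nu k).

(** On the branch x |-> k x^e the parameter t = x [tser] becomes k x^e [tser](k x^e), to be matched
    with T = (k / v) s^e. Hence s = x [eps] with eps^e = v [tser](k x^e), whose constant term is 1
    since dt(v) = 1. *)
Definition eps_rhs k := const_powser L tvec * psub (ld_neq0 k) (rm_gt0 k) tser.
Lemma cterm_eps_rhs k : cterm (eps_rhs k) = 1.
Proof. by rewrite ctermM cterm_const cterm_psub mulrC cterm_tser. Qed.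
Definition eps k := sval (cid (series_root (rm_gt0 k) (char0 (rm_gt0 k)) (cterm_eps_rhs k))).
Lemma epsP k : cterm (eps k) = 1 /\ eps k ^+ root_ram k = eps_rhs k.
Proof. exact: svalP (cid (series_root _ _ _)). Qed.

Fact unif_neq0 k : (pvar * eps k)%:F != 0.
Proof.
rewrite tofrac_eq0 mulf_neq0 ?pvar_neq0 //; have [e1 _] := epsP k.
by apply: contra_eq_neq e1 => ->; rewrite raddf0 eq_sym oner_neq0.
Qed.

Fact twist_neq0 k : tvec / root_lead k != 0.
Proof. by rewrite mulf_neq0 ?invr_neq0 ?tvec_neq0 ?ld_neq0. Qed.

Lemma cterm_zs k : cterm (root_series k) = root_val k.
Proof. exact: cterm_expansion. Qed.

Lemma sev_zs_P k : sev (root_series k) P = const_powser L (root_lead k) * pvar ^+ root_ram k * sev (root_series k) Q.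
Proof. by case: (nusP k). Qed.

Fact crit_zs k : (@FracField.tofrac _ \o sev (root_series k)) (crit_poly P Q) *
  (sev (root_series k) (crit_poly P Q))%:F^-1 = 1.
Proof.
rewrite divff // tofrac_eq0.
have ev_neq0 p : p.[root_val k] != 0 -> sev (root_series k) p != 0.
  by apply: contraNneq => p0; rewrite -cterm_zs -cterm_sev p0 raddf0.
have Q0 := ev_neq0 _ (rt_Q k).
rewrite /crit_poly !sevM; apply: mulf_neq0; last first.
  apply: ev_neq0.
  by rewrite hornerD hornerN (eqP (rt_root k)) sub0r oppr_eq0 rt_Q.
apply: (mulf_neq0 _ Q0); rewrite sev_zs_P; apply: (mulf_neq0 _ Q0).
by rewrite mulf_neq0 ?expf_neq0 ?pvar_neq0 ?const_powser_neq0 ?ld_neq0.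
Qed.

Definition rX k : {rmorphism loc (crit_poly P Q) -> {laurent L}} := loc_lift (crit_zs k).
Lemma rXE k p : rX k (cX P Q p) = (sev (root_series k) p)%:F.
Proof. exact: loc_lift_of. Qed.

Variables (a0 : L) (Pa0 : root P a0).
Fact base_mem : a0 \in root_seq P. Proof. by rewrite mem_rts. Qed.
Definition base_index : I := SeqSub base_mem.

Local Notation CX := (loc (crit_poly P Q)).
Local Notation CG := (dprod base_index (fun=> Gm L)).
Local Notation CK := (dprod base_index (fun=> {laurent L})).

Definition sX : {rmorphism P1_minus3 L -> CX} := str_cover_X Pm Qm PQ1 PQcop.
Definition sG : {rmorphism Gm L -> CG} := dprod_lift base_index (fun k => power_map (root_ram k) (twist_neq0 k)).
Definition root_ksub k : {rmorphism {laurent L} -> {laurent L}} := ksub (ld_neq0 k) (rm_gt0 k).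
(** Over the punctured disc the cover decomposes into one branch for each zero of [P]: L((x)) as an
    extension of itself by x |-> k x^e, with k the leading coefficient and e the multiplicity. Both
    [cov_X] and [cov_G] are compared with the product of these branches. *)
Definition sK : {rmorphism {laurent L} -> CK} := dprod_lift base_index root_ksub.
Definition rsX : {rmorphism CX -> CK} := dprod_lift base_index rX.
Definition rG k : {rmorphism Gm L -> {laurent L}} := iotaG (unif_neq0 k).
Definition rsG : {rmorphism CG -> CK} := dprod_map id rG.

Lemma ksC k a : root_ksub k (const_powser L a)%:F = (const_powser L a)%:F.
Proof. by rewrite /root_ksub ksubE psub_const. Qed.
Lemma ks_pvar k : root_ksub k pvar%:F = (const_powser L (root_lead k) * pvar ^+ root_ram k)%:F.
Proof. by rewrite /root_ksub ksubE psub_pvar. Qed.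

Lemma rX_sX k z : rX k (sX z) = root_ksub k (iotaX z).
Proof.
move: z; apply: (P1_ext (f := rX k \o sX) (g := root_ksub k \o iotaX)) => [a|].
  rewrite -[LHS]/(rX k (sX _)) -[RHS]/(root_ksub k (iotaX _)) iotaX_C ksC /sX str_cover_XC.
  by rewrite rXE sevC.
rewrite -[LHS]/(rX k (sX _)) -[RHS]/(root_ksub k (iotaX _)) iotaX_x ks_pvar.
have Q0 : (sev (root_series k) Q)%:F != 0.
  by rewrite tofrac_eq0; apply: contraNneq (rt_Q k) => p0; rewrite -cterm_zs -cterm_sev p0 raddf0.
apply: (mulIf Q0); rewrite -tofracM -sev_zs_P -!rXE -rmorphM.
by rewrite -(str_cover_XxQ Pm Qm PQ1 PQcop).
Qed.

Lemma rG_power k z : rG k (power_map (root_ram k) (twist_neq0 k) z) = root_ksub k (iotaG (tpar_neq0 i bp) z).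
Proof.
move: z; apply: (Gm_ext (f := rG k \o power_map _ (twist_neq0 k)) (g := root_ksub k \o iotaG _)) => [a|].
  rewrite -[LHS]/(rG k (power_map _ _ _)) -[RHS]/(root_ksub k (iotaG _ _)) power_mapC.
  by rewrite [rG k _]iotaG_C iotaG_C ksC.
rewrite -[LHS]/(rG k (power_map _ _ _)) -[RHS]/(root_ksub k (iotaG _ _)) power_mapX rmorphM rmorphXn.
rewrite [rG k (Gm_const _ _)]iotaG_C [rG k _]iotaG_t iotaG_t tparF /root_ksub ksubE.
rewrite -tofracXn -tofracM exprMn; congr FracField.tofrac.
have -> : psub (ld_neq0 k) (rm_gt0 k) (pvar * tser) =
    const_powser L (root_lead k) * pvar ^+ root_ram k * psub (ld_neq0 k) (rm_gt0 k) tser.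
  by rewrite -(psub_pvar (ld_neq0 k) (rm_gt0 k)); exact: (rmorphM (psub (ld_neq0 k) (rm_gt0 k))).
have [_ ->] := epsP k; rewrite /eps_rhs.
have e : const_powser L (tvec / root_lead k)^-1 * const_powser L tvec = const_powser L (root_lead k).
  by rewrite -rmorphM invfM invrK mulrAC mulVf ?tvec_neq0 ?mul1r.
rewrite -e; move: (const_powser _ _) (const_powser _ _) (pvar ^+ _) (psub _ _ _) => x y z w.
by ring.
Qed.

Local Notation J := {k : I & 'I_(root_ram k)}.

Lemma card_J : #|{: J}| = (size P).-1.
Proof.
rewrite card_tagged sumnE big_map big_enum /= -(sum_ram Pm).
by apply: eq_bigr => k _; rewrite card_ord.
Qed.

Lemma sK_spans_pvar : spans sK (dprod_basis base_index (fun k (j : 'I_(root_ram k)) => (pvar ^+ j)%:F)).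
Proof. by apply: dprod_spans => k; exact: ksub_spans. Qed.

(** All branches are used together: a polynomial of degree below deg P that is divisible by (X -
    c)^e for every zero c of multiplicity e vanishes. The rank of [cov_K] is the sum of the e, that
    is deg P, so independence also yields spanning. *)
Lemma X_basis_independent : independent sK (rsX \o (fun j : 'I_(size P).-1 => cX P Q 'X ^+ j)).
Proof.
move=> r r0; apply: (@ksub_independent _ I root_lead root_ram ld_neq0 rm_gt0 root_val root_nu).
- by move=> k; have [-> _] := nusP k; rewrite oner_neq0.
- by move=> p; exact: ram_dvd_eq0.
move=> k; have := congr1 (@dcomp _ _ _ ^~ k) r0; rewrite dprod_sum => e.
apply: etrans e; apply: eq_bigr => j _; rewrite -[dcomp (_ * _) k]/(root_ksub k (r j) * rX k (cX P Q 'X ^+ j)).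
by rewrite rmorphXn rXE sevX.
Qed.

Lemma X_basis_spans : spans sK (rsX \o (fun j : 'I_(size P).-1 => cX P Q 'X ^+ j)).
Proof.
by apply: (independent_spans _ sK_spans_pvar X_basis_independent); rewrite card_J card_ord.
Qed.

Lemma sX_rsX : rsX \o sX =1 sK \o iotaX.
Proof. by move=> z; apply: dprodP => k; exact: rX_sX. Qed.

Lemma sX_pushout : is_pushout sX iotaX rsX sK.
Proof.
apply: (basis_pushout sX_rsX _ X_basis_spans X_basis_independent).
exact: cover_X_spans.
Qed.

Lemma sX_etale : finite_etale sX.
Proof.
split; last exact: cover_X_etale PQw.
apply: (free_finitely_presented (cover_X_spans Pm Qm PQsize PQ1 PQcop)).
exact: independent_base sX_rsX (@iotaX_inj L) X_basis_independent.
Qed.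

Let gG k (j : 'I_(root_ram k)) : Gm L := Gm_t L ^+ j.

Lemma rsG_basis x : rsG (dprod_basis base_index gG x) =
  dprod_basis base_index (fun k (j : 'I_(root_ram k)) => (pvar * eps k)%:F ^+ j) x.
Proof.
case: x => k j; apply: dprodP => l /=; case: eqP => [->|_]; last exact: rmorph0.
by rewrite /= /gG rmorphXn [rG k _]iotaG_t.
Qed.

Lemma eps_independent k : independent (root_ksub k) (fun j : 'I_(root_ram k) => (pvar * eps k)%:F ^+ j).
Proof.
move=> r r0; apply: (@ksub_independent _ unit (fun=> root_lead k) (fun=> root_ram k) (fun=> ld_neq0 k)
  (fun=> rm_gt0 k) (fun=> 0) (fun=> eps k)) => [_|p sp dvd|_].
- by have [-> _] := epsP k; rewrite oner_neq0.
- apply/eqP/negPn/negP => p0; have := dvdp_leq p0 (dvd tt).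
  by rewrite subr0 size_polyXn ltnNge sp.
by rewrite rmorph0 add0r.
Qed.

Lemma G_basis_independent : independent sK (rsG \o dprod_basis base_index gG).
Proof.
have ind := dprod_independent (i0 := base_index) eps_independent.
by move=> r r0; apply: ind; rewrite -[RHS]r0; apply: eq_bigr => x _; rewrite /= rsG_basis.
Qed.

Lemma G_basis_spans : spans sK (rsG \o dprod_basis base_index gG).
Proof. exact: (independent_spans _ sK_spans_pvar G_basis_independent). Qed.

Lemma sG_spans : spans sG (dprod_basis base_index gG).
Proof. by apply: dprod_spans => k; exact: power_map_spans (rm_gt0 k). Qed.

Lemma sG_rsG : rsG \o sG =1 sK \o iotaG (tpar_neq0 i bp).
Proof. by move=> z; apply: dprodP => k; exact: rG_power. Qed.

Lemma sG_pushout : is_pushout sG (iotaG (tpar_neq0 i bp)) rsG sK.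
Proof. exact: (basis_pushout sG_rsG sG_spans G_basis_spans G_basis_independent). Qed.

Lemma sG_etale : finite_etale sG.
Proof.
split; last by apply: etale_product => k; exact: power_map_etale (rm_gt0 k) (char0 (rm_gt0 k)).
apply: (free_finitely_presented sG_spans).
apply: (independent_base sG_rsG _ G_basis_independent).
apply: (iotaG_inj _ tparF).
by apply: contra_eq_neq cterm_tser => ->; rewrite mul0r eq_sym oner_neq0.
Qed.

Definition belyi_cover : fet_cover i bp := FetCover sX_etale sG_etale sX_pushout sG_pushout.

(** * Its points and its symmetries *)

Local Notation Y0 := belyi_cover.

(** Connectedness in the form needed by [fiber_transitive]. As [cov_X] is a localization of L[z], it
    suffices that z goes to no constant; a constant value would make x = P / Q constant as well. *)
Lemma belyi_cover_generic (Om : fieldType) (jK : {rmorphism {laurent L} -> Om})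
    (k : {rmorphism cov_K Y0 -> Om}) :
  k \o str_K Y0 =1 jK -> injective (k \o res_X Y0).
Proof.
move=> kj; pose c : {rmorphism L -> Om} := jK \o (@FracField.tofrac _ \o const_powser L).
pose f : {rmorphism CX -> Om} := k \o res_X Y0.
have fs y : f (sX y) = jK (iotaX y).
  by rewrite -[LHS]/(k ((rsX \o sX) y)) sX_rsX -[LHS]/((k \o str_K Y0) (iotaX y)) kj.
pose z := f (cX P Q 'X).
have fE p : f (cX P Q p) = poly_ev c z p.
  apply: (poly_evE (f := f \o cX P Q)) => // a.
  by rewrite -[LHS]/(f (cX P Q a%:P)) -(str_cover_XC Pm Qm PQ1 PQcop) [LHS]fs iotaX_C.
have zx : poly_ev c z P = jK pvar%:F * poly_ev c z Q.
  by rewrite -!fE -(str_cover_XxQ Pm Qm PQ1 PQcop) rmorphM [f (str_cover_X _ _ _ _ _)]fs iotaX_x.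
have ztr a : z <> c a.
  move=> za; have evE p : poly_ev c z p = c p.[a].
    by rewrite -[LHS]/((map_poly c p).[z]) za horner_map.
  move: zx; rewrite !evE -[LHS]/(jK _%:F) -[X in _ = _ * X]/(jK _%:F) -rmorphM -tofracM.
  move/fmorph_inj/eqP; rewrite tofrac_eq => /eqP e.
  have Pa : root P a.
    by apply/eqP; have := congr1 (@cterm L) e; rewrite ctermM cterm_pvar mul0r cterm_const.
  move: e; rewrite (eqP Pa) rmorph0 => /esym/eqP; rewrite mulf_eq0 (negPf (pvar_neq0 L)) /=.
  by apply/negP/const_powser_neq0; exact: (coprimep_root PQcop Pa).
have sI := poly_ev_inj ztr.
apply: raddf_inj => y y0.
have [p [n yE]] := loc_image (idfun : {rmorphism CX -> CX}) y (crit_poly_neq0 Pm Qm PQ1 PQcop).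
have {}yE : y * cX P Q (crit_poly P Q) ^+ n = cX P Q p by exact: yE.
have p0 : p = 0.
  by apply: sI; rewrite -fE -yE rmorphM [f y]y0 rmorph0 mul0r.
have critK : cX P Q (crit_poly P Q) * cXv P Q = 1 by exact: loc_invK (crit_poly_neq0 Pm Qm PQ1 PQcop).
by rewrite -[y]mulr1 -(expr1n _ n) -critK exprMn mulrA yE p0 rmorph0 mul0r.
Qed.

Fact horner_unit (s0 : L) : s0 != 0 -> horner_eval s0 'X * s0^-1 = 1.
Proof. by move=> s00; rewrite /horner_eval hornerX divff. Qed.

Definition Gm_eval s0 (s00 : s0 != 0) : {rmorphism Gm L -> L} := loc_lift (horner_unit s00).
Lemma Gm_evalC s0 (s00 : s0 != 0) a : Gm_eval s00 (Gm_const L a) = a.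
Proof. by rewrite [LHS]loc_lift_of /= /horner_eval hornerC. Qed.
Lemma Gm_evalt s0 (s00 : s0 != 0) : Gm_eval s00 (Gm_t L) = s0.
Proof. by rewrite [LHS]loc_lift_of /= /horner_eval hornerX. Qed.

Definition root_point_fun k s0 (s00 : s0 != 0) : {rmorphism cov_G Y0 -> L} :=
  Gm_eval s00 \o @dproj _ base_index (fun=> Gm L) k.

Fact root_point_over k s0 (s00 : s0 != 0) : s0 ^+ root_ram k = tvec / root_lead k ->
  root_point_fun k s00 \o str_G Y0 =1 eval1.
Proof.
move=> s0e; apply: (Gm_ext (f := Gm_eval s00 \o power_map (root_ram k) (twist_neq0 k)) (g := eval1)) => [a|].
  rewrite -[LHS]/(Gm_eval s00 (power_map _ _ _)) power_mapC Gm_evalC.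
  by rewrite -[Gm_const L a]/(loc_of _ a%:P) eval1E hornerC.
rewrite -[LHS]/(Gm_eval s00 (power_map _ _ _)) power_mapX rmorphM rmorphXn Gm_evalC Gm_evalt.
by rewrite -[Gm_t L]/(loc_of _ 'X) eval1E hornerX s0e mulVf // twist_neq0.
Qed.

Definition root_point k s0 (s00 : s0 != 0) (s0e : s0 ^+ root_ram k = tvec / root_lead k) : fiber_point Y0 :=
  @FiberPoint _ _ i bp Y0 (root_point_fun k s00) (root_point_over s00 s0e).

(** Being an element of the algebra, it reads off the zero under a point of the fiber by mere
    evaluation, and it transforms well under the maps of covers used for the Galois action. *)
Definition root_const : cov_G Y0 := DProd (fun k => Gm_const L (root_val k)).

Lemma root_point_const k s0 (s00 : s0 != 0) (s0e : s0 ^+ root_ram k = tvec / root_lead k) :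
  root_point s00 s0e root_const = root_val k.
Proof. exact: Gm_evalC. Qed.

Lemma root_point_exists (b : L) : root P b -> exists p : fiber_point Y0, p root_const = b.
Proof.
rewrite -mem_rts // => bP; pose k : I := SeqSub bP.
have [|s0 s0P] := @closed_has_root L ('X^(root_ram k) - (tvec / root_lead k)%:P).
  by rewrite size_XnsubC ?rm_gt0 // eqSS -lt0n rm_gt0.
have s0e : s0 ^+ root_ram k = tvec / root_lead k.
  by apply/eqP; rewrite -subr_eq0; move: s0P; rewrite rootE hornerD hornerN hornerC hornerXn.
have s00 : s0 != 0.
  apply: contra_eq_neq s0e => ->; rewrite expr0n eqn0Ngt rm_gt0 eq_sym; exact: twist_neq0.
by exists (root_point s00 s0e); rewrite root_point_const.
Qed.

End Cover.

(** * Galois equivariance of the cover *)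

Section CoefficientAction.
Variables (L : fieldType) (s : {rmorphism L -> L}).

Lemma powser_map_const a : powser_map s (const_powser L a) = const_powser L (s a).
Proof. by apply: powserP => n; rewrite /= !coefC; case: eqP => // _; rewrite rmorph0. Qed.
Lemma powser_map_pvar : powser_map s pvar = pvar.
Proof. by apply: powserP => n; rewrite /= !coefX rmorph_nat. Qed.
Lemma cterm_powser_map a : cterm (powser_map s a) = s (cterm a).
Proof. by []. Qed.
Lemma coefK_tofrac a : Defs.coefK s a%:F = (powser_map s a)%:F.
Proof. exact: frac_map_tofrac. Qed.

Lemma powser_map_sev x p : powser_map s (sev x p) = sev (powser_map s x) (map_poly s p).
Proof.
move: p; apply: (polyhom_ext (f := powser_map s \o sev x) (g := sev (powser_map s x) \o map_poly s)) => [a|].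
  rewrite -[LHS]/(powser_map s (sev x _)) sevC -[RHS]/(sev _ (map_poly s _)) map_polyC.
  by rewrite [RHS]sevC powser_map_const.
by rewrite -[LHS]/(powser_map s (sev x _)) sevX -[RHS]/(sev _ (map_poly s _)) map_polyX sevX.
Qed.

Lemma powser_map_psub k e (k0 : k != 0) (e0 : (0 < e)%N) k' e' (k0' : k' != 0) (e0' : (0 < e')%N) a :
  s k = k' -> e = e' ->
  powser_map s (psub k0 e0 a) = psub k0' e0' (powser_map s a).
Proof.
move=> kk ee; apply: powserP => n /=; rewrite -ee -kk; case: ifP => _; last exact: rmorph0.
by rewrite rmorphM rmorphXn.
Qed.

Lemma coefK_ksub k e (k0 : k != 0) (e0 : (0 < e)%N) k' e' (k0' : k' != 0) (e0' : (0 < e')%N) z :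
  s k = k' -> e = e' ->
  Defs.coefK s (ksub k0 e0 z) = ksub k0' e0' (Defs.coefK s z).
Proof.
move=> kk ee; case: (fracE z) => -[a b] /= b0 ->.
rewrite !fmorph_div !ksubE !coefK_tofrac !ksubE.
by rewrite !(powser_map_psub k0 e0 k0' e0').
Qed.

Lemma coefX_C a : Defs.coefX s (P1_const L a) = P1_const L (s a).
Proof. by rewrite [LHS]loc_lift_of -[LHS]/(loc_of _ (map_poly s a%:P)) map_polyC. Qed.
Lemma coefX_x : Defs.coefX s (P1_x L) = P1_x L.
Proof. by rewrite [LHS]loc_lift_of -[LHS]/(loc_of _ (map_poly s 'X)) map_polyX. Qed.
Lemma coefG_C a : coefG s (Gm_const L a) = Gm_const L (s a).
Proof. by rewrite [LHS]loc_lift_of -[LHS]/(loc_of _ (map_poly s a%:P)) map_polyC. Qed.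
Lemma coefG_t : coefG s (Gm_t L) = Gm_t L.
Proof. by rewrite [LHS]loc_lift_of -[LHS]/(loc_of _ (map_poly s 'X)) map_polyX. Qed.

Variables (P Q : {poly L}).
Hypotheses (sP : map_poly s P = P) (sQ : map_poly s Q = Q) (P0 : P != 0).

Lemma crit_map : map_poly s (crit_poly P Q) = crit_poly P Q.
Proof. by rewrite /crit_poly !rmorphM rmorphB /= sP sQ. Qed.
Lemma ram_map a : ram P (s a) = ram P a.
Proof.
have H n : (n <= ram P (s a))%N = (n <= ram P a)%N.
  rewrite !mup_geq // -[in RHS](dvdp_map s) rmorphXn rmorphB /= map_polyX map_polyC /=.
  by rewrite sP.
by apply/eqP; rewrite eqn_leq -H leqnn H leqnn.
Qed.
Lemma cofac_map a : map_poly s (cofac P a) = cofac P (s a).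
Proof.
by rewrite /cofac map_divp rmorphXn rmorphB /= map_polyX map_polyC /= ram_map sP.
Qed.
Lemma lead_map a : s (lead P Q a) = lead P Q (s a).
Proof. by rewrite /lead fmorph_div -!horner_map cofac_map sQ. Qed.

Lemma solves_map a nu : solves P Q a nu -> solves P Q (s a) (powser_map s nu).
Proof.
have eE : powser_map s (expansion a nu) = expansion (s a) (powser_map s nu).
  by rewrite /expansion rmorphD rmorphM /= powser_map_const powser_map_pvar.
move=> [nu1 e]; split; first by rewrite cterm_powser_map nu1 rmorph1.
have := congr1 (powser_map s) e; rewrite !(rmorphM (powser_map s)) (rmorphXn (powser_map s)) /=.
by rewrite !powser_map_sev eE sP sQ powser_map_const powser_map_pvar lead_map ram_map.
Qed.

End CoefficientAction.

Section Descent.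
Variables (F : fieldType) (L : closedFieldType) (i : {rmorphism F -> L}).
Variable bp : tangential_base_point F.
Hypothesis char0 : forall n, (0 < n)%N -> n%:R != 0 :> L.
Variables (P Q : {poly L}) (PQ : wronskian_pair P Q) (a0 : L) (Pa0 : root P a0).
Hypotheses (Pgal : forall s : absgal i, map_poly s P = P) (Qgal : forall s : absgal i, map_poly s Q = Q).
Let Pm : P \is monic. Proof. by case: PQ => [[]]. Qed.
Let Qm : Q \is monic. Proof. by case: PQ => [[]]. Qed.
Let PQ1 : (1 < size P)%N. Proof. by case: PQ. Qed.
Let PQcop : coprimep P Q. Proof. by case: PQ. Qed.
Let P0 : P != 0. Proof. exact: monic_neq0. Qed.

Local Notation Y0 := (belyi_cover i bp char0 PQ Pa0).
Local Notation I := (seq_sub (root_seq P)).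
Local Notation CX := (loc (crit_poly P Q)).
Implicit Types k : I.

Section OneTwist.
Variable r : absgal i.
Let s : absgal i := (r^-1)%g.

Fact gal_root_mem k : r (root_val k) \in root_seq P.
Proof. by rewrite mem_rts //; have := rt_root PQ k; rewrite -(fmorph_root r) Pgal. Qed.
Definition gal_root k : I := SeqSub (gal_root_mem k).
Lemma gal_rootE k : s (root_val (gal_root k)) = root_val k.
Proof. exact: (Defs.galK r (root_val k)). Qed.

Lemma rm_gal k : root_ram (gal_root k) = root_ram k.
Proof. by rewrite /root_ram -(gal_rootE k) (ram_map (Pgal s)). Qed.
Lemma ld_gal k : s (root_lead Q (gal_root k)) = root_lead Q k.
Proof. by rewrite /root_lead (lead_map (Pgal s) (Qgal s) P0) gal_rootE. Qed.
(** A conjugate of the normalized solution at one zero is a normalized solution at the conjugate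
    zero, so uniqueness identifies it with the chosen one. The same argument gives [eps_gal]. *)
Lemma nus_gal k : powser_map s (root_nu char0 PQ (gal_root k)) = root_nu char0 PQ k.
Proof.
apply: (solves_unique P0 (rt_root PQ k) (rt_Q PQ k) char0); last exact: nusP.
by rewrite -(gal_rootE k); apply: solves_map => //; exact: nusP.
Qed.
Lemma zs_gal k : powser_map s (root_series char0 PQ (gal_root k)) = root_series char0 PQ k.
Proof.
rewrite /root_series /expansion rmorphD rmorphM /= powser_map_const powser_map_pvar.
by rewrite nus_gal gal_rootE.
Qed.

Lemma tvec_gal : s (tvec i bp) = tvec i bp.
Proof. exact: gal_fix. Qed.
Lemma tser_gal : powser_map s (tser i bp) = tser i bp.
Proof.
have /= := tpar_coefK bp s; rewrite !tparF coefK_tofrac => /eqP.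
rewrite tofrac_eq rmorphM /= powser_map_pvar => /eqP.
by apply: mulfI; exact: pvar_neq0.
Qed.
Lemma eps_gal k : powser_map s (eps i bp char0 PQ (gal_root k)) = eps i bp char0 PQ k.
Proof.
have [e1 eE] := epsP i bp char0 PQ k; have [e1' eE'] := epsP i bp char0 PQ (gal_root k).
have e1s : cterm (powser_map s (eps i bp char0 PQ (gal_root k))) = 1.
  by rewrite cterm_powser_map e1' rmorph1.
have eEs : powser_map s (eps i bp char0 PQ (gal_root k)) ^+ root_ram k = eps_rhs i bp PQ k.
  rewrite -[in LHS](rm_gal k) -(rmorphXn (powser_map s)) eE' /eps_rhs (rmorphM (powser_map s)).
  congr (_ * _); first by rewrite [LHS]powser_map_const tvec_gal.
  rewrite -[in RHS]tser_gal; apply: powser_map_psub; [exact: ld_gal|exact: rm_gal].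
exact: (series_root_unique (rm_gt0 PQ k) (char0 (rm_gt0 PQ k)) (cterm_eps_rhs i bp PQ k) e1s e1 eEs eE).
Qed.

Lemma crit_gal : map_poly s (crit_poly P Q) = crit_poly P Q.
Proof. exact: crit_map. Qed.

Fact gal_X_subproof : (cX P Q \o map_poly s) (crit_poly P Q) * cXv P Q = 1.
Proof.
by rewrite -[X in X * _]/(cX P Q (map_poly s _)) crit_gal; exact: loc_invK (crit_poly_neq0 Pm Qm PQ1 PQcop).
Qed.
Definition gal_X : {rmorphism CX -> CX} := loc_lift gal_X_subproof.
Lemma gal_XE p : gal_X (cX P Q p) = cX P Q (map_poly s p).
Proof. exact: loc_lift_of. Qed.

Definition gal_G : {rmorphism cov_G Y0 -> cov_G Y0} :=
  dprod_map (i0 := base_index PQ Pa0) gal_root (fun=> coefG s).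
Definition gal_K : {rmorphism cov_K Y0 -> cov_K Y0} :=
  dprod_map (i0 := base_index PQ Pa0) gal_root (fun=> Defs.coefK s).

Fact gal_X_str : gal_X \o str_X Y0 =1 str_X (twist r Y0).
Proof.
apply: (P1_ext (f := gal_X \o sX PQ) (g := sX PQ \o Defs.coefX s)) => [a|].
  rewrite -[LHS]/(gal_X (sX PQ _)) -[RHS]/(sX PQ (Defs.coefX s _)) coefX_C.
  by rewrite /sX !str_cover_XC gal_XE map_polyC.
rewrite -[LHS]/(gal_X (sX PQ _)) -[RHS]/(sX PQ (Defs.coefX s _)) coefX_x.
have QK := cXqiK Pm Qm PQ1 PQcop.
have cancel u v : u * cX P Q Q = v * cX P Q Q -> u = v.
  move=> e; rewrite -[u]mulr1 -[v]mulr1 -QK.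
  move: (cX P Q Q) (cXqi P Q) e => q q' e.
  by rewrite [u * _]mulrA [v * _]mulrA e.
apply: cancel; rewrite [RHS](str_cover_XxQ Pm Qm PQ1 PQcop).
have QE : gal_X (cX P Q Q) = cX P Q Q by rewrite gal_XE Qgal.
rewrite -[X in _ * X]QE -(rmorphM gal_X) (str_cover_XxQ Pm Qm PQ1 PQcop).
by rewrite gal_XE Pgal.
Qed.

Fact gal_K_str : gal_K \o str_K Y0 =1 str_K (twist r Y0).
Proof.
move=> z; apply: dprodP => k; apply: coefK_ksub; [exact: ld_gal|exact: rm_gal].
Qed.

Fact gal_G_str : gal_G \o str_G Y0 =1 str_G (twist r Y0).
Proof.
move=> z; apply: dprodP => k.
rewrite -[LHS]/(coefG s (power_map _ (twist_neq0 i bp PQ (gal_root k)) z)).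
rewrite -[RHS]/(power_map _ (twist_neq0 i bp PQ k) (coefG s z)).
move: z; apply: (Gm_ext (f := coefG s \o power_map _ (twist_neq0 i bp PQ (gal_root k)))
  (g := power_map _ (twist_neq0 i bp PQ k) \o coefG s)) => [a|].
  rewrite -[LHS]/(coefG s (power_map _ _ _)) -[RHS]/(power_map _ _ (coefG s _)).
  by rewrite power_mapC !coefG_C power_mapC.
rewrite -[LHS]/(coefG s (power_map _ _ _)) -[RHS]/(power_map _ _ (coefG s _)).
rewrite coefG_t !power_mapX rmorphM rmorphXn coefG_C coefG_t rm_gal.
by rewrite fmorphV fmorph_div tvec_gal ld_gal.
Qed.

Fact gal_X_res : gal_K \o res_X Y0 =1 res_X (twist r Y0) \o gal_X.
Proof.
move=> x; apply: dprodP => k; move: x.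
apply: (cover_X_ext Pm Qm PQ1 PQcop (f := Defs.coefK s \o rX char0 PQ (gal_root k))
  (g := rX char0 PQ k \o gal_X)) => [a|].
  rewrite -[LHS]/(Defs.coefK s (rX _ _ _ _)) -[RHS]/(rX _ _ _ (gal_X _)) gal_XE map_polyC.
  by rewrite !rXE coefK_tofrac !sevC powser_map_const.
rewrite -[LHS]/(Defs.coefK s (rX _ _ _ _)) -[RHS]/(rX _ _ _ (gal_X _)) gal_XE map_polyX.
by rewrite !rXE coefK_tofrac !sevX zs_gal.
Qed.

Fact gal_G_res : gal_K \o res_G Y0 =1 res_G (twist r Y0) \o gal_G.
Proof.
move=> x; apply: dprodP => k.
rewrite -[LHS]/(Defs.coefK s (rG i bp char0 PQ (gal_root k) (dcomp x (gal_root k)))).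
rewrite -[RHS]/(rG i bp char0 PQ k (coefG s (dcomp x (gal_root k)))).
move: (dcomp x _) => {}x; move: x.
apply: (Gm_ext (f := Defs.coefK s \o rG i bp char0 PQ (gal_root k))
  (g := rG i bp char0 PQ k \o coefG s)) => [a|].
  rewrite -[LHS]/(Defs.coefK s (rG _ _ _ _ _ _)) -[RHS]/(rG _ _ _ _ _ (coefG s _)) coefG_C.
  by rewrite /rG !iotaG_C coefK_tofrac powser_map_const.
rewrite -[LHS]/(Defs.coefK s (rG _ _ _ _ _ _)) -[RHS]/(rG _ _ _ _ _ (coefG s _)) coefG_t.
by rewrite /rG !iotaG_t coefK_tofrac rmorphM /= powser_map_pvar eps_gal.
Qed.

(** The descent datum expressing that the cover, with its decomposition over the disc, is defined by
    Galois-invariant equations: branches are permuted by [r], and coefficients are transformed by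
    its inverse. *)
Definition gal_hom : fet_cover_hom Y0 (twist r Y0) :=
  @FetCoverHom _ _ _ _ Y0 (twist r Y0) gal_X gal_G gal_K gal_X_str gal_G_str gal_K_str gal_X_res gal_G_res.

Lemma gal_G_const : gal_G (root_const i bp char0 PQ Pa0) = root_const i bp char0 PQ Pa0.
Proof.
by apply: dprodP => k; rewrite -[LHS]/(coefG s (Gm_const L _)) coefG_C gal_rootE.
Qed.

End OneTwist.

Hypothesis a0_gal : forall s : absgal i, s a0 = a0.
Hypothesis a0_simple : ram P a0 = 1%N.
Local Notation j0 := (base_index PQ Pa0).

Fact base_point_pow : (tvec i bp / root_lead Q j0) ^+ root_ram j0 = tvec i bp / root_lead Q j0.
Proof. by rewrite [root_ram j0]a0_simple expr1. Qed.

(** At the simple zero [a0] the equation of the fiber is linear, and its solution v / k is fixed by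
    Galois, as [v], [P], [Q] and [a0] are. *)
Definition base_point : fiber_point Y0 :=
  root_point char0 PQ Pa0 (twist_neq0 i bp PQ j0) base_point_pow.

Lemma gal_root_base r : gal_root r j0 = j0.
Proof. by apply: val_inj; exact: a0_gal. Qed.

Lemma pull_base_point r : pull (gal_hom r) (twist_point r base_point) = base_point.
Proof.
apply: fiber_point_ext => z; pose s : absgal i := (r^-1)%g.
pose ev := Gm_eval (twist_neq0 i bp PQ j0).
rewrite -[LHS]/(r (ev (coefG s (dcomp z (gal_root r j0))))) -[RHS]/(ev (dcomp z j0)).
rewrite gal_root_base; move: (dcomp z j0) => {}z; move: z.
apply: (Gm_ext (f := r \o ev \o coefG s) (g := ev)) => [a|].
  rewrite -[LHS]/(r (ev (coefG s _))) coefG_C /ev !Gm_evalC.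
  exact: (Defs.galVK r a).
rewrite -[LHS]/(r (ev (coefG s _))) coefG_t /ev !Gm_evalt fmorph_div.
congr (_ / _); first exact: gal_fix.
have e := ld_gal r j0; rewrite gal_root_base in e.
by rewrite -[in LHS]e; exact: (Defs.galVK r).
Qed.

(** [pi1_act s g] evaluates [g] on the twisted cover. Naturality along [gal_hom] leads back to the
    cover itself; since the base point and [root_const] are invariant, all that remains of the twist
    is [s] applied to the value. *)
Lemma root_const_act (s : absgal i) (g : pi1 i bp) :
  pi1_act s g Y0 base_point (root_const i bp char0 PQ Pa0) =
  s (g Y0 base_point (root_const i bp char0 PQ Pa0)).
Proof.
pose r : absgal i := (s^-1)%g; pose q := g (twist r Y0) (twist_point r base_point).
have -> : g Y0 base_point = pull (gal_hom r) q by rewrite -pi1_nat pull_base_point.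
rewrite -[RHS]/(s (q (gal_G r _))) gal_G_const.
by rewrite -[LHS]/((r^-1)%g (q _)) invgK.
Qed.

Lemma belyi_function : exists alpha : pi1 i bp -> L,
  [/\ pi1_locally_constant alpha, forall b, root P b -> exists g, alpha g = b &
      forall s g, alpha (pi1_act s g) = s (alpha g)].
Proof.
exists (fun g : pi1 i bp => g Y0 base_point (root_const i bp char0 PQ Pa0)); split=> [g|b Pb|]; last exact: root_const_act.
  exists (fun h : pi1 i bp => h Y0 base_point = g Y0 base_point); split=> // [h hU|h -> //].
  by exists 1%N, (fun=> Y0) => h' H; rewrite -hU; exact: (H ord0).
have [p <-] := root_point_exists i bp char0 PQ Pa0 Pb.
have [g <-] := fiber_transitive base_point p (@belyi_cover_generic _ _ i bp char0 _ _ PQ _ Pa0).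
by exists g.
Qed.

End Descent.

(** * Belyi's construction *)

Lemma sum_sign_binomial (R : comPzRingType) n : (0 < n)%N ->
  \sum_(k < n.+1) (-1) ^+ k *+ 'C(n, k) = 0 :> R.
Proof.
move=> n0; have := exprBn (1 : R) 1 n; rewrite subrr expr0n eqn0Ngt n0 => e.
by rewrite [RHS]e; apply: eq_bigr => k _; rewrite !expr1n !mulr1.
Qed.

(** The sum is, up to sign, the n-th finite difference of 1 / y. Pascal's rule gives the recursion
    f_(n+1)(y) = f_n(y) - f_n(y - 1) on which the induction runs. The point of the formula is that
    the sum, a logarithmic derivative in [belyi_wronskian_root], never vanishes. *)
Lemma binomial_partial_fraction (K : fieldType) n (y : K) :
    (forall k, (k <= n)%N -> y - k%:R != 0) ->
  (\sum_(k < n.+1) (-1) ^+ k *+ 'C(n, k) / (y - k%:R)) * \prod_(k < n.+1) (y - k%:R) =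
    (-1) ^+ n * n`!%:R.
Proof.
elim: n y => [|n IHn] y y0.
  by rewrite !big_ord1 fact0 expr0 mulr1 mul1r mulVf // y0.
have y1 k : (k <= n)%N -> y - 1 - k%:R != 0.
  by move=> kn; rewrite -addrA -opprD nat1r y0.
have := IHn (y - 1) y1; have := IHn y (fun k kn => y0 k (leqW kn)).
set f0 := \sum_(k < n.+1) _; set g0 := \prod_(k < n.+1) _.
set f1 := \sum_(k < n.+1) _; set g1 := \prod_(k < n.+1) _ => e0 e1.
have -> : \sum_(k < n.+2) (-1) ^+ k *+ 'C(n.+1, k) / (y - k%:R) = f0 - f1.
  rewrite big_ord_recl [f0]big_ord_recl -addrA; congr (_ + _).
    by rewrite !bin0.
  under eq_bigr => k _ do rewrite binS mulrnDr mulrDl.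
  rewrite big_split /= big_ord_recr /= bin_small // mulr0n mul0r addr0; congr (_ + _).
  rewrite /f1 -sumrN; apply: eq_bigr => k _; rewrite -mulNr /bump /= add1n exprS mulN1r mulNrn.
  by rewrite -addrA -opprD nat1r.
have gE : \prod_(k < n.+2) (y - k%:R) = y * g1.
  rewrite big_ord_recl subr0; congr (_ * _); apply: eq_bigr => k _.
  by rewrite -addrA -opprD nat1r.
have gE' : y * g1 = g0 * (y - n.+1%:R) by rewrite -gE big_ord_recr.
rewrite gE mulrBl [in X in X - _]gE' mulrA e0 [f1 * _]mulrCA e1 exprS factS natrM.
by rewrite -[n.+1%:R]natr1; ring.
Qed.

Lemma log_deriv_prod (K : fieldType) (I : Type) (r : seq I) (a : I -> {poly K}) (p : I -> nat) z :
    (forall k, (a k).[z] != 0) ->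
  (\prod_(k <- r) a k ^+ p k)^`().[z] =
    (\prod_(k <- r) a k ^+ p k).[z] * \sum_(k <- r) (p k)%:R * ((a k)^`().[z] / (a k).[z]).
Proof.
move=> a0; elim: r => [|k r IHr]; first by rewrite !big_nil mulr0 derivC hornerC.
rewrite !big_cons derivM hornerD !hornerM IHr mulrDr; congr (_ + _); last by ring.
rewrite deriv_exp hornerMn hornerM !horner_exp -mulr_natl.
case: (p k) => [|m] /=; first by rewrite !mul0r mulr0.
rewrite [in RHS]exprS; move: (a k)^`().[z] ((a k).[z] ^+ m) (a k).[z] (a0 k) => x t w w0.
move: (\prod_(_ <- _) _).[z] => q.
by field.
Qed.

Section BelyiPair.
Variables (L : closedFieldType) (y : {poly L}) (n : nat).
Hypothesis char0 : forall n, (0 < n)%N -> n%:R != 0 :> L.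
Hypotheses (n0 : (0 < n)%N) (y1 : (1 < size y)%N).
Hypothesis crit : forall z, root y^`() z ->
  exists j, [/\ (j <= n)%N, ~~ odd j & y.[z] = j%:R].

Let natr_inj j k : j%:R = k%:R :> L -> j = k.
Proof.
have H a b : (a < b)%N -> a%:R = b%:R :> L -> False.
  move=> ab e; have := char0 (_ : 0 < b - a)%N; rewrite subn_gt0 => /(_ ab).
  by rewrite natrB ?(ltnW ab) // e subrr eqxx.
by case: (ltngtP j k) => // [/H|/H {}H /esym].
Qed.

Definition belyi_factor (k : nat) : {poly L} := (lead_coef y)^-1 *: (y - k%:R%:P).
(** The quotient of the even side by the odd side is the product of the (y - k)^((-1)^k 'C(n, k)),
    made of monic factors. The alternating sum of binomials is 0, so both sides have the same
    degree. The logarithmic derivative is a nonzero constant times y' / prod (y - k); any critical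
    point off the zeros and poles would be one of y, but there y takes an even value at most n,
    which makes it a zero. *)
Definition belyi_side (b : bool) : {poly L} :=
  \prod_(k < n.+1) belyi_factor k ^+ (if odd k == b then 'C(n, k) else 0%N).

Let l0 : lead_coef y != 0.
Proof. by rewrite lead_coef_eq0 -size_poly_eq0; case: size y1. Qed.

Lemma belyi_factor_size k : size (belyi_factor k) = size y.
Proof. by rewrite size_scale ?invr_neq0 // size_polyDl // size_polyN (leq_ltn_trans (size_polyC_leq1 _)). Qed.
Lemma belyi_factor_monic k : belyi_factor k \is monic.
Proof.
rewrite monicE lead_coefZ lead_coefDl ?mulVf //.
by rewrite size_polyN (leq_ltn_trans (size_polyC_leq1 _)).
Qed.
Lemma belyi_factorE k z : (belyi_factor k).[z] = (lead_coef y)^-1 * (y.[z] - k%:R).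
Proof. by rewrite hornerZ hornerD hornerN hornerC. Qed.
Lemma belyi_factor_root k z : root (belyi_factor k) z = (y.[z] == k%:R).
Proof. by rewrite rootE belyi_factorE mulf_eq0 invr_eq0 (negPf l0) subr_eq0. Qed.

Lemma belyi_side_monic b : belyi_side b \is monic.
Proof. by apply: monic_prod => k _; apply: monic_exp; exact: belyi_factor_monic. Qed.

Lemma belyi_side_root b z : root (belyi_side b) z <->
  exists k, [/\ (k <= n)%N, odd k == b & y.[z] = k%:R].
Proof.
rewrite rootE /belyi_side horner_prod; split=> [/prodf_eq0[k _]|[k [kn kb yk]]].
  rewrite horner_exp expf_eq0 => /andP[]; case: ifP => // kb _.
  by rewrite -[_ == 0]/(root _ _) belyi_factor_root => /eqP; exists k; split=> //; rewrite -ltnS.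
apply/prodf_eq0; exists (Ordinal (kn : (k < n.+1)%N)) => //=.
rewrite kb horner_exp expf_eq0 bin_gt0 kn -[_ == 0]/(root _ _) belyi_factor_root yk eqxx.
by [].
Qed.

Lemma belyi_side_deg b : (size (belyi_side b)).-1 =
  ((size y).-1 * \sum_(k < n.+1 | odd k == b) 'C(n, k))%N.
Proof.
rewrite [in RHS]big_mkcond /belyi_side.
elim: (index_enum _) => [|k r IHr]; first by rewrite !big_nil size_poly1 muln0.
rewrite !big_cons mulnDr -IHr size_monicM ?monic_neq0 //; last 2 first.
- by apply: monic_exp; exact: belyi_factor_monic.
- by apply: monic_prod => j _; apply: monic_exp; exact: belyi_factor_monic.
rewrite -{1}(belyi_factor_size k) -size_exp.
have : belyi_factor k ^+ (if odd k == b then 'C(n, k) else 0%N) != 0.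
  by rewrite monic_neq0 // monic_exp // belyi_factor_monic.
have : \prod_(j <- r) belyi_factor j ^+ (if odd j == b then 'C(n, j) else 0%N) != 0.
  by rewrite monic_neq0 // monic_prod // => j _; rewrite monic_exp // belyi_factor_monic.
by rewrite -!size_poly_gt0; case: size => // s _; case: size => //= t _; rewrite addnS.
Qed.

Lemma belyi_side_size : size (belyi_side true) = size (belyi_side false).
Proof.
have s0 b : size (belyi_side b) = (size (belyi_side b)).-1.+1.
  by rewrite prednK // size_poly_gt0 monic_neq0 // belyi_side_monic.
rewrite (s0 true) (s0 false) !belyi_side_deg; congr (_ * _).+1.
apply/eqP; rewrite -(@Num.Theory.eqr_nat int) !natr_sum -subr_eq0 -oppr_eq0 opprB addrC -[X in _ == X](sum_sign_binomial int n0).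
rewrite [X in _ == X](bigID (fun k : 'I_n.+1 => odd k == true)) /= -sumrN.
apply/eqP; congr (_ + _); apply: eq_big => [k|k]; rewrite ?eqb_id ?eqbF_neg //.
  by move=> ko; rewrite -signr_odd ko expr1 mulNrn.
by move=> ko; rewrite -signr_odd (negPf ko) expr0.
Qed.

Lemma belyi_side_coprime : coprimep (belyi_side false) (belyi_side true).
Proof.
apply: Pdiv.ClosedField.root_coprimep => z /belyi_side_root[k [_ ke yk]].
rewrite -[_ == 0]/(root _ _); apply/negP => /belyi_side_root[l [_ lo yl]].
by move: lo; rewrite (natr_inj (etrans (esym yl) yk)) (eqP ke).
Qed.

Let P := belyi_side false.
Let Q := belyi_side true.

Lemma belyi_wronskian_root z : root (P^`() * Q - P * Q^`()) z -> root (P * Q) z.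
Proof.
move=> Wz; apply: contraT; rewrite rootM negb_or => /andP[Pz Qz].
have yk k : (k <= n)%N -> y.[z] - k%:R != 0.
  move=> kn; rewrite subr_eq0; apply/negP => /eqP yz.
  case ko: (odd k); [move/negP: Qz|move/negP: Pz]; apply; apply/belyi_side_root; exists k; split=> //; by rewrite ko.
pose a (k : 'I_n.+1) := belyi_factor k.
have a0 (k : 'I_n.+1) : (a k).[z] != 0.
  by rewrite belyi_factorE mulf_neq0 ?invr_neq0 // yk // -ltnS.
have aE (k : 'I_n.+1) : (a k)^`().[z] / (a k).[z] = y^`().[z] / (y.[z] - k%:R).
  rewrite belyi_factorE /a /belyi_factor derivZ derivB derivC subr0 hornerZ.
  by field; rewrite l0 yk // -ltnS.
have y'z : y^`().[z] != 0.
  apply/negP => /crit[j [jn je yj]]; move/negP: Pz; apply; apply/belyi_side_root.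
  by exists j; split=> //; rewrite (negPf je).
pose S b := \sum_(k < n.+1) (if odd k == b then 'C(n, k) else 0%N)%:R * ((a k)^`().[z] / (a k).[z]).
have dE b : (belyi_side b)^`().[z] = (belyi_side b).[z] * S b.
  exact: (log_deriv_prod _ _ a0).
move: Wz; rewrite rootE hornerD hornerN !hornerM !dE.
have -> : P.[z] * S false * Q.[z] - P.[z] * (Q.[z] * S true) = P.[z] * Q.[z] * (S false - S true) by ring.
rewrite !mulf_eq0 -![_.[z] == 0]/(root _ _) (negPf Pz) (negPf Qz) /= /S -sumrB.
have -> : \sum_(k < n.+1) ((if odd k == false then 'C(n, k) else 0%N)%:R * ((a k)^`().[z] / (a k).[z]) -
    (if odd k == true then 'C(n, k) else 0%N)%:R * ((a k)^`().[z] / (a k).[z])) =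
    y^`().[z] * \sum_(k < n.+1) (-1) ^+ k *+ 'C(n, k) / (y.[z] - k%:R).
  rewrite mulr_sumr; apply: eq_bigr => k _; rewrite aE -mulrBl.
  have -> : (if odd k == false then 'C(n, k) else 0%N)%:R - (if odd k == true then 'C(n, k) else 0%N)%:R =
      (-1) ^+ k *+ 'C(n, k) :> L.
    by rewrite -signr_odd; case: (odd k) => /=; rewrite ?expr0 ?expr1 ?mulNrn ?subr0 ?sub0r.
  by rewrite mulrCA.
rewrite mulf_eq0 (negPf y'z) /=; have := binomial_partial_fraction yk.
move=> e /eqP s0; move: e; rewrite s0 mul0r => /esym/eqP; rewrite mulf_eq0 signr_eq0 /=.
by rewrite (negPf (char0 (fact_gt0 n))).
Qed.

Lemma dvdp_exp_of_roots (p q : {poly L}) : p != 0 -> (forall z, root p z -> root q z) ->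
  exists m, p %| q ^+ m.
Proof.
move=> p0 pq; have [s sE] := closed_field_poly_normal p; exists (size s).
rewrite sE dvdpZl ?lead_coef_eq0 //.
have {}pq z : z \in s -> root q z.
  by move=> zs; apply: pq; rewrite sE rootZ ?lead_coef_eq0 // root_prod_XsubC.
elim: s {sE} pq => [|z s IHs] pq; first by rewrite big_nil dvd1p.
rewrite big_cons exprS; apply: dvdp_mul.
  by rewrite dvdp_XsubCl pq // mem_head.
by apply: IHs => x xs; apply: pq; rewrite inE xs orbT.
Qed.

Lemma belyi_size : (1 < size P)%N.
Proof.
have : (0 < (size P).-1)%N; last by rewrite -ltnS; case: size.
rewrite belyi_side_deg muln_gt0 -ltnS prednK ?(ltnW y1) // y1.
by rewrite (bigD1 (ord0 : 'I_n.+1)) //= bin0.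
Qed.

Lemma belyi_wronskian : exists R m, (P^`() * Q - P * Q^`()) * R = (P * Q) ^+ m.
Proof.
have [|m /dvdpP[R RE]] := @dvdp_exp_of_roots (P^`() * Q - P * Q^`()) (P * Q) _ belyi_wronskian_root; last first.
  by exists R, m; rewrite RE mulrC.
apply/negP => /eqP W0.
have PQ0 : P * Q != 0 by rewrite mulf_neq0 // monic_neq0 // belyi_side_monic.
(* The Wronskian is not identically 0: otherwise every element of [L] would be a root of P Q, while
   the natural numbers already give too many distinct elements. *)
have [z] : exists z : L, ~~ root (P * Q) z.
  apply: contrapT => none; have := max_poly_roots PQ0 (rs := [seq k%:R | k <- iota 0 (size (P * Q))]).
  rewrite size_map size_iota ltnn => H; apply: notF; apply: H.
    by apply/allP => z _; apply/negPn/negP => nz; apply: none; exists z.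
  by rewrite map_inj_uniq ?iota_uniq // => j k; exact: natr_inj.
by rewrite belyi_wronskian_root // W0 root0.
Qed.

Lemma belyi_wronskian_pair : wronskian_pair P Q.
Proof.
split; [split|exact: belyi_size|exact: belyi_side_coprime|exact: belyi_wronskian].
- exact: belyi_side_monic.
- exact: belyi_side_monic.
- exact: belyi_side_size.
Qed.

(** Among the even factors only the one with k = 0 vanishes at [z], and its exponent is 'C(n, 0) =
    1. *)
Lemma belyi_side_simple z : y.[z] = 0 -> y^`().[z] != 0 -> ram P z = 1%N.
Proof.
move=> yz y'z; rewrite /P /belyi_side (bigD1 (ord0 : 'I_n.+1)) //= bin0 expr1 /ram.
rewrite mupMl.
  have f0 := monic_neq0 (belyi_factor_monic 0).
  have m1 : (0 < mup z (belyi_factor 0))%N by rewrite -XsubC_dvd // dvdp_XsubCl belyi_factor_root yz.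
  apply/eqP; rewrite eqn_leq m1 andbT leqNgt mup_geq //; apply/negP => /dvdpP[q qE].
  have : (belyi_factor 0)^`().[z] = 0.
    by rewrite qE expr2 mulrA derivM derivXsubC mulr1 hornerD !hornerM hornerXsubC subrr !mulr0 addr0.
  apply/eqP; rewrite /belyi_factor derivZ derivB derivC subr0 hornerZ mulf_neq0 ?invr_neq0 //.
rewrite rootE horner_prod; apply/prodf_neq0 => k k0.
rewrite horner_exp expf_neq0 // -[_ == 0]/(root _ _) belyi_factor_root yz.
by rewrite eq_sym char0 // lt0n.
Qed.

Lemma belyi_side_map (s : {rmorphism L -> L}) b :
  map_poly s y = y -> map_poly s (belyi_side b) = belyi_side b.
Proof.
move=> sy; have ls : s (lead_coef y) = lead_coef y by rewrite -lead_coef_map sy.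
rewrite rmorph_prod; apply: eq_bigr => k _; rewrite rmorphXn; congr (_ ^+ _).
rewrite /belyi_factor /= map_polyZ rmorphB /= sy map_polyC /= rmorph_nat fmorphV.
by rewrite ls.
Qed.

End BelyiPair.

(** * Polynomials with rational, then even integral, critical values *)

Import Order.TTheory Num.Theory.

Lemma poly_unbounded (p : {poly rat}) : (1 < size p)%N -> 0 < lead_coef p ->
  forall b, exists N, forall x, N <= x -> b <= p.[x].
Proof.
elim/poly_ind: p => [|q c IHq]; first by rewrite size_poly0.
have [->|q0] := eqVneq q 0.
  by rewrite mul0r add0r size_polyC ltnNge leq_b1.
have sc : (size (c%:P : {poly rat}) < size (q * 'X)%R)%N.
  by rewrite size_mulX // (leq_ltn_trans (size_polyC_leq1 _)) // ltnS size_poly_gt0.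
rewrite lead_coefDl // lead_coefMX => _ lq b.
have [eps [M [eps0 qM]]] : exists eps M, 0 < eps /\ forall x, M <= x -> eps <= q.[x].
  have [q1|q1] := leqP (size q) 1.
    exists (lead_coef q), 0; split=> // x _.
    by have /size_poly1P[a _ ->] : size q == 1%N; [rewrite eqn_leq q1 size_poly_gt0|rewrite lead_coefC hornerC].
  by have [M qM] := IHq q1 lq 1; exists 1, M.
exists (Num.max M (Num.max 0 ((b - c) / eps))) => x; rewrite !ge_max => /and3P[Mx x0 bx].
rewrite hornerD hornerM hornerX hornerC -lerBlDr (le_trans _ (ler_wpM2r x0 (qM x Mx))) //.
by rewrite mulrC -ler_pdivrMr.
Qed.

Lemma common_even_multiple (V : seq rat) : (forall v, v \in V -> 0 < v) ->
  exists c n : nat, [/\ (0 < c)%N, (0 < n)%N & forall v, v \in V ->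
    exists j, [/\ (j <= n)%N, ~~ odd j & c%:R * v = j%:R]].
Proof.
elim: V => [|w V IHV] pos; first by exists 1%N, 1%N.
have [|c [n [c0 n0 cn]]] := IHV; first by move=> v vV; apply: pos; rewrite inE vV orbT.
have w0 := pos w (mem_head _ _).
pose a := `|numq w|%N; pose d := `|denq w|%N.
have aE : a%:R = (numq w)%:~R :> rat by rewrite pmulrn gez0_abs // numq_ge0 ltW.
have dE : d%:R = (denq w)%:~R :> rat by rewrite pmulrn gez0_abs // ltW // denq_gt0.
have dw : d%:R * w = a%:R by rewrite aE dE numqE mulrC.
exists ((2 * c) * d)%N, ((2 * d) * n + (2 * c) * a)%N; split=> [||v].
- by rewrite !muln_gt0 c0 absz_gt0 denq_neq0.
- by rewrite addn_gt0 !muln_gt0 n0 absz_gt0 denq_neq0.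
rewrite inE => /predU1P[->|/cn[j [jn je jE]]].
  exists ((2 * c) * a)%N; split; first exact: leq_addl.
    by rewrite -mulnA mul2n odd_double.
  by rewrite !natrM -mulrA dw.
exists ((2 * d) * j)%N; split; last first.
  - by rewrite !natrM -jE; ring.
  - by rewrite -mulnA mul2n odd_double.
  - by apply: leq_trans (leq_addr _ _); rewrite leq_mul2l jn orbT.
Qed.

(** The powers m^k for k < size d are linearly dependent in Q[X] / (d), whose dimension is size d -
    1. With d the derivative of m, the polynomial r kills the critical values of m and has smaller
    degree than m. *)
Lemma polynomial_relation (m d : {poly rat}) : d != 0 ->
  exists r : {poly rat}, [/\ r != 0, (size r <= size d)%N & d %| r \Po m].
Proof.
move=> d0; pose s := size d.
pose A : 'M[rat]_(s, s.-1) := \matrix_(k < s) poly_rV (m ^+ k %% d).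
have s0 : (0 < s)%N by rewrite size_poly_gt0.
have : kermx A != 0.
  rewrite kermx_eq0 /row_free; apply: contraTneq (rank_leq_col A) => ->.
  by rewrite -ltnNge prednK.
case/rowV0Pn => v /sub_kermxP vA v0; exists (rVpoly v); split.
- by apply: contra_neq v0 => e; rewrite -[v]rVpolyK e linear0.
- exact: size_poly.
pose R := \sum_(k < s) v 0 k *: (m ^+ k %% d).
have R0 : R = 0.
  have sR : (size R <= s.-1)%N.
    apply: (big_ind (fun p : {poly rat} => size p <= s.-1)%N) => [|p q sp sq|k _].
    - by rewrite size_poly0.
    - by rewrite (leq_trans (size_polyD _ _)) // geq_max sp sq.
    by rewrite (leq_trans (size_scale_leq _ _)) // -ltnS prednK // ltn_modpN0.
  rewrite -(poly_rV_K sR); suff -> : poly_rV R = v *m A by rewrite vA linear0.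
  rewrite /R linear_sum mulmx_sum_row; apply: eq_bigr => k _.
  by rewrite linearZ rowK.
have -> : rVpoly v \Po m = \sum_(k < s) v 0 k *: (m ^+ k - m ^+ k %% d).
  transitivity (\sum_(k < s) v 0 k *: m ^+ k).
    rewrite comp_polyE (big_ord_widen s (fun k => (rVpoly v)`_k *: m ^+ k)) ?size_poly // big_mkcond.
    apply: eq_bigr => k _; rewrite coef_rVpoly_ord; case: ltnP => // le.
    by rewrite -(coef_rVpoly_ord v k) nth_default ?scale0r.
  by under [RHS]eq_bigr do rewrite scalerBr; rewrite sumrB -/R R0 subr0.
apply: (big_ind (fun p => d %| p)) => [|p q dp dq|k _]; [exact: dvdp0|exact: dvdp_add|].
by rewrite -mul_polyC dvdp_mull // {1}(divp_eq (m ^+ k) d) addrK dvdp_mulIr.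
Qed.

Section RationalCriticalValues.
Variables (L : fieldType) (e : {rmorphism rat -> L}).
Local Notation "p ^e" := (map_poly e p) (at level 2, format "p ^e").
Definition rational_at (h : {poly rat}) z := exists a, h^e.[z] = e a.

(** First half of Belyi's argument, by induction on the degree: [m] sends its own roots to 0 and its
    critical points to roots of [r], of smaller degree. If [h] treats [r], then h o m treats [m],
    its critical points being those of [m] and the preimages of those of [h]. *)
Lemma rational_critical_values (m : {poly rat}) : m != 0 ->
  exists h : {poly rat}, [/\ (1 < size h)%N,
    forall z, root m^e z -> rational_at h z & forall z, root (h^`())^e z -> rational_at h z].
Proof.
have [n le] := ubnP (size m); elim: n m le => // n IHn m le m0.
have [m2|m2] := leqP (size m) 2.
  exists 'X; split=> [||z]; first by rewrite size_polyX.
    move=> z rz; rewrite /rational_at map_polyX hornerX.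
    have [m1|m1] := leqP (size m) 1.
      have /size_poly1P[a a0 mE] : size m == 1%N by rewrite eqn_leq m1 size_poly_gt0.
      by move: rz; rewrite mE map_polyC rootC fmorph_eq0 (negPf a0).
    have sm : size m = 2 by apply/eqP; rewrite eqn_leq m2.
    exists (- m`_0 / m`_1); have m10 : m`_1 != 0 by move: m0; rewrite -lead_coef_eq0 lead_coefE sm.
    move: rz; rewrite rootE horner_coef size_map_poly sm !big_ord_recr big_ord0 /= !coef_map /=.
    rewrite add0r mulr1 addrC addr_eq0 => /eqP ez.
    by rewrite fmorph_div rmorphN -ez mulrAC divff ?mul1r // fmorph_eq0.
  by rewrite derivX rmorph1 rootC oner_eq0.
have m'0 : m^`() != 0.
  have [k sm] : exists k, size m = k.+3 by case: (size m) m2 => [|[|[|k]]] // _; exists k.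
  have mk : m`_k.+2 != 0 by move: m0; rewrite -lead_coef_eq0 lead_coefE sm.
  by apply/eqP => /polyP/(_ k.+1)/eqP; rewrite coef_deriv coef0 mulrn_eq0 (negPf mk).
have [r [r0 sr dr]] := polynomial_relation m m'0.
have [|h [h1 hr hc]] := IHn r _ r0.
  by rewrite (leq_ltn_trans sr) // (leq_trans (lt_size_deriv m0)) // -ltnS.
have hE z : (h \Po m)^e.[z] = h^e.[m^e.[z]] by rewrite map_comp_poly horner_comp.
exists (h \Po m); split=> [|z rz|z].
- have := size_comp_poly h m; case: (size (h \Po m)) => [|[|k]] //= /esym/eqP.
  + by rewrite muln_eq0 -!subn1 !subn_eq0 leqNgt h1 leqNgt (ltnW m2).
  + by rewrite muln_eq0 -!subn1 !subn_eq0 leqNgt h1 leqNgt (ltnW m2).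
- by exists h.[0]; rewrite hE (eqP rz) -{1}(rmorph0 e) horner_map.
rewrite deriv_comp rmorphM /= rootM => /orP[cz|mz].
  have [|a aE] := hc m^e.[z]; first by move: cz; rewrite map_comp_poly /root horner_comp.
  by exists a; rewrite hE.
have [|a aE] := hr m^e.[z]; last by exists a; rewrite hE.
have : root (r \Po m)^e z.
  by move: dr => /dvdpP[q ->]; rewrite rmorphM /= rootM mz orbT.
by rewrite map_comp_poly /root horner_comp.
Qed.

End RationalCriticalValues.

Section Belyi.
Variables (L : closedFieldType) (e : {rmorphism rat -> L}).
Local Notation "p ^e" := (map_poly e p) (at level 2, format "p ^e").

Lemma even_at_critical (m : {poly rat}) : m != 0 ->
  exists (y : {poly rat}) (z0 : rat) (n : nat),
  [/\ (1 < size y)%N, (0 < n)%N, y.[z0] = 0, (y^`()).[z0] != 0 &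
      forall z, root m^e z || root (y^`())^e z ->
        exists j, [/\ (j <= n)%N, ~~ odd j & y^e.[z] = j%:R]].
Proof.
move=> m0; have [h [h1 hm hc]] := rational_critical_values e m0.
wlog lh : h h1 hm hc / 0 < lead_coef h => [H|].
  have h0 : lead_coef h != 0 by rewrite lead_coef_eq0 -size_poly_gt0 (ltnW h1).
  have [lt|gt] := ltP 0 (lead_coef h); first exact: (H h).
  apply: (H (- h)); rewrite ?size_polyN ?lead_coefN ?oppr_gt0 ?lt_neqAle ?h0 //.
    by move=> z /hm[a aE]; exists (- a); rewrite !rmorphN hornerN aE.
  move=> z; rewrite derivN rmorphN rootN => /hc[a aE].
  by exists (- a); rewrite !rmorphN hornerN aE.
have h'0 : h^`() != 0.
  apply/eqP => h'0; have [k sh] : exists k, size h = k.+2 by case: (size h) h1 => [|[|k]] // _; exists k.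
  have hk : h`_k.+1 != 0.
    by rewrite -[k.+1]/(k.+2.-1) -sh -lead_coefE lead_coef_eq0 -size_poly_gt0 (ltnW h1).
  by have /eqP := congr1 (fun p : {poly rat} => p`_k) h'0; rewrite coef_deriv coef0 mulrn_eq0 (negPf hk).
have mh0 : (m * h^`())^e != 0 by rewrite map_poly_eq0 mulf_neq0.
have [s sE] := closed_field_poly_normal (m * h^`())^e.
have mem_s z : (z \in s) = root m^e z || root (h^`())^e z.
  by rewrite -rootM -rmorphM /= sE rootZ ?lead_coef_eq0 // root_prod_XsubC.
have val z : exists a, z \in s -> h^e.[z] = e a.
  case zs: (z \in s); last by exists 0.
  by move: zs; rewrite mem_s => /orP[/hm|/hc] [a aE]; exists a.
pose v z := sval (cid (val z)).
have vE z : z \in s -> h^e.[z] = e (v z) by exact: (svalP (cid (val z))).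
(* [N] is taken so large that h(N) exceeds h at all roots of [m] and all critical points of h. Then
   y = c (h(N) - h) vanishes at [N], which is not critical, and is positive at those points; the
   factor [c] turns its values there into even integers. *)
have [N hN] := poly_unbounded h1 lh (1 + \sum_(z <- s) `|v z|).
have z0N := hN N (lexx N).
have pos w : w \in [seq h.[N] - v z | z <- s] -> 0 < w.
  case/mapP => z zs ->; rewrite subr_gt0 (lt_le_trans _ z0N) // ltr_pwDl // (le_trans (ler_norm _)) //.
  by rewrite (big_rem z) //= lerDl sumr_ge0.
have [c [n [c0 n0 cn]]] := common_even_multiple pos.
have cR : c%:R != 0 :> rat by rewrite pnatr_eq0 -lt0n.
pose y := c%:R *: (h.[N]%:P - h).
have y' : y^`() = - (c%:R *: h^`()) by rewrite /y derivZ derivB derivC sub0r scalerN.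
have yE z : z \in s -> exists j, [/\ (j <= n)%N, ~~ odd j & y^e.[z] = j%:R].
  move=> zs; have [|j [jn je jE]] := cn (h.[N] - v z); first by apply/mapP; exists z.
  exists j; split=> //.
  rewrite map_polyZ rmorphB /= map_polyC hornerZ hornerD hornerN hornerC vE //.
  by rewrite -rmorphB -rmorphM jE rmorph_nat.
exists y, N, n; split=> [||||z] //.
- rewrite size_scale // addrC size_polyDl size_polyN //.
  by rewrite (leq_ltn_trans (size_polyC_leq1 _)).
- by rewrite hornerZ hornerD hornerN hornerC subrr mulr0.
- rewrite y' hornerN hornerZ oppr_eq0 mulf_neq0 //; apply/negP => hz.
  have zs : e N \in s by rewrite mem_s {2}/root horner_map fmorph_eq0 hz orbT.
  have vN : h.[N] = v (e N) by apply: (fmorph_inj e); rewrite -vE // horner_map.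
  have : 0 < h.[N] - v (e N) by apply: pos; apply/mapP; exists (e N).
  by rewrite -vN subrr ltxx.
rewrite y' rmorphN rootN /= map_polyZ rootZ ?fmorph_eq0 // => zP.
by apply: yE; rewrite mem_s.
Qed.

End Belyi.

Lemma equivariant_function (F : fieldType) (L : closedFieldType) (i : {rmorphism F -> L})
    (bp : tangential_base_point F) (e : {rmorphism rat -> L}) (m : {poly rat}) :
    (forall (s : absgal i) a, s (e a) = e a) -> m != 0 ->
  exists alpha : pi1 i bp -> L,
  [/\ pi1_locally_constant alpha, forall b, root (map_poly e m) b -> exists g, alpha g = b &
      forall s g, alpha (pi1_act s g) = s (alpha g)].
Proof.
move=> egal m0; have [y [z0 [n [y1 n0 yz0 y'z0 crit]]]] := even_at_critical e m0.
have char0 k : (0 < k)%N -> k%:R != 0 :> L.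
  by move=> k0; rewrite -(rmorph_nat e) fmorph_eq0 pnatr_eq0 -lt0n.
pose ye := map_poly e y.
have ye1 : (1 < size ye)%N by rewrite size_map_poly.
have yecrit z : root ye^`() z -> exists j, [/\ (j <= n)%N, ~~ odd j & ye.[z] = j%:R].
  by rewrite deriv_map => rz; apply: crit; rewrite rz orbT.
have PQ := belyi_wronskian_pair char0 n0 ye1 yecrit.
have yegal (s : absgal i) : map_poly s ye = ye.
  by rewrite -map_poly_comp; apply: eq_map_poly => a; exact: egal.
have z0E : ye.[e z0] = 0 by rewrite horner_map yz0 rmorph0.
have root0 : root (belyi_side ye n false) (e z0).
  by apply/(belyi_side_root n ye1); exists 0%N.
have y'e : ye^`().[e z0] != 0 by rewrite deriv_map horner_map fmorph_eq0.
have [alpha [aloc asurj aact]] := belyi_function bp char0 PQ root0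
  (fun s => belyi_side_map n false (yegal s)) (fun s => belyi_side_map n true (yegal s))
  (fun s => egal s z0) (belyi_side_simple n char0 ye1 z0E y'e).
exists alpha; split=> // b bm; apply: asurj; apply/(belyi_side_root n ye1).
by have [|j [jn je jE]] := crit b; [rewrite bm|exists j; split=> //; rewrite (negPf je)].
Qed.

(** * Representations with finite image *)

Lemma avoid_finite (L : fieldType) (e : {rmorphism rat -> L}) (s : seq L) :
  exists c : nat, c%:R \notin s.
Proof.
apply: contrapT => none; have : (size [seq (k%:R : L) | k <- iota 0 (size s).+1] <= size s)%N.
  apply: uniq_leq_size => [|x /mapP[k _ ->]].
    rewrite map_inj_uniq ?iota_uniq // => j k; rewrite -!(rmorph_nat e) => /fmorph_inj/eqP.
    by rewrite Num.Theory.eqr_nat => /eqP.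
  by apply/negPn/negP => nk; apply: none; exists k.
by rewrite size_map size_iota ltnn.
Qed.

Section Galois.
Variables (F : fieldType) (L : closedFieldType) (i : {rmorphism F -> L}) (e : {rmorphism rat -> L}).
Hypothesis alg : integralRange i.
Hypothesis e_gal : forall (s : absgal i) a, s (e a) = e a.

Let nat_gal (s : absgal i) k : s k%:R = k%:R.
Proof. exact: rmorph_nat. Qed.

Lemma conj_root (s : absgal i) p x : root (map_poly i p) x -> root (map_poly i p) (s x).
Proof.
have sp : map_poly s (map_poly i p) = map_poly i p.
  by rewrite -map_poly_comp; apply: eq_map_poly => a; exact: gal_fix.
by move=> px; rewrite -sp fmorph_root.
Qed.

Lemma conjugates_finite x : exists t : seq L, forall s : absgal i, s x \in t.
Proof.
have [p pm px] := alg x; have [t tE] := closed_field_poly_normal (map_poly i p).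
exists t => s; have := conj_root s px; rewrite {1}tE rootZ ?root_prod_XsubC //.
by rewrite lead_coef_eq0 map_poly_eq0 monic_neq0.
Qed.

Lemma primitive_element (X : seq L) :
  exists b, forall s : absgal i, s b = b -> {in X, s =1 id}.
Proof.
elim: X => [|x X [b bX]]; first by exists 0.
have [tx xP] := conjugates_finite x; have [tb bP] := conjugates_finite b.
(* As in the primitive element theorem: if s fixed x + c b without fixing b, then c would be the
   quotient (s x - x) / (b - s b), one of finitely many. *)
have [c cP] := avoid_finite e [seq (x' - x) / (b - b') | x' <- tx, b' <- tb].
exists (x + c%:R * b) => s; rewrite rmorphD rmorphM /= nat_gal => eq.
have sb : s b = b.
  apply/eqP; apply: contraNT cP => nb; apply/allpairsP; exists (s x, s b); split=> //=.
  have nb' : b - s b != 0 by rewrite subr_eq0 eq_sym.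
  apply: (mulIf nb'); rewrite divfK //; move/eqP: eq; rewrite -subr_eq0 => /eqP eq.
  by apply/eqP; rewrite -subr_eq0 -oppr_eq0 -eq; apply/eqP; ring.
have sx : s x = x by move: eq; rewrite sb => /addIr.
by move=> y; rewrite inE => /predU1P[->//|]; exact: bX.
Qed.

(** Otherwise [s] would translate [b] by a nonzero rational number, and its iterates would give [b]
    infinitely many conjugates. *)
Lemma gal_translate (s : absgal i) b j k : s (b + j%:R) = b + k%:R -> j = k.
Proof.
rewrite rmorphD /= nat_gal => sb; apply/eqP; rewrite -(Num.Theory.eqr_nat rat) -subr_eq0.
rewrite -(fmorph_eq0 e); apply/negPn/negP => t0; set t := e _ in t0.
have {}sb : s b = b - t.
  by rewrite /t rmorphB !rmorph_nat opprB addrA -sb addrK.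
have [p pm pb] := alg b.
have pn n : root (map_poly i p) (b - n%:R * t).
  elim: n => [|n IHn]; first by rewrite mul0r subr0.
  have := conj_root s IHn; rewrite rmorphB rmorphM /= nat_gal sb e_gal -/t -natr1 => H.
  by have -> : b - (n%:R + 1) * t = b - t - n%:R * t by ring.
have p0 : map_poly i p != 0 by rewrite map_poly_eq0 monic_neq0.
have := max_poly_roots p0 (rs := [seq b - n%:R * t | n <- iota 0 (size (map_poly i p))]).
rewrite size_map size_iota ltnn => H; apply: notF; apply: H.
  by apply/allP => x /mapP[n _ ->].
rewrite map_inj_uniq ?iota_uniq // => m n /addrI/oppr_inj/(mulIf t0).
by rewrite -!(rmorph_nat e) => /fmorph_inj/eqP; rewrite Num.Theory.eqr_nat => /eqP.
Qed.

Lemma krull_continuous_stabilizer (T : choiceType) (f : absgal i -> T) :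
  continuous (f : absgal i -> discrete_topology T) ->
  exists X : seq L, forall r : absgal i, {in X, r =1 id} -> f r = f 1%g.
Proof.
move=> /(_ 1%g) fc; have : nbhs (f 1%g : discrete_topology T) [set f 1%g] by [].
move=> /fc; rewrite nbhsE => -[B [oB B1] Bf].
have [X HX] := (oB : absgal_open B) 1%g B1.
by exists X => r rX; apply: (Bf r); apply: HX.
Qed.

End Galois.

Lemma algebraic_over_rat (F : fieldExtType rat) (L : fieldType) (i : {rmorphism F -> L}) :
  integralRange i -> integralRange (i \o GRing.in_alg F).
Proof.
move=> alg z; have [p pm pz] := alg z; apply: (integral_root _ pz).
  by rewrite map_poly_eq0 monic_neq0.
move=> x /(nthP 0)[k _ <-]; rewrite coef_map /=; set a := p`_k.
have /polyOver1P[q qE] := minPolyOver 1%AS a.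
have q0 : q != 0.
  by have := monic_neq0 (monic_minPoly 1%AS a); rewrite qE map_poly_eq0.
have qr : root (map_poly (i \o GRing.in_alg F) q) (i a).
  by rewrite map_poly_comp fmorph_root -qE root_minPoly.
exists ((lead_coef q)^-1 *: q); first by rewrite monicE lead_coefZ mulVf ?lead_coef_eq0.
by rewrite map_polyZ rootZ // fmorph_eq0 invr_eq0 lead_coef_eq0.
Qed.

Lemma map_XsubC_nat (R S : nzRingType) (f : {rmorphism R -> S}) k :
  map_poly f ('X - k%:R%:P) = 'X - k%:R%:P.
Proof. by rewrite rmorphB /= map_polyX map_polyC /= rmorph_nat. Qed.

Theorem proposition1p1 (F : fieldExtType rat) (Fbar : closedFieldType)
    (i : {rmorphism F -> Fbar}) (Fbar_algebraic : integralRange i)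
    (bp : tangential_base_point F)
    (d : nat) (rho : absgal i -> 'M[rat]_d)
    (rho_rep : is_representation rho)
    (rho_cont : continuous (rho : absgal i -> discrete_topology 'M[rat]_d))
    (rho_fin : finite_set (range rho)) :
  embeds_in_Func_loc_const bp rho.
Proof.
case: rho_rep => rhoU rhoM; pose e : {rmorphism rat -> Fbar} := i \o GRing.in_alg F.
have e_gal (s : absgal i) a : s (e a) = e a by exact: gal_fix.
have rho1 : rho 1%g = 1%:M.
  by rewrite -[LHS](mulKmx (rhoU 1%g)) -rhoM mulg1 mulVmx.
have [X HX] := krull_continuous_stabilizer rho_cont.
have [b bX] := primitive_element e Fbar_algebraic X.
have rho_stab (s r : absgal i) : s b = r b -> rho (s^-1)%g = rho (r^-1)%g.
  move=> sr; have := HX (s^-1 * r)%g; rewrite rhoM rho1 => /(_ _) E.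
  have {}E : rho (s^-1)%g *m rho r = 1%:M.
    apply: E; apply: bX; rewrite -[LHS]/((s^-1)%g (r b)) -sr; exact: Defs.galK.
  rewrite -[LHS]mulmx1 -rho1 -(mulgV r) rhoM mulmxA E mul1mx //.
have b_dist (s r : absgal i) (k l : 'I_d) : s (b + k%:R) = r (b + l%:R) -> k = l /\ s b = r b.
  move=> skl; have kl : k = l.
    apply/val_inj/(@gal_translate _ _ i e Fbar_algebraic e_gal (r^-1 * s)%g b).
    by rewrite -[LHS]/((r^-1)%g (s _)) skl; exact: Defs.galK.
  split=> //; move: skl; rewrite kl !rmorphD /= !rmorph_nat; exact: addIr.
pose orb x (sk : absgal i * 'I_d) := x = sk.1 (b + sk.2%:R).
(* The choice of the pair is immaterial: [b_dist] recovers k and s b from the point s (b + k), and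
   by [rho_stab] the matrix of s^-1 depends only on s b. *)
pose G x (u : 'cV[rat]_d) : rat := if pselect (exists sk, orb x sk) is left h then
  (rho ((sval (cid h)).1^-1)%g *m u) (sval (cid h)).2 0 else 0.
have GE (s : absgal i) (k : 'I_d) u : G (s (b + k%:R)) u = (rho (s^-1)%g *m u) k 0.
  rewrite /G; case: pselect => [h|[]]; last by exists (s, k).
  by case: (cid h) => -[r l] /= /b_dist[-> /rho_stab ->].
have G0 x u : ~ (exists sk, orb x sk) -> G x u = 0 by rewrite /G; case: pselect.
have [q qm qb] := algebraic_over_rat Fbar_algebraic b.
(* Belyi's construction starts from a polynomial over the rational numbers, so the minimal data is
   an equation [q] of [b] over them; its translates together vanish at all the points b + k. *)
pose m := \prod_(k < d) (q \Po ('X - k%:R%:P)).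
have m0 : m != 0.
  apply/prodf_neq0 => k _; rewrite comp_poly2_eq0 ?monic_neq0 //; exact: size_XsubC.
have mb (k : 'I_d) : root (map_poly e m) (b + k%:R).
  rewrite rmorph_prod /root horner_prod; apply/prodf_eq0; exists k => //=.
  by rewrite map_comp_poly map_XsubC_nat horner_comp hornerXsubC addrK.
have [alpha [aloc asurj aact]] := equivariant_function bp e_gal m0.
exists (fun u g => G (alpha g) u); split.
- move=> u g; have [U [oU Ug Uc]] := aloc g; exists U; split=> // h /Uc; by move=> ->.
- move=> a u v; apply: funext => g; rewrite /G; case: pselect => [h|_]; last by rewrite mulr0 addr0.
  by rewrite mulmxDr -scalemxAr !mxE.
- move=> u v uv; apply/colP => k; have [g gE] := asurj _ (mb k).
  have := congr1 (@^~ g) uv; rewrite /= gE -[b + _]/((1%g : absgal i) _) !GE.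
  by rewrite invg1 rho1 !mul1mx.
move=> s u; apply: funext => g; rewrite /func_act aact.
have [[[r k] xE]|none] := pselect (exists sk, orb (alpha g) sk).
  have yE : (s^-1)%g (alpha g) = (s^-1 * r)%g (b + k%:R) by rewrite xE.
  by rewrite yE xE !GE invgM invgK mulmxA -rhoM.
rewrite !G0 // => -[[r k] /= xE]; apply: none; exists ((s * r)%g, k).
by rewrite /orb /= -[RHS]/(s (r _)) -xE; exact: esym (Defs.galVK s _).
Qed.
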